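(* Let $\mathcal{C}$ be a non-degenerate pivotal fusion category over an algebraically closed field $k$, let $U:\mathcal{Z}(\mathcal{C})\to\mathcal{C}$ be the forgetful functor from the monoidal (Drinfeld) center, and let $R$ be a right adjoint of $U$. Then the following assertions are equivalent: (1) $R(\mathbf{1})\in\mathcal{Z}(\mathcal{C})$ is multiplicity-free. (2) The algebra $\mathsf{Gr}_k(\mathcal{C})$ is commutative.
   Context: A finite tensor category over $k$ is a rigid monoidal category that is, as a $k$-linear category, equivalent to the category of finite-dimensional modules over a finite-dimensional $k$-algebra, with $\otimes$ $k$-linear in each variable and $\mathrm{End}(\mathbf{1})\cong k$. A fusion category is a semisimple finite tensor category. A pivotal structure is an isomorphism $j:\mathrm{id}_{\mathcal{C}}\to(-)^{**}$ of monoidal functors ($X^*$ is the left dual, with $\mathrm{ev}_X:X^*\otimes X\to\mathbf{1}$, $\mathrm{coev}_X:\mathbf{1}\to X\otimes X^*$). The pivotal dimension is $\dim(X)=\mathrm{ev}_{X^*}\circ(j_X\otimes\mathrm{id}_{X^*})\circ\mathrm{coev}_X\in\mathrm{End}(\mathbf{1})=k$. With $V_0=\mathbf{1},\dots,V_m$ representatives of the isomorphism classes of simple objects, $\dim(\mathcal{C})=\sum_{i=0}^m\dim(V_i^* )\dim(V_i)\in k$, and $\mathcal{C}$ is non-degenerate if $\dim(\mathcal{C})\ne0$ in $k$. Under this assumption $\mathcal{Z}(\mathcal{C})$ is semisimple. $\mathsf{Gr}_k(\mathcal{C})=k\otimes_{\mathbb{Z}}\mathsf{Gr}(\mathcal{C})$,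 where $\mathsf{Gr}(\mathcal{C})$ is the Grothendieck ring, $[V]\cdot[W]=[V\otimes W]$. A semisimple object is multiplicity-free if it is a direct sum of pairwise non-isomorphic simple objects. The center $\mathcal{Z}(\mathcal{C})$ has objects $(V,\sigma)$ with $V\in\mathcal{C}$ and $\sigma_X:V\otimes X\to X\otimes V$ a natural isomorphism satisfying $\sigma_{X\otimes Y}=(\mathrm{id}_X\otimes\sigma_Y)\circ(\sigma_X\otimes\mathrm{id}_Y)$; morphisms are morphisms of $\mathcal{C}$ compatible with the $\sigma$'s. The right adjoint $R$ exists. *)

(* Defs.v *)
From HB Require Import structures.
From mathcomp Require Import all_boot all_order all_algebra all_field.
From mathcomp Require Import boolp.

Set Implicit Arguments.
Unset Strict Implicit.
Unset Printing Implicit Defensive.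
Import GRing.Theory.
Local Open Scope ring_scope.
Local Open Scope quotient_scope.

Declare Scope cat_scope.
Delimit Scope cat_scope with cat.

Record linCat (k : fieldType) := LinCat {
  obj :> Type;
  hom : obj -> obj -> lmodType k;
  idm : forall X, hom X X;
  comp : forall X Y Z, hom Y Z -> hom X Y -> hom X Z;
  compA : forall X Y Z W (h : hom Z W) (g : hom Y Z) (f : hom X Y),
    comp h (comp g f) = comp (comp h g) f;
  comp1m : forall X Y (f : hom X Y), comp (idm Y) f = f;
  compm1 : forall X Y (f : hom X Y), comp f (idm X) = f;
  comp_linl : forall X Y Z (f : hom X Y), linear (fun g : hom Y Z => comp g f);
  comp_linr : forall X Y Z (g : hom Y Z), linear (fun f : hom X Y => comp g f)
}.

Arguments hom {k l} _ _.
Arguments idm {k l} _.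
Arguments comp {k l X Y Z} _ _.
Notation "g ∘ f" := (comp g f) (at level 40, left associativity) : cat_scope.
Local Open Scope cat_scope.

Lemma linear_zero (k : fieldType) (A B : lmodType k) (f : A -> B) :
  linear f -> f 0 = 0.
Proof.
move=> lf; apply/eqP; rewrite -(inj_eq (addrI (f 0))) addr0.
by have := lf 1 0 0; rewrite /= !scale1r addr0 => <-.
Qed.

Section CategoricalNotions.
Variables (k : fieldType) (C : linCat k).
Implicit Types X Y Z : C.

Definition inverse X Y (f : hom X Y) (g : hom Y X) : Prop :=
  g ∘ f = idm X /\ f ∘ g = idm Y.

Definition is_iso X Y (f : hom X Y) : Prop := exists g, inverse f g.

Definition isomorphic X Y : Prop := exists f : hom X Y, is_iso f.

Definition monic X Y (f : hom X Y) : Prop :=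
  forall W (g h : hom W X), f ∘ g = f ∘ h -> g = h.

Definition is_zero X : Prop := idm X = 0.

Definition simple X : Prop :=
  ~ is_zero X /\
  forall Y (f : hom Y X), monic f -> is_zero Y \/ is_iso f.

Definition is_direct_sum n (S : 'I_n -> C) X : Prop :=
  exists (i : forall a, hom (S a) X) (p : forall a, hom X (S a)),
    [/\ forall a, p a ∘ i a = idm (S a),
        forall a b, a <> b -> p b ∘ i a = 0
      & \sum_a (i a ∘ p a) = idm X].

Definition semisimple_obj X : Prop :=
  exists n (S : 'I_n -> C), (forall a, simple (S a)) /\ is_direct_sum S X.

Definition multiplicity_free X : Prop :=
  exists n (S : 'I_n -> C),
    [/\ forall a, simple (S a),
        forall a b, a <> b -> ~ isomorphic (S a) (S b)
      & is_direct_sum S X].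

Definition is_kernel X Y Z (f : hom X Y) (g : hom Y Z) : Prop :=
  g ∘ f = 0 /\
  forall W (h : hom W Y), g ∘ h = 0 -> exists! u : hom W X, f ∘ u = h.

Definition is_cokernel X Y Z (f : hom X Y) (g : hom Y Z) : Prop :=
  g ∘ f = 0 /\
  forall W (h : hom Y W), h ∘ f = 0 -> exists! u : hom Z W, u ∘ g = h.

Definition short_exact X Y Z (f : hom X Y) (g : hom Y Z) : Prop :=
  is_kernel f g /\ is_cokernel f g.

End CategoricalNotions.

Record functor (k : fieldType) (C D : linCat k) := Functor {
  fobj :> C -> D;
  fmap : forall X Y, hom X Y -> hom (fobj X) (fobj Y);
  fmap1 : forall X, fmap (idm X) = idm (fobj X);
  fmapM : forall X Y Z (g : hom Y Z) (f : hom X Y),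
    fmap (g ∘ f) = fmap g ∘ fmap f
}.

Definition linear_functor (k : fieldType) (C D : linCat k) (F : functor C D) :=
  forall X Y, linear (@fmap k C D F X Y).

Definition equivalent (k : fieldType) (C D : linCat k) : Prop :=
  exists (F : functor C D) (G : functor D C)
         (eta : forall X : C, hom X (G (F X)))
         (eps : forall Y : D, hom (F (G Y)) Y),
    [/\ linear_functor F /\ linear_functor G,
        forall X Y (f : hom X Y), eta Y ∘ f = fmap G (fmap F f) ∘ eta X,
        forall X, is_iso (eta X),
        forall X Y (f : hom X Y), f ∘ eps X = eps Y ∘ fmap F (fmap G f)
      & forall Y, is_iso (eps Y)].

Definition right_adjoint (k : fieldType) (D C : linCat k)
    (U : functor D C) (R : functor C D) : Prop :=
  exists (eta : forall X : D, hom X (R (U X)))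
         (eps : forall Y : C, hom (U (R Y)) Y),
    [/\ forall X Y (f : hom X Y), eta Y ∘ f = fmap R (fmap U f) ∘ eta X,
        forall X Y (f : hom X Y), f ∘ eps X = eps Y ∘ fmap U (fmap R f),
        forall X, eps (U X) ∘ fmap U (eta X) = idm (U X)
      & forall Y, fmap R (eps Y) ∘ eta (R Y) = idm (R Y)].

Section SubLmod.
Variables (k : fieldType) (V : lmodType k) (P : V -> Prop).

Definition submod_prop : Prop :=
  P 0 /\ forall (a : k) u v, P u -> P v -> P (a *: u + v).

Hypothesis Psub : submod_prop.

Definition submod_pred of submod_prop := [pred v : V | `[< P v >]].

Lemma submod_pred_closed : submod_closed (submod_pred Psub).
Proof.
case: (Psub) => P0 PD; split; first exact/asboolP.
by move=> a u v /asboolP Pu /asboolP Pv; apply/asboolP/PD.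
Qed.

HB.instance Definition _ :=
  GRing.isSubmodClosed.Build k V (submod_pred Psub) submod_pred_closed.

Record sublmod : Type := SubLmod {
  sublmod_val :> V;
  sublmod_valP : sublmod_val \in submod_pred Psub
}.

HB.instance Definition _ := [isSub for sublmod_val].
HB.instance Definition _ := [Choice of sublmod by <:].
HB.instance Definition _ := [SubChoice_isSubLmodule of sublmod by <:].

Definition mk_sublmod v (Pv : P v) : sublmod :=
  SubLmod (introT (asboolP (P v)) Pv : v \in submod_pred Psub).

Lemma sublmodP (u : sublmod) : P u.
Proof. by case: u => v /= /asboolP. Qed.

Lemma sublmod_inj (u v : sublmod) : u = v :> V -> u = v.
Proof. exact: val_inj. Qed.

End SubLmod.

(* A finite-dimensional left module is given in coordinates, as a space of
   column vectors k^n on which the algebra acts by matrices.  This loses no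
   module up to isomorphism, and keeps the type of modules small, which the
   universe constraints of the algebraic hierarchy demand. *)
Record fdModule (k : fieldType) (A : falgType k) := FdModule {
  mdim : nat;
  mact : A -> 'M[k]_mdim;
  mact_linear : linear mact;
  mact1 : mact 1 = 1%:M;
  mactM : forall a b, mact (a * b) = mact a *m mact b
}.

Section ModuleCategory.
Variables (k : fieldType) (A : falgType k).
Implicit Types M N P : fdModule A.

Definition module_morphism M N (f : 'M[k]_(mdim N, mdim M)) : Prop :=
  forall a, f *m mact M a = mact N a *m f.

Lemma module_morphism_submod M N : submod_prop (@module_morphism M N).
Proof.
split=> [a|c f g Pf Pg a]; first by rewrite mul0mx mulmx0.
by rewrite mulmxDl mulmxDr -scalemxAl -scalemxAr Pf Pg.
Qed.

Definition module_hom M N : Type := sublmod (module_morphism_submod M N).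

Lemma module_id_subproof M : @module_morphism M M 1%:M.
Proof. by move=> a; rewrite mul1mx mulmx1. Qed.

Lemma module_comp_subproof M N P (g : module_hom N P) (f : module_hom M N) :
  @module_morphism M P (sublmod_val g *m sublmod_val f).
Proof.
by move=> a; rewrite -mulmxA (sublmodP f) mulmxA (sublmodP g) mulmxA.
Qed.

Definition module_id M : module_hom M M :=
  mk_sublmod _ (@module_id_subproof M).
Definition module_comp M N P (g : module_hom N P) (f : module_hom M N) :
  module_hom M P := mk_sublmod _ (module_comp_subproof g f).

Definition fdModuleCat : linCat k.
Proof.
refine (@LinCat k (fdModule A)
  (fun M N => sublmod (module_morphism_submod M N))
  module_id module_comp _ _ _ _ _).
- by move=> X Y Z W h g f; apply/val_inj/mulmxA.
- by move=> X Y f; apply/val_inj/mul1mx.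
- by move=> X Y f; apply/val_inj/mulmx1.
- by move=> X Y Z f a u v; apply/val_inj; rewrite /= mulmxDl scalemxAl.
- by move=> X Y Z g a u v; apply/val_inj; rewrite /= mulmxDr scalemxAr.
Defined.

End ModuleCategory.

Reserved Notation "X ⊗ Y" (at level 39, left associativity).
Reserved Notation "f ⊠ g" (at level 39, left associativity).

(* Not assumed strict: [assoc], [lunit] and [runit] are inserted wherever
   textbook formulas suppress them. *)
Record monCat (k : fieldType) := MonCat {
  mcat :> linCat k;
  tunit : mcat;
  tens : mcat -> mcat -> mcat
    where "X ⊗ Y" := (tens X Y);
  tensm : forall X X' Y Y', hom X X' -> hom Y Y' -> hom (X ⊗ Y) (X' ⊗ Y')
    where "f ⊠ g" := (tensm f g);
  assoc : forall X Y Z, hom ((X ⊗ Y) ⊗ Z) (X ⊗ (Y ⊗ Z));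
  assocV : forall X Y Z, hom (X ⊗ (Y ⊗ Z)) ((X ⊗ Y) ⊗ Z);
  lunit : forall X, hom (tunit ⊗ X) X;
  lunitV : forall X, hom X (tunit ⊗ X);
  runit : forall X, hom (X ⊗ tunit) X;
  runitV : forall X, hom X (X ⊗ tunit);
  tensm_linl : forall X X' Y Y' (g : hom Y Y'),
    linear (fun f : hom X X' => f ⊠ g);
  tensm_linr : forall X X' Y Y' (f : hom X X'),
    linear (fun g : hom Y Y' => f ⊠ g);
  tensm1 : forall X Y, idm X ⊠ idm Y = idm (X ⊗ Y);
  tensmM : forall X X' X'' Y Y' Y'' (f' : hom X' X'') (f : hom X X')
      (g' : hom Y' Y'') (g : hom Y Y'),
    (f' ∘ f) ⊠ (g' ∘ g) = (f' ⊠ g') ∘ (f ⊠ g);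
  assocP : forall X Y Z, inverse (assoc X Y Z) (assocV X Y Z);
  lunitP : forall X, inverse (lunit X) (lunitV X);
  runitP : forall X, inverse (runit X) (runitV X);
  assoc_nat : forall X X' Y Y' Z Z'
      (f : hom X X') (g : hom Y Y') (h : hom Z Z'),
    assoc X' Y' Z' ∘ ((f ⊠ g) ⊠ h) = (f ⊠ (g ⊠ h)) ∘ assoc X Y Z;
  lunit_nat : forall X Y (f : hom X Y),
    lunit Y ∘ (idm tunit ⊠ f) = f ∘ lunit X;
  runit_nat : forall X Y (f : hom X Y),
    runit Y ∘ (f ⊠ idm tunit) = f ∘ runit X;
  pentagon : forall X Y Z W,
    assoc X Y (Z ⊗ W) ∘ assoc (X ⊗ Y) Z W =
    (idm X ⊠ assoc Y Z W) ∘ assoc X (Y ⊗ Z) W ∘ (assoc X Y Z ⊠ idm W);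
  triangle : forall X Y,
    (idm X ⊠ lunit Y) ∘ assoc X tunit Y = runit X ⊠ idm Y
}.

Arguments tunit {k} _.
Arguments tens {k m} _ _.
Arguments tensm {k m X X' Y Y'} _ _.
Arguments assoc {k m} _ _ _.
Arguments assocV {k m} _ _ _.
Arguments lunit {k m} _.
Arguments lunitV {k m} _.
Arguments runit {k m} _.
Arguments runitV {k m} _.
Notation "X ⊗ Y" := (tens X Y) : cat_scope.
Notation "f ⊠ g" := (tensm f g) : cat_scope.

(* [D] with evaluation [e] and coevaluation [c] is a left dual of [X]. *)
Definition is_left_dual (k : fieldType) (C : monCat k) (X D : C)
    (e : hom (D ⊗ X) (tunit C)) (c : hom (tunit C) (X ⊗ D)) : Prop :=
  runit X ∘ (idm X ⊠ e) ∘ assoc X D X ∘ (c ⊠ idm X) ∘ lunitV X = idm X /\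
  lunit D ∘ (e ⊠ idm D) ∘ assocV D X D ∘ (idm D ⊠ c) ∘ runitV D = idm D.

(* [Y] is a right dual of [X] when [X] is a left dual of [Y]. *)
Record rigidCat (k : fieldType) := RigidCat {
  rmon :> monCat k;
  dual : rmon -> rmon;
  ev : forall X, hom (dual X ⊗ X) (tunit rmon);
  coev : forall X, hom (tunit rmon) (X ⊗ dual X);
  dualP : forall X, is_left_dual (ev X) (coev X);
  right_dual : forall X, exists Y e c, @is_left_dual k rmon Y X e c
}.

Arguments dual {k r} _.
Arguments ev {k r} _.
Arguments coev {k r} _.

Record finTensorCat (k : fieldType) := FinTensorCat {
  frigid :> rigidCat k;
  fin_modules : exists A : falgType k, equivalent frigid (fdModuleCat A);
  (* The inverse of the unit map k -> End(1) of the algebra End(1). *)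
  scalar : hom (tunit frigid) (tunit frigid) -> k;
  scalarK : forall f, scalar f *: idm (tunit frigid) = f;
  scalarZ : forall a : k, scalar (a *: idm (tunit frigid)) = a
}.

Arguments scalar {k f0} _.

Record fusionCat (k : fieldType) := FusionCat {
  ffin :> finTensorCat k;
  fsemisimple : forall X : ffin, semisimple_obj X
}.

Section Duality.
Variables (k : fieldType) (C : rigidCat k).
Implicit Types X Y : C.

Definition transpose X Y X' Y' (c : hom (tunit C) (X ⊗ X'))
    (e : hom (Y' ⊗ Y) (tunit C)) (f : hom X Y) : hom Y' X' :=
  lunit X' ∘ (e ⊠ idm X') ∘ ((idm Y' ⊠ f) ⊠ idm X') ∘ assocV Y' X X'
    ∘ (idm Y' ⊠ c) ∘ runitV Y'.

Definition dualm X Y (f : hom X Y) : hom (dual Y) (dual X) :=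
  transpose (coev X) (ev Y) f.

Definition ev_tens X Y : hom ((dual Y ⊗ dual X) ⊗ (X ⊗ Y)) (tunit C) :=
  ev Y ∘ (idm (dual Y) ⊠ (lunit Y ∘ (ev X ⊠ idm Y) ∘ assocV (dual X) X Y))
    ∘ assoc (dual Y) (dual X) (X ⊗ Y).

(* The canonical isomorphisms Y^* ⊗ X^* -> (X ⊗ Y)^* and 1 -> 1^*. *)
Definition dual_tens X Y : hom (dual Y ⊗ dual X) (dual (X ⊗ Y)) :=
  transpose (coev (X ⊗ Y)) (ev_tens X Y) (idm (X ⊗ Y)).

Definition dual_unit : hom (tunit C) (dual (tunit C)) :=
  transpose (coev (tunit C)) (lunit (tunit C)) (idm (tunit C)).

(* The monoidal structure X^** ⊗ Y^** -> (X ⊗ Y)^** of the double dual is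
   ((dual_tens X Y)^-1)^* ∘ dual_tens Y^* X^*, and its unit part 1 -> 1^** is
   (dual_unit^-1)^* ∘ dual_unit; in [pivotal_tens] and [pivotal_unit] the
   inverses are moved to the other side. *)
Record pivotal := Pivotal {
  piv : forall X, hom X (dual (dual X));
  piv_iso : forall X, is_iso (piv X);
  piv_nat : forall X Y (f : hom X Y), piv Y ∘ f = dualm (dualm f) ∘ piv X;
  pivotal_tens : forall X Y,
    dualm (dual_tens X Y) ∘ piv (X ⊗ Y) =
    dual_tens (dual Y) (dual X) ∘ (piv X ⊠ piv Y);
  pivotal_unit : dualm dual_unit ∘ piv (tunit C) = dual_unit
}.

End Duality.

Section Dimension.
Variables (k : fieldType) (C : finTensorCat k) (j : pivotal C).

Definition pdim (X : C) : k :=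
  scalar (ev (dual X) ∘ (piv j X ⊠ idm (dual X)) ∘ coev X).

Definition simple_representatives m (V : 'I_m.+1 -> C) : Prop :=
  [/\ V ord0 = tunit C,
      forall i, simple (V i),
      forall i i', i <> i' -> ~ isomorphic (V i) (V i')
    & forall X, simple X -> exists i, isomorphic X (V i)].

(* The sum does not depend on the choice of the representatives. *)
Definition nondegenerate_pivotal : Prop :=
  exists m (V : 'I_m.+1 -> C), simple_representatives V /\
    \sum_i pdim (dual (V i)) * pdim (V i) <> 0.

End Dimension.

Section Center.
Variables (k : fieldType) (C : monCat k).

Record centerObj := CenterObj {
  cobj :> C;
  hbraid : forall X, hom (cobj ⊗ X) (X ⊗ cobj);
  hbraid_iso : forall X, is_iso (hbraid X);
  hbraid_nat : forall X Y (f : hom X Y),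
    hbraid Y ∘ (idm cobj ⊠ f) = (f ⊠ idm cobj) ∘ hbraid X;
  hbraid_tens : forall X Y,
    hbraid (X ⊗ Y) =
    assocV X Y cobj ∘ (idm X ⊠ hbraid Y) ∘ assoc X cobj Y
      ∘ (hbraid X ⊠ idm Y) ∘ assocV cobj X Y
}.

Implicit Types V W : centerObj.

Definition center_morphism V W (f : hom (cobj V) (cobj W)) : Prop :=
  forall X, hbraid W X ∘ (f ⊠ idm X) = (idm X ⊠ f) ∘ hbraid V X.

Lemma center_morphism_submod V W : submod_prop (@center_morphism V W).
Proof.
split=> [X|a f g Pf Pg X].
  have /= -> := linear_zero (@tensm_linl k C V W X X (idm X)).
  have /= -> := linear_zero (@tensm_linr k C X X V W (idm X)).
  have /= -> := linear_zero (@comp_linl k C _ _ (X ⊗ W) (hbraid V X)).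
  by have /= -> := linear_zero (@comp_linr k C (V ⊗ X) _ _ (hbraid W X)).
have /= -> := tensm_linl (idm X) a f g.
have /= -> := tensm_linr (idm X) a f g.
have /= -> := comp_linl (hbraid V X) a (idm X ⊠ f) (idm X ⊠ g).
have /= -> := comp_linr (hbraid W X) a (f ⊠ idm X) (g ⊠ idm X).
by rewrite Pf Pg.
Qed.

Definition center_hom V W : Type := sublmod (center_morphism_submod V W).

Lemma center_id_subproof V : center_morphism (idm (cobj V)).
Proof. by move=> X; rewrite !tensm1 comp1m compm1. Qed.

Lemma center_comp_subproof U V W (g : center_hom V W) (f : center_hom U V) :
  center_morphism (sublmod_val g ∘ sublmod_val f).
Proof.
move=> X; rewrite -[idm X]comp1m !tensmM compA (sublmodP g) -compA.
by rewrite (sublmodP f) compA.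
Qed.

Definition center_id V : center_hom V V := mk_sublmod _ (@center_id_subproof V).
Definition center_comp U V W (g : center_hom V W) (f : center_hom U V) :
  center_hom U W := mk_sublmod _ (center_comp_subproof g f).

Definition drinfeldCenter : linCat k.
Proof.
refine (@LinCat k centerObj (fun V W => sublmod (center_morphism_submod V W))
  center_id center_comp _ _ _ _ _).
- by move=> X Y Z W h g f; apply/val_inj/compA.
- by move=> X Y f; apply/val_inj/comp1m.
- by move=> X Y f; apply/val_inj/compm1.
- by move=> X Y Z f a u v; apply/val_inj/comp_linl.
- by move=> X Y Z g a u v; apply/val_inj/comp_linr.
Defined.

Definition forget : functor drinfeldCenter C.
Proof.
by refine (@Functor k drinfeldCenter C cobj
  (fun V W (f : center_hom V W) => sublmod_val f) _ _).
Defined.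

End Center.

Section LinearityLemmas.
Variables (k : fieldType) (C : monCat k).

Lemma comp0m (X Y Z : C) (f : hom X Y) : (0 : hom Y Z) ∘ f = 0.
Proof. exact: (linear_zero (@comp_linl k C X Y Z f)). Qed.

Lemma compm0 (X Y Z : C) (g : hom Y Z) : g ∘ (0 : hom X Y) = 0.
Proof. exact: (linear_zero (@comp_linr k C X Y Z g)). Qed.

Lemma tens0m (X X' Y Y' : C) (g : hom Y Y') : (0 : hom X X') ⊠ g = 0.
Proof. exact: (linear_zero (@tensm_linl k C X X' Y Y' g)). Qed.

Lemma tensml (X X' X'' Y : C) (f' : hom X' X'') (f : hom X X') :
  (f' ∘ f) ⊠ idm Y = (f' ⊠ idm Y) ∘ (f ⊠ idm Y).
Proof. by rewrite -tensmM comp1m. Qed.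

Lemma tensmr (X Y Y' Y'' : C) (f' : hom Y' Y'') (f : hom Y Y') :
  idm X ⊠ (f' ∘ f) = (idm X ⊠ f') ∘ (idm X ⊠ f).
Proof. by rewrite -tensmM comp1m. Qed.

Lemma tensm_swap (X X' Y Y' : C) (f : hom X X') (g : hom Y Y') :
  (f ⊠ idm Y') ∘ (idm X ⊠ g) = (idm X' ⊠ g) ∘ (f ⊠ idm Y).
Proof. by rewrite -!tensmM !compm1 !comp1m. Qed.

Lemma assocK (X Y Z : C) : assocV X Y Z ∘ assoc X Y Z = idm _.
Proof. by case: (assocP X Y Z). Qed.
Lemma assocVK (X Y Z : C) : assoc X Y Z ∘ assocV X Y Z = idm _.
Proof. by case: (assocP X Y Z). Qed.
Lemma runitK (X : C) : runitV X ∘ runit X = idm _.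
Proof. by case: (runitP X). Qed.
Lemma runitVK (X : C) : runit X ∘ runitV X = idm _.
Proof. by case: (runitP X). Qed.
Lemma lunitK (X : C) : lunitV X ∘ lunit X = idm _.
Proof. by case: (lunitP X). Qed.
Lemma lunitVK (X : C) : lunit X ∘ lunitV X = idm _.
Proof. by case: (lunitP X). Qed.

Lemma inverse_epi (X Y Z : C) (f : hom X Y) (f' : hom Y X) (g h : hom Y Z) :
  inverse f f' -> g ∘ f = h ∘ f -> g = h.
Proof. by case=> _ ff' e; rewrite -[g]compm1 -ff' compA e -compA ff' compm1. Qed.

Lemma inverse_mono (X Y Z : C) (f : hom X Y) (f' : hom Y X) (g h : hom Z X) :
  inverse f f' -> f ∘ g = f ∘ h -> g = h.
Proof. by case=> f'f _ e; rewrite -[g]comp1m -f'f -compA e compA f'f comp1m. Qed.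

Lemma assocV_nat (X X' Y Y' Z Z' : C)
    (f : hom X X') (g : hom Y Y') (h : hom Z Z') :
  assocV X' Y' Z' ∘ (f ⊠ (g ⊠ h)) = ((f ⊠ g) ⊠ h) ∘ assocV X Y Z.
Proof.
apply: (inverse_epi (assocP _ _ _)); apply: (inverse_mono (assocP _ _ _)).
rewrite -!compA assocK compm1 -assoc_nat !compA assocVK comp1m; done.
Qed.

Lemma runitV_nat (X Y : C) (f : hom X Y) :
  runitV Y ∘ f = (f ⊠ idm (tunit C)) ∘ runitV X.
Proof.
apply: (inverse_mono (runitP _)).
by rewrite !compA runitVK comp1m runit_nat -compA runitVK compm1.
Qed.

Lemma lunitV_nat (X Y : C) (f : hom X Y) :
  lunitV Y ∘ f = (idm (tunit C) ⊠ f) ∘ lunitV X.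
Proof.
apply: (inverse_mono (lunitP _)).
by rewrite !compA lunitVK comp1m lunit_nat -compA lunitVK compm1.
Qed.

Lemma runit_tens (X Y : C) :
  runit (X ⊗ Y) = (idm X ⊠ runit Y) ∘ assoc X Y (tunit C).
Proof.
have faithful (A B : C) (f g : hom A B) :
    f ⊠ idm (tunit C) = g ⊠ idm (tunit C) -> f = g.
  move=> e; apply: (inverse_epi (runitP _)).
  by rewrite -!runit_nat e.
apply: faithful; apply: (inverse_mono (assocP X Y (tunit C))).
have swap : assoc X Y (tunit C) ∘ (idm (X ⊗ Y) ⊠ lunit (tunit C)) =
    (idm X ⊠ (idm Y ⊠ lunit (tunit C))) ∘ assoc X Y _.
  by rewrite -tensm1 assoc_nat.
rewrite -triangle compA swap -compA pentagon tensml [in RHS]compA assoc_nat.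
by rewrite -triangle tensmr !compA.
Qed.

End LinearityLemmas.

Section DualAdjunction.
Variables (k : fieldType) (C : monCat k) (A B : C).
Variables (e : hom (B ⊗ A) (tunit C)) (c : hom (tunit C) (A ⊗ B)).
Hypothesis AB : is_left_dual e c.
Implicit Types V X Y Z : C.

Let eta V : hom V (V ⊗ A ⊗ B) := assocV V A B ∘ (idm V ⊠ c) ∘ runitV V.
Let eps Y : hom (Y ⊗ B ⊗ A) Y := runit Y ∘ (idm Y ⊠ e) ∘ assoc Y B A.

Lemma eta_nat X Y (f : hom X Y) :
  eta Y ∘ f = ((f ⊠ idm A) ⊠ idm B) ∘ eta X.
Proof.
rewrite /eta -!compA runitV_nat [in RHS]compA -assocV_nat tensm1 -[in RHS]compA.
by congr (_ ∘ _); rewrite compA -tensm_swap -compA.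
Qed.

Lemma eps_nat X Y (f : hom X Y) :
  eps Y ∘ ((f ⊠ idm B) ⊠ idm A) = f ∘ eps X.
Proof.
rewrite /eps -!compA assoc_nat tensm1 !compA; congr (_ ∘ _).
by rewrite -runit_nat -!compA tensm_swap.
Qed.

Lemma triangle1 V : eps (V ⊗ A) ∘ (eta V ⊠ idm A) = idm (V ⊗ A).
Proof.
have pent : assoc (V ⊗ A) B A ∘ (assocV V A B ⊠ idm A) =
    assocV V A (B ⊗ A) ∘ (idm V ⊠ assoc A B A) ∘ assoc V (A ⊗ B) A.
  apply: (inverse_mono (assocP _ _ _)).
  rewrite !compA pentagon assocVK comp1m -compA -tensml assocVK tensm1.
  by rewrite compm1.
have head : runit (V ⊗ A) ∘ (idm (V ⊗ A) ⊠ e) ∘ assocV V A (B ⊗ A) =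
    idm V ⊠ (runit A ∘ (idm A ⊠ e)).
  rewrite -tensm1 -compA -assocV_nat runit_tens compA -[_ ∘ _ ∘ assocV _ _ _]compA.
  by rewrite assocVK compm1 -tensmr.
have tail : assoc V (A ⊗ B) A ∘ ((idm V ⊠ c) ⊠ idm A) ∘ (runitV V ⊠ idm A) =
    idm V ⊠ ((c ⊠ idm A) ∘ lunitV A).
  rewrite assoc_nat tensmr -compA; congr (_ ∘ _).
  have inv : idm V ⊠ lunit A ∘ (idm V ⊠ lunitV A) = idm (V ⊗ A).
    by rewrite -tensmr lunitVK tensm1.
  have inv' : idm V ⊠ lunitV A ∘ (idm V ⊠ lunit A) = idm (V ⊗ (tunit C ⊗ A)).
    by rewrite -tensmr lunitK tensm1.
  apply: (inverse_mono (conj inv' inv)).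
  by rewrite inv compA triangle -tensml runitVK tensm1.
rewrite /eps /eta !tensml !compA.
rewrite -[_ ∘ _ ∘ (assocV _ _ _ ⊠ _)]compA pent !compA head.
rewrite -!compA [assoc V _ A ∘ _]compA tail -!tensmr !compA.
by case: AB => -> _; exact: tensm1.
Qed.

Lemma triangle2 Y : (eps Y ⊠ idm B) ∘ eta (Y ⊗ B) = idm (Y ⊗ B).
Proof.
have pent : (assoc Y B A ⊠ idm B) ∘ assocV (Y ⊗ B) A B =
    assocV Y (B ⊗ A) B ∘ (idm Y ⊠ assocV B A B) ∘ assoc Y B (A ⊗ B).
  apply: (inverse_mono (assocP _ _ _)); rewrite !compA assocVK comp1m.
  have inv : idm Y ⊠ assoc B A B ∘ (idm Y ⊠ assocV B A B) = idm _.
    by rewrite -tensmr assocVK tensm1.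
  have inv' : idm Y ⊠ assocV B A B ∘ (idm Y ⊠ assoc B A B) = idm _.
    by rewrite -tensmr assocK tensm1.
  apply: (inverse_mono (conj inv' inv)).
  by rewrite !compA -pentagon inv comp1m -compA assocVK compm1.
have head : (runit Y ⊠ idm B) ∘ ((idm Y ⊠ e) ⊠ idm B) ∘ assocV Y (B ⊗ A) B =
    idm Y ⊠ (lunit B ∘ (e ⊠ idm B)).
  rewrite -compA -assocV_nat compA tensmr; congr (_ ∘ _).
  by rewrite -triangle -compA assocVK compm1.
have tail : assoc Y B (A ⊗ B) ∘ (idm (Y ⊗ B) ⊠ c) ∘ runitV (Y ⊗ B) =
    idm Y ⊠ ((idm B ⊠ c) ∘ runitV B).
  rewrite -tensm1 assoc_nat tensmr -compA; congr (_ ∘ _).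
  apply: (inverse_epi (runitP _)); rewrite -compA runitK compm1 runit_tens.
  by rewrite compA -tensmr runitK tensm1 comp1m.
rewrite /eps /eta !tensml !compA.
rewrite -[_ ∘ (assoc _ _ _ ⊠ _) ∘ assocV _ _ _]compA pent.
rewrite !compA head -!compA [assoc Y _ _ ∘ _]compA tail -!tensmr !compA.
by case: AB => _ ->; exact: tensm1.
Qed.

Lemma tens_kernel X Y Z (f : hom X Y) (g : hom Y Z) :
  is_kernel f g -> is_kernel (f ⊠ idm B) (g ⊠ idm B).
Proof.
case=> gf0 univ; split; first by rewrite -tensml gf0 tens0m.
move=> W h gh0.
have phi_inj X' (u u' : hom W (X' ⊗ B)) :
    eps X' ∘ (u ⊠ idm A) = eps X' ∘ (u' ⊠ idm A) -> u = u'.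
  move=> E; rewrite -[u]comp1m -[u']comp1m -(triangle2 X').
  rewrite -[_ ∘ u]compA -[_ ∘ u']compA !eta_nat.
  by rewrite !compA -!tensml E.
have [|u [fu uniq]] := univ _ (eps Y ∘ (h ⊠ idm A)).
  by rewrite compA -eps_nat -compA -tensml gh0 tens0m compm0.
exists ((u ⊠ idm B) ∘ eta W); split=> [|u' fu'].
  rewrite compA -tensml fu tensml -compA -eta_nat compA triangle2.
  by rewrite comp1m.
have <- : eps X ∘ (u' ⊠ idm A) = u.
  by symmetry; apply: uniq; rewrite compA -eps_nat -compA -tensml fu'.
by rewrite tensml -compA -eta_nat compA triangle2 comp1m.
Qed.

Lemma tens_cokernel X Y Z (f : hom X Y) (g : hom Y Z) :
  is_cokernel f g -> is_cokernel (f ⊠ idm A) (g ⊠ idm A).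
Proof.
case=> gf0 univ; split; first by rewrite -tensml gf0 tens0m.
move=> W h hf0.
have [|u [ug uniq]] := univ _ ((h ⊠ idm B) ∘ eta Y).
  by rewrite -compA eta_nat compA -tensml hf0 tens0m comp0m.
exists (eps W ∘ (u ⊠ idm A)); split=> [|u' ug'].
  rewrite -compA -tensml ug tensml compA eps_nat -compA triangle1.
  by rewrite compm1.
have -> : u = (u' ⊠ idm B) ∘ eta Z.
  by apply: uniq; rewrite -compA eta_nat compA -tensml ug'.
by rewrite tensml compA eps_nat -compA triangle1 compm1.
Qed.

End DualAdjunction.

Section Reversal.
Variables (k : fieldType) (C : monCat k).

Definition revCat : monCat k.
Proof.
refine (@MonCat k C (tunit C) (fun X Y => Y ⊗ X)
  (fun X X' Y Y' f g => g ⊠ f) (fun X Y Z => assocV Z Y X)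
  (fun X Y Z => assoc Z Y X) runit runitV lunit lunitV
  _ _ _ _ _ _ _ _ _ _ _ _).
- by move=> X X' Y Y' g; apply: tensm_linr.
- by move=> X X' Y Y' g; apply: tensm_linl.
- by move=> X Y; apply: tensm1.
- by move=> *; apply: tensmM.
- by move=> X Y Z; case: (assocP Z Y X).
- exact: runitP.
- exact: lunitP.
- by move=> *; apply: assocV_nat.
- exact: runit_nat.
- exact: lunit_nat.
- move=> X Y Z W /=.
  apply: (inverse_mono (assocP _ _ _)); rewrite !compA assocVK comp1m.
  apply: (inverse_mono (assocP _ _ _)); rewrite !compA assocVK pentagon.
  rewrite -[_ ∘ (assocV W Z Y ⊠ _)]compA -[(assoc _ _ _ ⊠ _) ∘ _]tensml.
  rewrite assocVK tensm1 compm1 -[_ ∘ assocV W _ X]compA assocVK compm1.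
  by rewrite -tensmr assocVK tensm1.
- by move=> X Y /=; rewrite -triangle -compA assocVK compm1.
Defined.

Lemma rev_left_dual (A B : C)
    (e : hom (B ⊗ A) (tunit C)) (c : hom (tunit C) (A ⊗ B)) :
  is_left_dual e c -> @is_left_dual k revCat B A e c.
Proof. by case. Qed.

End Reversal.

Section Exactness.
Variables (k : fieldType) (C : rigidCat k) (X Y Z W : C).
Variables (f : hom X Y) (g : hom Y Z).
Hypothesis fg : short_exact f g.

Lemma short_exact_tensr : short_exact (f ⊠ idm W) (g ⊠ idm W).
Proof.
case: fg => kf cg; split; last exact: (tens_cokernel (dualP W) cg).
by have [R [e [c d]]] := right_dual W; apply: (tens_kernel d kf).
Qed.

Lemma short_exact_tensl : short_exact (idm W ⊠ f) (idm W ⊠ g).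
Proof.
case: fg => kf cg; split.
  exact: (@tens_kernel _ (revCat C) _ _ _ _ (rev_left_dual (dualP W)) _ _ _ _ _ kf).
have [R [e [c d]]] := right_dual W.
exact: (@tens_cokernel _ (revCat C) _ _ _ _ (rev_left_dual d) _ _ _ _ _ cg).
Qed.

End Exactness.

Lemma isomorphic_tens (k : fieldType) (C : monCat k) (X X' Y Y' : C) :
  isomorphic X X' -> isomorphic Y Y' -> isomorphic (X ⊗ Y) (X' ⊗ Y').
Proof.
move=> [f [f' [ff1 ff2]]] [g [g' [gg1 gg2]]].
by exists (f ⊠ g), (f' ⊠ g'); rewrite /inverse -!tensmM ff1 ff2 gg1 gg2 !tensm1.
Qed.

(* [T M f] singles out the functions [f : S -> M] into an abelian group that
   respect the relations one wants to impose on the generators [S].  The group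
   [presented T] is the free abelian group on [S] (formal sums with integer
   coefficients) in which two formal sums are identified when no such function
   distinguishes them. *)
Section Presented.
Variables (S : Type) (T : forall M : zmodType, (S -> M) -> Prop).

Definition formalSum := seq (int * {classic S}).

Definition fsum_eval (M : zmodType) (f : S -> M) (s : formalSum) : M :=
  \sum_(a <- s) f a.2 *~ a.1.

Definition fsum_eqv (s t : formalSum) : bool :=
  `[< forall (M : zmodType) (f : S -> M), T f ->
        fsum_eval f s = fsum_eval f t >].

Lemma fsum_eqv_is_equiv : equiv_class_of fsum_eqv.
Proof.
split=> [s|s t|t s u]; first exact/asboolP.
  by apply/asboolP/asboolP => st M f Tf; rewrite st.
by move=> /asboolP st /asboolP tu; apply/asboolP => M f Tf; rewrite st // tu.
Qed.

Canonical fsum_equiv := EquivRelPack fsum_eqv_is_equiv.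

Definition presented := {eq_quot fsum_equiv}.
HB.instance Definition _ := Choice.on presented.
HB.instance Definition _ := EqQuotient.on presented.

Definition pclass (s : formalSum) : presented := \pi s.

Definition gen (x : S) : presented := pclass [:: (1 : int, x : {classic S})].

Definition peval (M : zmodType) (f : S -> M) (u : presented) : M :=
  fsum_eval f (repr u).

Lemma peval_pi (M : zmodType) (f : S -> M) s :
  T f -> peval f (pclass s) = fsum_eval f s.
Proof.
move=> Tf; rewrite /peval; by case: piP => t /eqmodP/asboolP->.
Qed.

Lemma presented_ext (u v : presented) :
  (forall (M : zmodType) (f : S -> M), T f -> peval f u = peval f v) -> u = v.
Proof.
by move=> uv; rewrite -[u]reprK -[v]reprK; apply/eqmodP/asboolP.
Qed.

Definition pzero : presented := pclass [::].
Definition padd (u v : presented) : presented := pclass (repr u ++ repr v).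
Definition popp (u : presented) : presented :=
  pclass [seq (- a.1, a.2) | a <- repr u].

Lemma fsum_eval_gen (M : zmodType) (f : S -> M) (x : S) :
  T f -> peval f (gen x) = f x.
Proof. by move=> Tf; rewrite peval_pi // /fsum_eval big_seq1. Qed.

Lemma peval0 (M : zmodType) (f : S -> M) : T f -> peval f pzero = 0.
Proof. by move=> Tf; rewrite peval_pi // /fsum_eval big_nil. Qed.

Lemma pevalD (M : zmodType) (f : S -> M) u v :
  T f -> peval f (padd u v) = peval f u + peval f v.
Proof. by move=> Tf; rewrite peval_pi // /fsum_eval big_cat. Qed.

Lemma pevalN (M : zmodType) (f : S -> M) u :
  T f -> peval f (popp u) = - peval f u.
Proof.
move=> Tf; rewrite peval_pi // /fsum_eval big_map /= -sumrN.
by apply: eq_bigr => a _; rewrite mulrNz.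
Qed.

Fact paddA : associative padd.
Proof.
by move=> u v w; apply: presented_ext => M f Tf; rewrite !pevalD // addrA.
Qed.
Fact paddC : commutative padd.
Proof.
by move=> u v; apply: presented_ext => M f Tf; rewrite !pevalD // addrC.
Qed.
Fact padd0 : left_id pzero padd.
Proof.
by move=> u; apply: presented_ext => M f Tf; rewrite pevalD // peval0 // add0r.
Qed.
Fact paddN : left_inverse pzero popp padd.
Proof.
move=> u; apply: presented_ext => M f Tf.
by rewrite pevalD // pevalN // peval0 // addNr.
Qed.

HB.instance Definition _ :=
  GRing.isZmodule.Build presented paddA paddC padd0 paddN.

Definition pmul (m : S -> S -> S) (u v : presented) : presented :=
  pclass [seq (a.1 * b.1, m a.2 b.2 : {classic S}) | a <- repr u, b <- repr v].

Definition pmap (h : S -> S) (u : presented) : presented :=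
  pclass [seq (a.1, h a.2 : {classic S}) | a <- repr u].

Lemma peval_pmap (M : zmodType) (f : S -> M) h u :
  T f -> peval f (pmap h u) = peval (f \o h) u.
Proof. by move=> Tf; rewrite peval_pi // /fsum_eval big_map. Qed.

Section Mul.
Variables (m : S -> S -> S) (e : S).
Hypothesis Tl : forall (M : zmodType) (f : S -> M) y,
  T f -> T (fun x => f (m x y)).
Hypothesis Tr : forall (M : zmodType) (f : S -> M) x,
  T f -> T (fun y => f (m x y)).
Hypothesis mA : forall (M : zmodType) (f : S -> M) x y z,
  T f -> f (m x (m y z)) = f (m (m x y) z).
Hypothesis m1 : forall (M : zmodType) (f : S -> M) x, T f -> f (m e x) = f x.
Hypothesis m1' : forall (M : zmodType) (f : S -> M) x, T f -> f (m x e) = f x.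

Lemma eq_peval (M : zmodType) (f g : S -> M) u :
  f =1 g -> peval f u = peval g u.
Proof. by move=> fg; apply: eq_bigr => a _; rewrite fg. Qed.

Lemma pevalMl (M : zmodType) (f : S -> M) u v : T f ->
  peval f (pmul m u v) = peval (fun x => peval (fun y => f (m x y)) v) u.
Proof.
move=> Tf; rewrite peval_pi // /fsum_eval big_allpairs_dep.
apply: eq_bigr => a _; rewrite /peval /fsum_eval mulrz_suml.
by apply: eq_bigr => b _; rewrite /= mulrC mulrzA.
Qed.

Lemma peval_exchange (M : zmodType) (f : S -> S -> M) u v :
  peval (fun x => peval (f x) v) u = peval (fun y => peval (f^~ y) u) v.
Proof.
rewrite /peval /fsum_eval.
under eq_bigr do rewrite mulrz_suml.
under [RHS]eq_bigr do rewrite mulrz_suml.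
rewrite exchange_big; apply: eq_bigr => b _; apply: eq_bigr => a _.
by rewrite -!mulrzA mulrC.
Qed.

Lemma pevalMr (M : zmodType) (f : S -> M) u v : T f ->
  peval f (pmul m u v) = peval (fun y => peval (fun x => f (m x y)) u) v.
Proof. by move=> Tf; rewrite pevalMl // peval_exchange. Qed.

Lemma peval_sum (M : zmodType) (f g : S -> M) u :
  peval (fun x => f x + g x) u = peval f u + peval g u.
Proof.
rewrite /peval /fsum_eval -big_split; apply: eq_bigr => a _.
by rewrite mulrzDl.
Qed.

Fact pmulA : associative (pmul m).
Proof.
move=> u v w; apply: presented_ext => M f Tf.
rewrite pevalMl // [RHS]pevalMr //.
under eq_peval do rewrite (pevalMl _ _ (Tr _ Tf)).
under [RHS]eq_peval do rewrite (pevalMl _ _ (Tl _ Tf)).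
rewrite [RHS]peval_exchange; apply: eq_peval => x.
rewrite [RHS]peval_exchange; apply: eq_peval => y.
by apply: eq_peval => z; apply: mA.
Qed.

Fact pmul1 : left_id (gen e) (pmul m).
Proof.
move=> u; apply: presented_ext => M f Tf; rewrite pevalMr //.
by apply: eq_peval => x; rewrite fsum_eval_gen ?m1 //; apply: Tl.
Qed.

Fact pmulr1 : right_id (gen e) (pmul m).
Proof.
move=> u; apply: presented_ext => M f Tf; rewrite pevalMl //.
by apply: eq_peval => x; rewrite fsum_eval_gen ?m1' //; apply: Tr.
Qed.

Fact pmulDl : left_distributive (pmul m) +%R.
Proof.
move=> u v w; apply: presented_ext => M f Tf.
rewrite [RHS]pevalD // !pevalMr // -peval_sum.
by apply: eq_peval => x; rewrite pevalD //; apply: Tl.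
Qed.

Fact pmulDr : right_distributive (pmul m) +%R.
Proof.
move=> u v w; apply: presented_ext => M f Tf.
rewrite [RHS]pevalD // !pevalMl // -peval_sum.
by apply: eq_peval => x; rewrite pevalD //; apply: Tr.
Qed.

Lemma pmul_gen x y : pmul m (gen x) (gen y) = gen (m x y).
Proof.
apply: presented_ext => M f Tf; rewrite pevalMr //.
under eq_peval => z do rewrite (fsum_eval_gen _ (Tl z Tf)).
by rewrite (fsum_eval_gen _ (Tr x Tf)) fsum_eval_gen.
Qed.

End Mul.
End Presented.

Section GrothendieckRing.
Variables (k : fieldType) (C : rigidCat k).

Definition additive_function (M : zmodType) (f : C -> M) : Prop :=
  (forall X Y : C, isomorphic X Y -> f X = f Y) /\
  (forall (X Y Z : C) (i : hom X Y) (p : hom Y Z),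
     short_exact i p -> f Y = f X + f Z).

Definition Gr : Type := presented additive_function.

Definition Grclass (X : C) : Gr := gen additive_function X.

Lemma isomorphic_refl (X : C) : isomorphic X X.
Proof. by exists (idm X), (idm X); rewrite /inverse comp1m. Qed.

Fact additive_tensr (M : zmodType) (f : C -> M) Y :
  additive_function f -> additive_function (fun X => f (X ⊗ Y)).
Proof.
case=> fiso fex; split=> [X X' XX'|X X' X'' i p ip].
  exact/fiso/isomorphic_tens/isomorphic_refl.
exact: fex (short_exact_tensr Y ip).
Qed.

Fact additive_tensl (M : zmodType) (f : C -> M) X :
  additive_function f -> additive_function (fun Y => f (X ⊗ Y)).
Proof.
case=> fiso fex; split=> [Y Y' YY'|Y Y' Y'' i p ip].
  exact/fiso/isomorphic_tens/YY'/isomorphic_refl.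
exact: fex (short_exact_tensl X ip).
Qed.

Fact additive_assoc (M : zmodType) (f : C -> M) X Y Z :
  additive_function f -> f (X ⊗ (Y ⊗ Z)) = f ((X ⊗ Y) ⊗ Z).
Proof.
case=> fiso _; apply/esym/fiso; exists (assoc X Y Z), (assocV X Y Z).
exact: assocP.
Qed.

Fact additive_lunit (M : zmodType) (f : C -> M) X :
  additive_function f -> f (tunit C ⊗ X) = f X.
Proof.
by case=> fiso _; apply: fiso; exists (lunit X), (lunitV X); apply: lunitP.
Qed.

Fact additive_runit (M : zmodType) (f : C -> M) X :
  additive_function f -> f (X ⊗ tunit C) = f X.
Proof.
by case=> fiso _; apply: fiso; exists (runit X), (runitV X); apply: runitP.
Qed.

HB.instance Definition _ := GRing.Zmodule.on Gr.
HB.instance Definition _ := GRing.Zmodule_isPzRing.Build Gr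
  (pmulA additive_tensr additive_tensl additive_assoc)
  (pmul1 additive_tensr additive_lunit)
  (pmulr1 additive_tensl additive_runit)
  (pmulDl additive_tensr)
  (pmulDr additive_tensl).

Lemma Grclass1 : Grclass (tunit C) = 1.
Proof. by []. Qed.

Lemma GrclassM X Y : Grclass X * Grclass Y = Grclass (X ⊗ Y).
Proof. exact: (pmul_gen additive_tensr additive_tensl). Qed.

Lemma Grclass_iso X Y : isomorphic X Y -> Grclass X = Grclass Y.
Proof.
move=> XY; apply: presented_ext => M f Tf; rewrite !fsum_eval_gen //.
by case: Tf => + _; apply.
Qed.

Lemma Grclass_exact (X Y Z : C) (i : hom X Y) (p : hom Y Z) :
  short_exact i p -> Grclass Y = Grclass X + Grclass Z.
Proof.
move=> ip; apply: presented_ext => M f Tf.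
by rewrite pevalD // !fsum_eval_gen //; case: Tf => _; apply; apply: ip.
Qed.

End GrothendieckRing.

Section ExtensionOfScalars.
Variables (K : comPzRingType) (G : pzRingType).

Definition biadditive (M : zmodType) (f : K * G -> M) : Prop :=
  (forall a b x, f (a + b, x) = f (a, x) + f (b, x)) /\
  (forall a x y, f (a, x + y) = f (a, x) + f (a, y)).

Definition scalarExt : Type := presented biadditive.

(* The elementary tensor a ⊗ x of K ⊗_Z G. *)
Definition pure (a : K) (x : G) : scalarExt := gen biadditive (a, x).

Definition pair_mul (u v : K * G) : K * G := (u.1 * v.1, u.2 * v.2).
Definition pair_scale (c : K) (u : K * G) : K * G := (c * u.1, u.2).

Fact biadditive_mulr (M : zmodType) (f : K * G -> M) v :
  biadditive f -> biadditive (fun u => f (pair_mul u v)).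
Proof.
by case=> fl fr; split=> *; rewrite /pair_mul /= mulrDl (fl, fr).
Qed.

Fact biadditive_mull (M : zmodType) (f : K * G -> M) u :
  biadditive f -> biadditive (fun v => f (pair_mul u v)).
Proof.
by case=> fl fr; split=> *; rewrite /pair_mul /= mulrDr (fl, fr).
Qed.

Fact biadditive_scale (M : zmodType) (f : K * G -> M) c :
  biadditive f -> biadditive (f \o pair_scale c).
Proof.
by case=> fl fr; split=> *; rewrite /pair_scale /= ?mulrDr (fl, fr).
Qed.

Fact biadditive_mulA (M : zmodType) (f : K * G -> M) u v w :
  biadditive f ->
  f (pair_mul u (pair_mul v w)) = f (pair_mul (pair_mul u v) w).
Proof. by rewrite /pair_mul !mulrA. Qed.

Fact biadditive_mul1 (M : zmodType) (f : K * G -> M) u :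
  biadditive f -> f (pair_mul (1, 1) u) = f u.
Proof. by case: u => a x; rewrite /pair_mul !mul1r. Qed.

Fact biadditive_mulr1 (M : zmodType) (f : K * G -> M) u :
  biadditive f -> f (pair_mul u (1, 1)) = f u.
Proof. by case: u => a x; rewrite /pair_mul !mulr1. Qed.

HB.instance Definition _ := GRing.Zmodule.on scalarExt.
HB.instance Definition _ := GRing.Zmodule_isPzRing.Build scalarExt
  (pmulA biadditive_mulr biadditive_mull biadditive_mulA)
  (pmul1 biadditive_mulr biadditive_mul1)
  (pmulr1 biadditive_mull biadditive_mulr1)
  (pmulDl biadditive_mulr)
  (pmulDr biadditive_mull).

Definition ext_scale (c : K) : scalarExt -> scalarExt := pmap (pair_scale c).

Fact ext_scaleA a b u : ext_scale a (ext_scale b u) = ext_scale (a * b) u.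
Proof.
apply: presented_ext => M f Tf; rewrite !peval_pmap //; last first.
  exact: biadditive_scale.
by apply: eq_peval => -[c x]; rewrite /= /pair_scale /= mulrA.
Qed.

Fact ext_scale1 : left_id 1 ext_scale.
Proof.
move=> u; apply: presented_ext => M f Tf; rewrite peval_pmap //.
by apply: eq_peval => -[c x]; rewrite /= /pair_scale /= mul1r.
Qed.

Fact ext_scaleDr : right_distributive ext_scale +%R.
Proof.
move=> c u v; apply: presented_ext => M f Tf.
rewrite pevalD // !peval_pmap // pevalD //; exact: biadditive_scale.
Qed.

Fact ext_scaleDl u : {morph ext_scale^~ u : a b / a + b}.
Proof.
move=> a b; apply: presented_ext => M f Tf.
rewrite pevalD // !peval_pmap // -peval_sum; apply: eq_peval => -[c x].
by rewrite /= /pair_scale /= mulrDl; case: Tf.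
Qed.

HB.instance Definition _ := GRing.Zmodule_isLmodule.Build K scalarExt
  ext_scaleA ext_scale1 ext_scaleDr ext_scaleDl.

Lemma ext_scaleAl (a : K) (u v : scalarExt) : a *: (u * v) = (a *: u) * v.
Proof.
apply: presented_ext => M f Tf.
have Tfa := biadditive_scale a Tf.
rewrite peval_pmap // (pevalMl pair_mul _ _ Tfa) (pevalMr pair_mul _ _ Tf).
rewrite [RHS](@eq_peval _ _ _ _
  (fun y => peval (fun x => f (pair_mul (pair_scale a x) y)) u)).
  rewrite peval_exchange; apply: eq_peval => y; apply: eq_peval => x.
  by rewrite /= /pair_scale /pair_mul /= mulrA.
by move=> y; rewrite peval_pmap //; apply: biadditive_mulr.
Qed.

Lemma ext_scaleAr (a : K) (u v : scalarExt) : a *: (u * v) = u * (a *: v).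
Proof.
apply: presented_ext => M f Tf.
have Tfa := biadditive_scale a Tf.
rewrite peval_pmap // (pevalMl pair_mul _ _ Tfa) (pevalMl pair_mul _ _ Tf).
rewrite [RHS](@eq_peval _ _ _ _
  (fun x => peval (fun y => f (pair_mul x (pair_scale a y))) v)).
  apply: eq_peval => x; apply: eq_peval => y.
  by rewrite /= /pair_scale /pair_mul /= mulrCA.
by move=> x; rewrite peval_pmap //; apply: biadditive_mull.
Qed.

Lemma pureM a b x y : pure a x * pure b y = pure (a * b) (x * y).
Proof. exact: (pmul_gen biadditive_mulr biadditive_mull). Qed.

Lemma pureZ c a x : c *: pure a x = pure (c * a) x.
Proof.
apply: presented_ext => M f Tf.
by rewrite peval_pmap // !fsum_eval_gen //; apply: biadditive_scale.
Qed.

End ExtensionOfScalars.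

(* [scalarExt] carries no [algType] structure only because algebras are
   required to be nonzero in MathComp; the algebra axioms are [ext_scaleAl]
   and [ext_scaleAr]. *)
Definition Grk (k : fieldType) (C : rigidCat k) : Type := scalarExt k (Gr C).
HB.instance Definition _ (k : fieldType) (C : rigidCat k) :=
  GRing.PzRing.on (Grk C).
HB.instance Definition _ (k : fieldType) (C : rigidCat k) :=
  GRing.Lmodule.on (Grk C).

(* Main.v *)
(* Let V_0, ..., V_m be the simple objects and J the direct sum of the
   V_i ⊗ V_i^*. Morphisms Q -> P ⊗ J are the same as natural families
   Q ⊗ X -> P ⊗ X, which equips J with a half-braiding and shows that
   Hom_Z(Z, J) = Hom_C(Z, 1); hence R(1) is isomorphic to J, and End_Z(J) is
   identified with Hom_C(J, 1). The pivotal traces of the universal family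
   J ⊗ X -> X are morphisms ch(X) : J -> 1; they are additive in X, they convert
   ⊗ into composition in End_Z(J), and the ch(V_i) form a basis. So End_Z(J) is
   commutative exactly when Gr_k(C) is.
   Weighting the projections of J by the dimensions of the V_i^* gives a
   morphism J -> 1 of the center, whose composite with the unit 1 -> J is
   dim(C). Since dim(C) is nonzero, averaging against it turns a weak inverse
   in C of a morphism of the center into a weak inverse in the center. Thus
   the center is semisimple, and there an object is multiplicity-free exactly
   when its endomorphism algebra is commutative. *)
From HB Require Import structures.
From mathcomp Require Import all_boot all_order all_algebra all_field.
From mathcomp Require Import boolp.
Require Import Defs.

Set Implicit Arguments.
Unset Strict Implicit.
Unset Printing Implicit Defensive.
Import GRing.Theory.
Local Open Scope ring_scope.
Local Open Scope cat_scope.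

(** * Linear categories *)

(** Semisimplicity of the center enters only as von Neumann regularity: every f has some g with f g
    f = f. This refers to neither kernels nor subobjects, so the center is never shown to be
    abelian. Together with split idempotents, eigenvalues and a rank function, the last two pulled
    back along the faithful forgetful functor, it gives Schur's lemma and the decomposition of an
    object with commutative endomorphisms. Nor is the center given a tensor product; the hexagon is
    written out instead. The pivotal structure need not be spherical, so the left dimension
    [ev X ∘ pcoev j X] and the right dimension [pev j X ∘ coev X] of a simple object may differ.
    Left dimensions as weights make the functional J -> 1 central, while the unit 1 -> J contributes
    the right ones. As the left dimension of X is the pivotal dimension of its dual, the products
    are exactly the summands of dim(C). The characteristic may be positive: the characters see
    multiplicities only through their images in k, which is what Gr_k records. *)

Section LinearMaps.
Variables (k : fieldType) (A B : lmodType k) (f : A -> B).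
Hypothesis lf : linear f.

Lemma linear_mapD u v : f (u + v) = f u + f v.
Proof. by have := lf 1 u v; rewrite !scale1r. Qed.

Lemma linear_mapZ a u : f (a *: u) = a *: f u.
Proof. by have := lf a u 0; rewrite (linear_zero lf) !addr0. Qed.

Lemma linear_mapN u : f (- u) = - f u.
Proof. by rewrite -scaleN1r linear_mapZ scaleN1r. Qed.

Lemma linear_mapB u v : f (u - v) = f u - f v.
Proof. by rewrite linear_mapD linear_mapN. Qed.

Lemma linear_map_sum I r (P : pred I) F :
  f (\sum_(i <- r | P i) F i) = \sum_(i <- r | P i) f (F i).
Proof. exact: (big_morph f linear_mapD (linear_zero lf)). Qed.

End LinearMaps.

Section LinearCategory.
Variables (k : fieldType) (C : linCat k).
Implicit Types X Y Z W : C.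

Lemma comp0l X Y Z (f : hom X Y) : (0 : hom Y Z) ∘ f = 0.
Proof. exact: (linear_zero (@comp_linl k C X Y Z f)). Qed.
Lemma comp0r X Y Z (g : hom Y Z) : g ∘ (0 : hom X Y) = 0.
Proof. exact: (linear_zero (@comp_linr k C X Y Z g)). Qed.
Lemma compDl X Y Z (f : hom X Y) (g h : hom Y Z) :
  (g + h) ∘ f = g ∘ f + h ∘ f.
Proof. exact: (linear_mapD (@comp_linl k C X Y Z f)). Qed.
Lemma compDr X Y Z (g : hom Y Z) (f h : hom X Y) :
  g ∘ (f + h) = g ∘ f + g ∘ h.
Proof. exact: (linear_mapD (@comp_linr k C X Y Z g)). Qed.
Lemma compBl X Y Z (f : hom X Y) (g h : hom Y Z) :
  (g - h) ∘ f = g ∘ f - h ∘ f.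
Proof. exact: (linear_mapB (@comp_linl k C X Y Z f)). Qed.
Lemma compBr X Y Z (g : hom Y Z) (f h : hom X Y) :
  g ∘ (f - h) = g ∘ f - g ∘ h.
Proof. exact: (linear_mapB (@comp_linr k C X Y Z g)). Qed.
Lemma compZl X Y Z (f : hom X Y) a (g : hom Y Z) : (a *: g) ∘ f = a *: (g ∘ f).
Proof. exact: (linear_mapZ (@comp_linl k C X Y Z f)). Qed.
Lemma compZr X Y Z (g : hom Y Z) a (f : hom X Y) : g ∘ (a *: f) = a *: (g ∘ f).
Proof. exact: (linear_mapZ (@comp_linr k C X Y Z g)). Qed.
Lemma comp_suml X Y Z (f : hom X Y) I r (P : pred I) (G : I -> hom Y Z) :
  (\sum_(i <- r | P i) G i) ∘ f = \sum_(i <- r | P i) (G i ∘ f).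
Proof. exact: (linear_map_sum (@comp_linl k C X Y Z f)). Qed.
Lemma comp_sumr X Y Z (g : hom Y Z) I r (P : pred I) (F : I -> hom X Y) :
  g ∘ (\sum_(i <- r | P i) F i) = \sum_(i <- r | P i) (g ∘ F i).
Proof. exact: (linear_map_sum (@comp_linr k C X Y Z g)). Qed.

Lemma isomorphic_sym X Y : isomorphic X Y -> isomorphic Y X.
Proof. by move=> [f [g [gf fg]]]; exists g, f. Qed.

Lemma zero_hom_to X Y (f : hom Y X) : is_zero X -> f = 0.
Proof. by move=> X0; rewrite -[f]comp1m X0 comp0l. Qed.

(** Von Neumann regularity: [g ∘ f] and [f ∘ g] are then idempotents, whose splittings replace
    images and complements. *)
Definition regular X Y (f : hom X Y) := exists g : hom Y X, f ∘ g ∘ f = f.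

(** The remainder factors both as f (1 - g f) and as (1 - f g) f, so a weak inverse of it,
    compressed by these two factors, corrects g. *)
Lemma mccoy X Y (f : hom X Y) (g : hom Y X) :
  regular (f - f ∘ g ∘ f) -> regular f.
Proof.
move=> [h]; set r := f - _ => rhr.
exists ((idm _ - g ∘ f) ∘ h ∘ (idm _ - f ∘ g) + g).
rewrite compDr compDl !compA.
have -> : f ∘ (idm X - g ∘ f) = r by rewrite compBr compm1 compA.
rewrite -(compA _ _ f).
have -> : (idm Y - f ∘ g) ∘ f = r by rewrite compBl comp1m.
by rewrite rhr subrK.
Qed.

End LinearCategory.

(** * Schur's lemma and the commutativity criterion for multiplicity-freeness *)

Section IdempotentsSplit.
Variables (k : fieldType) (C : linCat k).

Definition idempotents_split := forall (X : C) (e : hom X X), e ∘ e = e ->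
  exists (Y : C) (i : hom Y X) (p : hom X Y), p ∘ i = idm Y /\ i ∘ p = e.

(** Phrased by non-invertibility, the property passes back along faithful linear functors, since
    functors preserve isomorphisms. *)
Definition has_eigenvalues := forall (X : C) (f : hom X X), ~ is_zero X ->
  exists c, ~ is_iso (f - c *: idm X).

Definition has_kernels := forall (X Y : C) (f : hom X Y),
  exists (K : C) (i : hom K X), [/\ f ∘ i = 0, monic i &
    forall W (h : hom W X), f ∘ h = 0 -> exists u, h = i ∘ u].

Definition schur := forall (X Y : C) (f : hom X Y),
  simple X -> simple Y -> f <> 0 -> is_iso f.

Lemma kernels_split : has_kernels -> idempotents_split.
Proof.
move=> kerC X e ee; have [K [i [i0 imon iuniv]]] := kerC _ _ (idm X - e).
have [|p ep] := iuniv X e; first by rewrite compBl comp1m ee subrr.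
exists K, i, p; split=> //; apply: imon; rewrite compA -ep compm1.
by move: i0; rewrite compBl comp1m => /subr0_eq.
Qed.

Lemma kernels_schur : has_kernels -> schur.
Proof.
move=> kerC X Y f [X0 sX] [Y0 sY] f0.
have [K [i [i0 imon iuniv]]] := kerC _ _ f.
have [K0|[i' [_ ii']]] := sX _ _ imon; last first.
  by case: f0; rewrite -[f]compm1 -ii' compA i0 comp0l.
have [||//] := sY _ f; last by move/X0.
move=> W g h fgh; apply: subr0_eq.
have [|u ->] := iuniv _ (g - h); first by rewrite compBr fgh subrr.
by rewrite (zero_hom_to u K0) comp0r.
Qed.

(** The version of Schur's lemma for the center. A nonzero idempotent of a simple object is the
    identity, because its image is a nonzero subobject; this applies to [g ∘ f] and [f ∘ g]. *)
Lemma regular_schur : (forall (X Y : C) (f : hom X Y), regular f) ->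
  idempotents_split -> schur.
Proof.
move=> reg spl X Y f [X0 sX] [Y0 sY] f0.
have [g fgf] := reg _ _ f.
have one (Z : C) (sZ : forall Y (f : hom Y Z), monic f -> is_zero Y \/ is_iso f)
    (e : hom Z Z) : e ∘ e = e -> e <> 0 -> e = idm Z.
  move=> ee e0; have [T [i [p [pi ip]]]] := spl _ _ ee.
  have imon : monic i.
    by move=> W u v uv; rewrite -[u]comp1m -[v]comp1m -pi -!compA uv.
  have [T0|[i' [i'i ii']]] := sZ _ _ imon.
    by case: e0; rewrite -ip (zero_hom_to p T0) comp0r.
  have pi' : p = i' by rewrite -[p]compm1 -ii' compA pi comp1m.
  by rewrite -ip pi' ii'.
exists g; split; apply: one => //.
- by rewrite compA -(compA g) -compA fgf.
- by move=> gf0; case: f0; rewrite -fgf -compA gf0 comp0r.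
- by rewrite !compA fgf.
- by move=> fg0; case: f0; rewrite -fgf fg0 comp0l.
Qed.

Lemma schur_scalar : has_eigenvalues -> schur ->
  forall (X : C) (f : hom X X), simple X -> exists c, f = c *: idm X.
Proof.
move=> eigC sch X f sX; have [c nc] := eigC X f (proj1 sX).
exists c; apply: subr0_eq; apply: contrapT => fc; apply: nc; exact: sch.
Qed.

Lemma schur_hom0 : schur -> forall (X Y : C) (f : hom X Y),
  simple X -> simple Y -> ~ isomorphic X Y -> f = 0.
Proof.
by move=> sch X Y f sX sY nXY; apply: contrapT => f0; apply: nXY; exists f; apply: sch.
Qed.

(* Gaussian elimination: McCoy's lemma clears one summand of the source at a
   time, an invertible entry of the matrix of [f] serving as pivot. *)
Lemma semisimple_regular : schur -> forall (X Y : C) (f : hom X Y),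
  semisimple_obj X -> semisimple_obj Y -> regular f.
Proof.
move=> sch X Y f [n [S [sS [i [p [pi1 pi0 ip]]]]]] [m [T [sT [j [q [_ _ jq]]]]]].
have [N] := ubnP #|[pred a | `[< f ∘ i a <> 0 >]]|.
elim: N f => // N IHN f; rewrite ltnS => leN.
have [f0|/existsNP [a fa0]] := pselect (forall a, f ∘ i a = 0).
  exists 0; rewrite comp0r comp0l -[f]compm1 -ip comp_sumr big1 // => a _.
  by rewrite compA f0 comp0l.
have [b qfi0] : exists b, q b ∘ (f ∘ i a) <> 0.
  apply: contrapT => /forallNP q0; apply: fa0.
  rewrite -[_ ∘ _]comp1m -jq comp_suml big1 // => b _.
  by rewrite -compA (contrapT (q0 b)) comp0r.
have [u [ui iu]] := sch _ _ _ (sS a) (sT b) qfi0.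
apply: (@mccoy _ _ _ _ f (i a ∘ u ∘ q b)); apply: IHN.
apply: leq_trans leN; apply: proper_card; apply/properP; split.
  apply/subsetP => c; rewrite !inE => /asboolP fc; apply/asboolP => fc0; apply: fc.
  by rewrite compBl -!compA fc0 !comp0r subrr.
exists a; rewrite !inE; first exact/asboolP.
by apply/asboolPn; case; rewrite compBl -!compA ui compm1 subrr.
Qed.

(** A measure that drops on proper retracts, so that repeated splitting terminates; for modules it
    is the dimension. *)
Definition has_rank (mu : C -> nat) := forall (X Y : C) (i : hom Y X) (p : hom X Y),
  p ∘ i = idm Y -> i ∘ p <> idm X -> (mu Y < mu X)%N.

Definition commutative_end (X : C) := forall f g : hom X X, f ∘ g = g ∘ f.

Lemma commutative_end_retract (X Y : C) (i : hom Y X) (p : hom X Y) :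
  p ∘ i = idm Y -> commutative_end X -> commutative_end Y.
Proof.
move=> pi cX f g; have := cX (i ∘ f ∘ p) (i ∘ g ∘ p).
move=> /(congr1 (fun h => p ∘ h ∘ i)).
by rewrite !compA pi !comp1m -!(compA _ p i) pi !compm1.
Qed.

Lemma simple_nonzero (X : C) : simple X -> idm X <> 0.
Proof. by case. Qed.

Lemma multiplicity_free_biproduct (X X1 X2 : C)
    (i1 : hom X1 X) (p1 : hom X X1) (i2 : hom X2 X) (p2 : hom X X2) :
  p1 ∘ i1 = idm X1 -> p2 ∘ i2 = idm X2 -> p1 ∘ i2 = 0 -> p2 ∘ i1 = 0 ->
  i1 ∘ p1 + i2 ∘ p2 = idm X -> (forall f : hom X1 X2, f = 0) ->
  (forall f : hom X2 X1, f = 0) ->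
  multiplicity_free X1 -> multiplicity_free X2 -> multiplicity_free X.
Proof.
move=> pi1 pi2 pi12 pi21 ip h12 h21.
move=> [n1 [S1 [s1 ns1 [j1 [q1 [qj1 qj10 jq1]]]]]].
move=> [n2 [S2 [s2 ns2 [j2 [q2 [qj2 qj20 jq2]]]]]].
(* An isomorphism between a summand of X1 and one of X2 would extend to a nonzero morphism from X1
   to X2. *)
have no12 a b : ~ isomorphic (S1 a) (S2 b).
  move=> [f [g [gf _]]]; apply: (simple_nonzero (s1 a)); rewrite -gf.
  have : j2 b ∘ f ∘ q1 a = 0 by apply: h12.
  move=> /(congr1 (fun h => q2 b ∘ h ∘ j1 a)); rewrite comp0r comp0l.
  by rewrite -!compA qj1 compm1 !compA qj2 comp1m => ->; rewrite comp0r.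
pose S (a : 'I_(n1 + n2)) := match split a with inl b => S1 b | inr b => S2 b end.
pose j a : hom (S a) X :=
  match split a as u return hom (match u with inl b => S1 b | inr b => S2 b end) X
  with inl b => i1 ∘ j1 b | inr b => i2 ∘ j2 b end.
pose q a : hom X (S a) :=
  match split a as u return hom X (match u with inl b => S1 b | inr b => S2 b end)
  with inl b => q1 b ∘ p1 | inr b => q2 b ∘ p2 end.
exists (n1 + n2)%N, S; split.
- by rewrite /S => a; case: (split a).
- move=> a b ab; rewrite /S -(splitK a) -(splitK b) in ab *.
  case: (split a) (split b) ab => [a'|a'] [b'|b'] ab; rewrite !unsplitK.
  + by apply: ns1 => e; rewrite e in ab.
  + exact: no12.
  + by move=> /isomorphic_sym; apply: no12.
  + by apply: ns2 => e; rewrite e in ab.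
- exists j, q; split.
  + rewrite /q /j /S => a; case: (split a) => b; rewrite compA -(compA (_ b)).
      by rewrite pi1 compm1 qj1.
    by rewrite pi2 compm1 qj2.
  + move=> a b ab; rewrite /q /j /S.
    have : split a <> split b by move=> /(can_inj splitK).
    case: (split a) (split b) => [a'|a'] [b'|b'] ab'; rewrite compA -(compA (_ b')).
    * by rewrite pi1 compm1 qj10 // => e; rewrite e in ab'.
    * by rewrite pi21 comp0r comp0l.
    * by rewrite pi12 comp0r comp0l.
    * by rewrite pi2 compm1 qj20 // => e; rewrite e in ab'.
  rewrite big_split_ord /= -ip; congr (_ + _).
    rewrite -[i1 in RHS]compm1 -jq1 comp_sumr comp_suml; apply: eq_bigr => a _.
    by rewrite /j /q /S; case: (split _) (unsplitK (inl a : _ + 'I_n2)) => b //= [->]; rewrite !compA.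
  rewrite -[i2 in RHS]compm1 -jq2 comp_sumr comp_suml; apply: eq_bigr => a _.
  by rewrite /j /q /S; case: (split _) (unsplitK (inr a : 'I_n1 + _)) => b //= [->]; rewrite !compA.
Qed.

Lemma multiplicity_free_iso (X Y : C) :
  isomorphic X Y -> multiplicity_free X -> multiplicity_free Y.
Proof.
move=> [f [g [gf fg]]] [n [S [sS nS [i [p [pi pi0 ip]]]]]].
exists n, S; split=> //; exists (fun a => f ∘ i a), (fun a => p a ∘ g); split.
- by move=> a; rewrite compA -(compA (p a)) gf compm1 pi.
- by move=> a b ab; rewrite compA -(compA (p b)) gf compm1 pi0.
- rewrite -fg -[f in RHS]compm1 -ip comp_sumr comp_suml.
  by apply: eq_bigr => a _; rewrite !compA.
Qed.

(** By Schur's lemma every endomorphism is diagonal with scalar entries, and diagonal matrices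
    commute. *)
Lemma multiplicity_free_commutative : schur -> has_eigenvalues ->
  forall X : C, multiplicity_free X -> commutative_end X.
Proof.
move=> sch eigC X [n [S [sS nS [i [p [pi pi0 ip]]]]]].
have diag (f : hom X X) : exists c : 'I_n -> k, f = \sum_a c a *: (i a ∘ p a).
  have /choice [c cE] a := schur_scalar eigC sch (p a ∘ f ∘ i a) (sS a).
  exists c; rewrite -{1}[f]compm1 -{1}ip -{1}[f]comp1m -{1}ip !comp_suml.
  apply: eq_bigr => a _; rewrite comp_sumr (bigD1 a) //= big1 ?addr0.
    by rewrite -!compA [p a ∘ _]compA [_ ∘ (i a ∘ _)]compA (cE a) compZl compZr comp1m.
  move=> b /eqP ba; rewrite -!compA [p a ∘ _]compA [_ ∘ (i b ∘ _)]compA.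
  rewrite (schur_hom0 sch (p a ∘ f ∘ i b)) ?comp0l ?comp0r //.
  exact: nS.
move=> f g; have [c ->] := diag f; have [d ->] := diag g.
have mul (u v : 'I_n -> k) : (\sum_a u a *: (i a ∘ p a)) ∘ (\sum_a v a *: (i a ∘ p a)) =
    \sum_a (u a * v a) *: (i a ∘ p a).
  rewrite comp_suml; apply: eq_bigr => a _; rewrite comp_sumr (bigD1 a) //= big1 ?addr0.
    by rewrite compZl compZr scalerA compA -(compA (i a)) pi compm1.
  move=> b /eqP ba; rewrite compZl compZr compA -(compA (i a)) pi0 //.
  by rewrite comp0r comp0l !scaler0.
by rewrite !mul; apply: eq_bigr => a _; rewrite mulrC.
Qed.

(** Induction on the rank. If all endomorphisms are scalars, X is simple. Otherwise f - c, for an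
    eigenvalue c of a non-scalar f, yields a nontrivial idempotent; it is central, so no nonzero
    morphism links its image to the complement. *)
Lemma commutative_multiplicity_free (mu : C -> nat) : has_rank mu ->
  (forall (X Y : C) (f : hom X Y), regular f) ->
  idempotents_split -> has_eigenvalues ->
  forall X : C, commutative_end X -> multiplicity_free X.
Proof.
move=> rk reg spl eigC X; have [N] := ubnP (mu X).
elim: N X => // N IHN X; rewrite ltnS => leN cX.
have [X0|X0] := pselect (is_zero X).
  exists 0%N, (fun _ => X); split; [by case | by case |].
  exists (fun _ => 0), (fun _ => 0).
  by split; [case | case | rewrite big_ord0].
have [[f nf]|sc] := pselect (exists f : hom X X, forall c, f <> c *: idm X); last first.
  have sX : simple X.
    split=> // Y f mf; have [g fgf] := reg _ _ f.
    have [c fg] : exists c, f ∘ g = c *: idm X.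
      by apply: contrapT => /forallNP nc; apply: sc; exists (f ∘ g).
    (* If c = 0, then f = f g f = 0 and Y is zero because f is monic. Otherwise f is nonzero and f =
       c f forces c = 1. *)
    have [c0|c0] := eqVneq c 0.
      left; apply: mf; rewrite comp0r compm1 -fgf fg c0 compZl.
      by rewrite scale0r.
    right; have gf : g ∘ f = idm Y by apply: mf; rewrite compA fgf compm1.
    have fc : f = c *: f by rewrite -{1}fgf fg compZl comp1m.
    exists g; split=> //; have [f0|f0] := pselect (f = 0).
      case: X0; rewrite /is_zero.
      have := fg; rewrite f0 comp0l => /esym/(congr1 (fun x => c^-1 *: x)).
      by rewrite scalerA mulVf // scale1r scaler0.
    have : (1 - c) *: f = 0 by rewrite scalerBl scale1r -fc subrr.
    move=> /eqP; rewrite scaler_eq0 => /orP [|/eqP //].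
    by rewrite subr_eq0 => /eqP c1; rewrite fg -c1 scale1r.
  exists 1%N, (fun _ => X); split=> //; first by move=> a b; rewrite !ord1.
  exists (fun _ => idm X), (fun _ => idm X); split.
  - by move=> _; rewrite comp1m.
  - by move=> a b; rewrite !ord1.
  - by rewrite big_ord1 comp1m.
have [c nc] := eigC _ f X0.
set g := f - _ in nc; have [h ghg] := reg _ _ g.
have ee : (h ∘ g) ∘ (h ∘ g) = h ∘ g by rewrite -compA (compA g) ghg.
(* With [h ∘ g] the identity, commutativity would make g invertible, against the choice of c; with
   [h ∘ g] zero, g = g h g would vanish and f would be scalar. *)
have e1 : h ∘ g <> idm X.
  by move=> e; apply: nc; exists h; split=> //; rewrite cX.
have e0 : h ∘ g <> 0.
  move=> e; apply: (nf c); apply: subr0_eq; rewrite -/g -ghg -compA e.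
  by rewrite comp0r.
move: (h ∘ g) ee e1 e0 => e ee e1 e0.
have [X1 [i1 [p1 [pi1 ip1]]]] := spl _ _ ee.
have ee' : (idm X - e) ∘ (idm X - e) = idm X - e.
  by rewrite compBl comp1m compBr compm1 ee subrr subr0.
have [X2 [i2 [p2 [pi2 ip2]]]] := spl _ _ ee'.
have eX1 (W : C) (u : hom W X1) : e ∘ (i1 ∘ u) = i1 ∘ u.
  by rewrite compA -ip1 -(compA i1) pi1 compm1.
have eX1' (W : C) (u : hom X1 W) : (u ∘ p1) ∘ e = u ∘ p1.
  by rewrite -compA -ip1 (compA p1) pi1 comp1m.
have ei2 : e ∘ i2 = 0.
  rewrite -[i2]compm1 -pi2 (compA i2) ip2 compA compBr compm1 ee subrr.
  by rewrite comp0l.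
have p2e : p2 ∘ e = 0.
  rewrite -[p2]comp1m -pi2 -(compA p2) ip2 -compA compBl comp1m ee subrr.
  by rewrite comp0r.
have p1i2 : p1 ∘ i2 = 0.
  by rewrite -[p1]comp1m -pi1 -(compA p1) ip1 -compA ei2 comp0r.
have p2i1 : p2 ∘ i1 = 0.
  by rewrite -[i1]compm1 -pi1 (compA i1) ip1 compA p2e comp0l.
apply: (multiplicity_free_biproduct pi1 pi2 p1i2 p2i1).
- by rewrite ip1 ip2 addrC subrK.
- move=> u; have := cX e (i2 ∘ u ∘ p1).
  rewrite !compA ei2 !comp0l eX1' => /(congr1 (fun h => p2 ∘ h ∘ i1)).
  by rewrite comp0r comp0l !compA pi2 comp1m -compA pi1 compm1.
- move=> u; have := cX e (i1 ∘ u ∘ p2).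
  rewrite -[RHS]compA p2e comp0r -(compA i1) eX1 => /(congr1 (fun h => p1 ∘ h ∘ i2)).
  by rewrite comp0r comp0l !compA pi1 comp1m -compA pi2 compm1.
- apply: IHN; last exact: commutative_end_retract pi1 cX.
  by apply: leq_trans leN; apply: (rk _ _ i1 p1) => //; rewrite ip1.
- apply: IHN; last exact: commutative_end_retract pi2 cX.
  apply: leq_trans leN; apply: (rk _ _ i2 p2) => //; rewrite ip2.
  by move=> /(congr1 (fun x => idm X - x)); rewrite opprB addrC subrK subrr.
Qed.

End IdempotentsSplit.

(** * Kernels of modules *)

Section ModuleKernels.
Variables (k : fieldType) (A : falgType k) (M N : fdModule A).
Variable f : @hom k (fdModuleCat A) M N.

Let F : 'M[k]_(mdim N, mdim M) := sublmod_val f.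
(** [kermx] consists of row vectors while modules consist of columns, hence the transposes. The
    columns of K form a basis of the kernel of F and L is a left inverse of K, so that a acts on the
    kernel by L a K. *)
Let K : 'M[k]_(mdim M, \rank (kermx F^T)) := (row_base (kermx F^T))^T.
Let L : 'M[k]_(\rank (kermx F^T), mdim M) := (pinvmx K^T)^T.

Let FK0 : F *m K = 0.
Proof.
apply: trmx_inj; rewrite trmx_mul trmx0 /K trmxK.
by apply/sub_kermxP; rewrite eq_row_base.
Qed.

Let LK : L *m K = 1%:M.
Proof.
apply: trmx_inj; rewrite trmx_mul trmx1 /L (trmxK (pinvmx _)) mulmxVp // /K trmxK.
exact: row_base_free.
Qed.

Let KL n (X : 'M[k]_(mdim M, n)) : F *m X = 0 -> K *m (L *m X) = X.
Proof.
move=> FX; rewrite mulmxA; apply: trmx_inj; rewrite !trmx_mul /L (trmxK (pinvmx _)) mulmxA mulmxKpV //.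
rewrite /K trmxK eq_row_base; apply/sub_kermxP.
by rewrite -trmx_mul FX trmx0.
Qed.

Let Fact n (X : 'M[k]_(mdim M, n)) a : F *m X = 0 -> F *m (mact M a *m X) = 0.
Proof. by move=> FX; rewrite mulmxA (sublmodP f a) -mulmxA FX mulmx0. Qed.

Lemma module_kernel : exists (Q : fdModuleCat A) (i : hom Q (M : fdModuleCat A)),
  [/\ f ∘ i = 0, monic i &
    forall W (h : hom W (M : fdModuleCat A)), f ∘ h = 0 -> exists u, h = i ∘ u].
Proof.
have lin : linear (fun a => L *m mact M a *m K).
  by move=> c a b; rewrite (mact_linear M) mulmxDr mulmxDl -scalemxAr -scalemxAl.
have act1 : L *m mact M 1 *m K = 1%:M by rewrite mact1 mulmx1 LK.
have actM a b : L *m mact M (a * b) *m K =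
    (L *m mact M a *m K) *m (L *m mact M b *m K).
  rewrite mactM -!mulmxA; congr (L *m (_ *m _)).
  by rewrite KL //; apply: Fact.
pose Q := @FdModule k A _ _ lin act1 actM.
have morK : @module_morphism k A Q M K.
  by move=> a /=; rewrite -!mulmxA KL //; apply: Fact.
exists Q, (mk_sublmod (module_morphism_submod Q M) morK); split.
- by apply/val_inj; exact: FK0.
- move=> W g h /(congr1 (fun x => L *m sublmod_val x)) /=.
  by rewrite !mulmxA LK !mul1mx => gh; apply/val_inj.
- move=> W h /(congr1 (@sublmod_val _ _ _ _)) /= Fh.
  have morU : @module_morphism k A W Q (L *m sublmod_val h).
    by move=> a /=; rewrite -!mulmxA KL // (sublmodP h a).
  by exists (mk_sublmod (module_morphism_submod W Q) morU); apply/val_inj; rewrite /= KL.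
Qed.

End ModuleKernels.

Lemma module_has_kernels (k : fieldType) (A : falgType k) :
  has_kernels (fdModuleCat A).
Proof. by move=> X Y f; apply: module_kernel. Qed.

Lemma module_has_eigenvalues (k : closedFieldType) (A : falgType k) :
  has_eigenvalues (fdModuleCat A).
Proof.
move=> M f M0; have m0 : (0 < mdim M)%N.
  rewrite lt0n; apply/eqP => m0; apply: M0; apply/val_inj => /=.
  by apply/matrixP => i; have := ltn_ord i; rewrite {2}m0.
have /closed_rootP [c] : size (char_poly (sublmod_val f)) != 1%N.
  by rewrite size_char_poly eqSS -lt0n.
rewrite -eigenvalue_root_char => /eigenvalueP [v vf v0].
(* A row eigenvector suffices: it is killed by f - c, which therefore has no right inverse. *)
exists c => -[g [_ /(congr1 (@sublmod_val _ _ _ _)) /= fg]].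
case/eqP: v0; rewrite -[v]mulmx1 -fg mulmxA.
by rewrite mulmxBr vf -scalemxAr mulmx1 subrr mul0mx.
Qed.

Lemma module_has_rank (k : fieldType) (A : falgType k) :
  @has_rank k (fdModuleCat A) (@mdim k A).
Proof.
move=> X Y i p /(congr1 (@sublmod_val _ _ _ _)) /= pi ip.
set I := sublmod_val i in pi; set P := sublmod_val p in pi.
have rI : \rank I = mdim Y.
  apply/eqP; rewrite eqn_leq rank_leq_col /=.
  by rewrite -[X in (X <= _)%N](mxrank1 k) -pi mxrankM_maxr.
(* If dim X <= dim Y, then I has full row rank and cancels on the right in I P I = I. *)
rewrite ltnNge; apply/negP => le; apply: ip; apply/val_inj => /=.
have fI : row_free I by rewrite -row_leq_rank rI.
apply: (row_free_inj fI).
by rewrite /= -/I -/P -mulmxA pi mulmx1 mul1mx.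
Qed.

(** * Transfer along faithful functors and equivalences *)

Section Transfer.
Variables (k : fieldType) (C D : linCat k) (F : functor C D).
Hypotheses (linF : linear_functor F).
Hypothesis faithF : forall (X Y : C) (f g : hom X Y), fmap F f = fmap F g -> f = g.

Lemma fmap_iso (X Y : C) (f : hom X Y) : is_iso f -> is_iso (fmap F f).
Proof.
by move=> [g [gf fg]]; exists (fmap F g); split; rewrite -fmapM ?gf ?fg fmap1.
Qed.

Lemma faithful_eigenvalues : has_eigenvalues D -> has_eigenvalues C.
Proof.
move=> eigD X f X0; have [|c nc] := eigD (F X) (fmap F f).
  move=> FX0; apply: X0; apply: faithF; rewrite fmap1 FX0.
  by rewrite (linear_zero (@linF X X)).
exists c => /fmap_iso; apply: contra_not nc.
by rewrite (linear_mapB (@linF X X)) (linear_mapZ (@linF X X)) fmap1.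
Qed.

Lemma faithful_rank mu : has_rank mu -> @has_rank k C (mu \o F).
Proof.
move=> rk X Y i p pi ip; apply: (rk _ _ (fmap F i) (fmap F p)).
  by rewrite -fmapM pi fmap1.
by rewrite -fmapM -fmap1 => /faithF.
Qed.

End Transfer.

Section Equivalence.
Variables (k : fieldType) (C D : linCat k) (F : functor C D) (G : functor D C).
Variables (eta : forall X : C, hom X (G (F X))) (eps : forall Y : D, hom (F (G Y)) Y).
Hypotheses (linG : linear_functor G).
Hypothesis eta_nat : forall X Y (f : hom X Y), eta Y ∘ f = fmap G (fmap F f) ∘ eta X.
Hypothesis eta_iso : forall X, is_iso (eta X).
Hypothesis eps_nat : forall X Y (f : hom X Y), f ∘ eps X = eps Y ∘ fmap F (fmap G f).
Hypothesis eps_iso : forall Y, is_iso (eps Y).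

Lemma equivalence_faithful (X Y : C) (f g : hom X Y) : fmap F f = fmap F g -> f = g.
Proof.
move=> fg; have [h [h1 _]] := eta_iso Y.
by rewrite -[f]comp1m -[g]comp1m -h1 -!compA !eta_nat fg.
Qed.

(** The kernel of [fmap F f] is carried back by G and corrected by the inverse of eta. [fmap G i]
    stays monic because eps relates its image under F to i, and F is faithful. *)
Lemma equivalence_kernels : linear_functor F -> has_kernels D -> has_kernels C.
Proof.
move=> linF kerD X Y f; have [K [i [fi im iu]]] := kerD _ _ (fmap F f).
have [hX [hX1 hX2]] := eta_iso X; have [hY [hY1 _]] := eta_iso Y.
exists (G K), (hX ∘ fmap G i); split.
- rewrite compA -[f]comp1m -hY1 -(compA hY) eta_nat -!compA.
  rewrite (compA (eta X)) hX2 comp1m -fmapM fi.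
  by rewrite (linear_zero (@linG _ _)) comp0r.
- move=> W a b ab; have : fmap G i ∘ a = fmap G i ∘ b.
    by rewrite -[fmap G i]comp1m -hX2 -!compA !(compA hX) ab.
  move=> /(congr1 (fun x => eps _ ∘ fmap F x)); rewrite !fmapM !compA -!eps_nat.
  rewrite -!compA => /im; have [h [h1 _]] := eps_iso K.
  move=> /(congr1 (fun x => h ∘ x)); rewrite !compA h1 !comp1m.
  exact: equivalence_faithful.
- move=> W h fh; have [|u Fh] := iu _ (fmap F h).
    by rewrite -fmapM fh (linear_zero (@linF _ _)).
  exists (fmap G u ∘ eta W); rewrite -[h]comp1m -hX1 -compA eta_nat Fh.
  by rewrite fmapM !compA.
Qed.

End Equivalence.

Section FiniteTensor.
Variables (k : closedFieldType) (C : finTensorCat k).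

Lemma fin_kernels : has_kernels C.
Proof.
have [A [F [G [eta [eps [[lF lG] e1 e2 e3 e4]]]]]] := fin_modules C.
exact: (equivalence_kernels lG e1 e2 e3 e4 lF (@module_has_kernels _ A)).
Qed.

Lemma fin_eigenvalues : has_eigenvalues C.
Proof.
have [A [F [G [eta [eps [[lF lG] e1 e2 e3 e4]]]]]] := fin_modules C.
exact: (faithful_eigenvalues lF (equivalence_faithful e1 e2) (@module_has_eigenvalues _ A)).
Qed.

Lemma fin_rank : exists mu, @has_rank k C mu.
Proof.
have [A [F [G [eta [eps [[lF lG] e1 e2 e3 e4]]]]]] := fin_modules C.
exists (@mdim k A \o F).
exact: (faithful_rank (equivalence_faithful e1 e2) (@module_has_rank _ A)).
Qed.

End FiniteTensor.

(** * Direct sums *)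

Section Biproducts.
Variables (k : fieldType).

Definition is_biproduct (C : linCat k) (X1 X2 X : C) :=
  exists (i1 : hom X1 X) (i2 : hom X2 X) (p1 : hom X X1) (p2 : hom X X2),
    [/\ p1 ∘ i1 = idm X1, p2 ∘ i2 = idm X2, p1 ∘ i2 = 0, p2 ∘ i1 = 0 &
        i1 ∘ p1 + i2 ∘ p2 = idm X].

Definition has_biproducts (C : linCat k) :=
  forall X1 X2 : C, exists X, is_biproduct X1 X2 X.

Lemma module_has_biproducts (A : falgType k) : has_biproducts (fdModuleCat A).
Proof.
move=> M N.
have lin : linear (fun a => block_mx (mact M a) 0 0 (mact N a)).
  move=> c a b; rewrite !(mact_linear, mact_linear N).
  by rewrite scale_block_mx add_block_mx !scaler0 !addr0.
have act1 : block_mx (mact M 1) 0 0 (mact N 1) = 1%:M.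
  by rewrite !mact1 -scalar_mx_block.
have actM a b : block_mx (mact M (a * b)) 0 0 (mact N (a * b)) =
    block_mx (mact M a) 0 0 (mact N a) *m block_mx (mact M b) 0 0 (mact N b).
  by rewrite mulmx_block !mactM !(mulmx0, mul0mx) !(addr0, add0r).
pose Q := @FdModule k A _ _ lin act1 actM.
have m1 : @module_morphism k A M Q (col_mx 1%:M 0).
  by move=> a /=; rewrite mul_col_mx mul_block_col !(mulmx0, mul0mx, mulmx1, mul1mx) !addr0.
have m2 : @module_morphism k A N Q (col_mx 0 1%:M).
  by move=> a /=; rewrite mul_col_mx mul_block_col !(mulmx0, mul0mx, mulmx1, mul1mx) !add0r.
have m3 : @module_morphism k A Q M (row_mx 1%:M 0).
  by move=> a /=; rewrite mul_mx_row mul_row_block !(mulmx0, mul0mx, mulmx1, mul1mx) !addr0.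
have m4 : @module_morphism k A Q N (row_mx 0 1%:M).
  by move=> a /=; rewrite mul_mx_row mul_row_block !(mulmx0, mul0mx, mulmx1, mul1mx) !add0r.
exists Q, (mk_sublmod (module_morphism_submod M Q) m1), (mk_sublmod (module_morphism_submod N Q) m2),
  (mk_sublmod (module_morphism_submod Q M) m3), (mk_sublmod (module_morphism_submod Q N) m4).
split; apply/val_inj => /=.
- by rewrite mul_row_col mulmx1 mulmx0 addr0.
- by rewrite mul_row_col mulmx1 mulmx0 add0r.
- by rewrite mul_row_col mulmx0 mul0mx addr0.
- by rewrite mul_row_col mulmx0 mul0mx addr0.
- rewrite !mul_col_mx !mul_mx_row !(mulmx0, mul0mx, mulmx1).
  by rewrite add_col_mx !add_row_mx !(addr0, add0r) -block_mxEv -scalar_mx_block.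
Qed.

Lemma functor_biproduct (C D : linCat k) (F : functor C D) (X1 X2 X : C) :
  linear_functor F -> is_biproduct X1 X2 X -> is_biproduct (F X1) (F X2) (F X).
Proof.
move=> lF [i1 [i2 [p1 [p2 [e1 e2 e3 e4 e5]]]]].
exists (fmap F i1), (fmap F i2), (fmap F p1), (fmap F p2).
split; rewrite -!fmapM ?e1 ?e2 ?e3 ?e4 ?fmap1 ?(linear_zero (@lF _ _)) //.
by rewrite -(linear_mapD (@lF _ _)) e5 fmap1.
Qed.

Lemma biproduct_iso (C : linCat k) (X1 Y1 X2 Y2 X : C) :
  isomorphic X1 Y1 -> isomorphic X2 Y2 -> is_biproduct X1 X2 X -> is_biproduct Y1 Y2 X.
Proof.
move=> [f [f' [ff1 ff2]]] [g [g' [gg1 gg2]]] [i1 [i2 [p1 [p2 [e1 e2 e3 e4 e5]]]]].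
exists (i1 ∘ f'), (i2 ∘ g'), (f ∘ p1), (g ∘ p2); split.
- by rewrite compA -(compA f) e1 compm1 ff2.
- by rewrite compA -(compA g) e2 compm1 gg2.
- by rewrite compA -(compA f) e3 comp0r comp0l.
- by rewrite compA -(compA g) e4 comp0r comp0l.
- by rewrite !compA -(compA i1) ff1 -(compA i2) gg1 !compm1 e5.
Qed.

Lemma biproducts_direct_sum (C : linCat k) (Z : C) : has_biproducts C -> is_zero Z ->
  forall n (S : 'I_n -> C), exists X, is_direct_sum S X.
Proof.
move=> bip Z0; elim=> [|n IHn] S.
  exists Z, (fun _ => 0), (fun _ => 0); split; [by case | by case |].
  by rewrite big_ord0 Z0.
have [X1 [i [p [pi pi0 ip]]]] := IHn (fun a => S (lift ord0 a)).
have [X [i1 [i2 [p1 [p2 [e1 e2 e3 e4 e5]]]]]] := bip (S ord0) X1.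
(* The summands are re-expressed through [unlift] so that inclusions and projections can be defined
   by a dependent match. *)
pose T a := match unlift ord0 a with Some b => S (lift ord0 b) | None => S ord0 end.
have ST a : S a = T a.
  by rewrite /T; case: unliftP => [b|] ->.
have -> : S = T by apply: funext.
exists X.
exists (fun a => match unlift ord0 a as u return
  hom (match u with Some b => S (lift ord0 b) | None => S ord0 end) X with
  | Some b => i2 ∘ i b | None => i1 end).
exists (fun a => match unlift ord0 a as u return
  hom X (match u with Some b => S (lift ord0 b) | None => S ord0 end) with
  | Some b => p b ∘ p2 | None => p1 end).
split.
- move=> a; rewrite /T; case: (unlift ord0 a) => [b|] //.
  by rewrite compA -(compA (p b)) e2 compm1 pi.
- move=> a b ab; rewrite /T.
  case: (unliftP ord0 a) ab => [a'|] ->; case: (unliftP ord0 b) => [b'|] -> // ab.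
  + rewrite compA -(compA (p b')) e2 compm1 pi0 // => e; by rewrite e in ab.
  + by rewrite compA e3 comp0l.
  + by rewrite -compA e4 comp0r.
- rewrite big_ord_recl /= /T.
  set G := (X in _ + X); have -> : G = i2 ∘ p2.
    rewrite /G -[i2 in RHS]compm1 -ip comp_sumr comp_suml; apply: eq_bigr => a _.
    by case: (unliftP ord0 (lift ord0 a)) => [b /lift_inj ->|/eqP]; rewrite ?compA // eq_sym (negbTE (neq_lift _ _)).
  by case: (unliftP ord0 ord0) => [b /eqP|_]; [rewrite (negbTE (neq_lift _ _)) | rewrite e5].
Qed.

End Biproducts.

Lemma fin_direct_sum (k : closedFieldType) (C : finTensorCat k) n (S : 'I_n -> C) :
  exists X, is_direct_sum S X.
Proof.
have [A [F [G [eta [eps [[lF lG] e1 e2 e3 e4]]]]]] := fin_modules C.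
(* A zero object arises as the kernel of an identity. *)
have [Z Z0] : exists Z : C, is_zero Z.
  have [K [i [fi im _]]] := fin_kernels (idm (tunit C)).
  exists K; apply: im; rewrite compm1 comp0r.
  by rewrite -[i]comp1m.
apply: biproducts_direct_sum Z0 _ _ => X1 X2.
have [X bX] := module_has_biproducts (F X1 : fdModuleCat A) (F X2).
exists (G X); apply: biproduct_iso (functor_biproduct lG bX).
  by apply: isomorphic_sym; exists (eta X1).
by apply: isomorphic_sym; exists (eta X2).
Qed.

(** * Calculus in monoidal categories *)

Notation "X ◁ f" := (idm X ⊠ f) (at level 38, f at level 38, right associativity) : cat_scope.
Notation "f ▷ X" := (f ⊠ idm X) (at level 39, left associativity) : cat_scope.

Section MonoidalCalculus.
Variables (k : fieldType) (C : monCat k).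
Implicit Types P Q V W X Y Z : C.
Local Notation I := (tunit C).

Lemma tensDl X X' Y Y' (f f' : hom X X') (g : hom Y Y') :
  (f + f') ⊠ g = f ⊠ g + f' ⊠ g.
Proof. exact: (linear_mapD (@tensm_linl k C X X' Y Y' g)). Qed.
Lemma tensDr X X' Y Y' (f : hom X X') (g g' : hom Y Y') :
  f ⊠ (g + g') = f ⊠ g + f ⊠ g'.
Proof. exact: (linear_mapD (@tensm_linr k C X X' Y Y' f)). Qed.
Lemma tensZl X X' Y Y' a (f : hom X X') (g : hom Y Y') :
  (a *: f) ⊠ g = a *: (f ⊠ g).
Proof. exact: (linear_mapZ (@tensm_linl k C X X' Y Y' g)). Qed.
Lemma tensZr X X' Y Y' a (f : hom X X') (g : hom Y Y') :
  f ⊠ (a *: g) = a *: (f ⊠ g).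
Proof. exact: (linear_mapZ (@tensm_linr k C X X' Y Y' f)). Qed.
Lemma tens0l X X' Y Y' (g : hom Y Y') : (0 : hom X X') ⊠ g = 0.
Proof. exact: (linear_zero (@tensm_linl k C X X' Y Y' g)). Qed.
Lemma tens0r X X' Y Y' (f : hom X X') : f ⊠ (0 : hom Y Y') = 0.
Proof. exact: (linear_zero (@tensm_linr k C X X' Y Y' f)). Qed.
Lemma tens_suml X X' Y Y' (g : hom Y Y') J r (P : pred J) (F : J -> hom X X') :
  (\sum_(i <- r | P i) F i) ⊠ g = \sum_(i <- r | P i) (F i ⊠ g).
Proof. exact: (linear_map_sum (@tensm_linl k C X X' Y Y' g)). Qed.
Lemma tens_sumr X X' Y Y' (f : hom X X') J r (P : pred J) (G : J -> hom Y Y') :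
  f ⊠ (\sum_(i <- r | P i) G i) = \sum_(i <- r | P i) (f ⊠ G i).
Proof. exact: (linear_map_sum (@tensm_linr k C X X' Y Y' f)). Qed.

Lemma assoc_natl X X' Y Z (f : hom X X') :
  assoc X' Y Z ∘ (f ▷ Y ▷ Z) = (f ▷ (Y ⊗ Z)) ∘ assoc X Y Z.
Proof. by rewrite assoc_nat tensm1. Qed.
Lemma assoc_natm X Y Y' Z (g : hom Y Y') :
  assoc X Y' Z ∘ ((X ◁ g) ▷ Z) = (X ◁ (g ▷ Z)) ∘ assoc X Y Z.
Proof. exact: assoc_nat. Qed.
Lemma assoc_natr X Y Z Z' (h : hom Z Z') :
  assoc X Y Z' ∘ ((X ⊗ Y) ◁ h) = (X ◁ Y ◁ h) ∘ assoc X Y Z.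
Proof. by rewrite -tensm1 assoc_nat. Qed.
Lemma assocV_natl X X' Y Z (f : hom X X') :
  assocV X' Y Z ∘ (f ▷ (Y ⊗ Z)) = (f ▷ Y ▷ Z) ∘ assocV X Y Z.
Proof. by rewrite -tensm1 assocV_nat. Qed.
Lemma assocV_natm X Y Y' Z (g : hom Y Y') :
  assocV X Y' Z ∘ (X ◁ (g ▷ Z)) = ((X ◁ g) ▷ Z) ∘ assocV X Y Z.
Proof. exact: assocV_nat. Qed.
Lemma assocV_natr X Y Z Z' (h : hom Z Z') :
  assocV X Y Z' ∘ (X ◁ Y ◁ h) = ((X ⊗ Y) ◁ h) ∘ assocV X Y Z.
Proof. by rewrite assocV_nat tensm1. Qed.

Lemma inverse_tensl X Y Z (f : hom X Y) (g : hom Y X) :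
  inverse f g -> inverse (f ▷ Z) (g ▷ Z).
Proof. by move=> [gf fg]; split; rewrite -tensml ?gf ?fg tensm1. Qed.

Lemma inverse_tensr X Y Z (f : hom X Y) (g : hom Y X) :
  inverse f g -> inverse (Z ◁ f) (Z ◁ g).
Proof. by move=> [gf fg]; split; rewrite -tensmr ?gf ?fg tensm1. Qed.

(** Left-handed and inverse forms are read off from [revCat], where the tensor factors are reversed
    and [assoc] and [assocV] trade places. *)
Lemma pentagonV X Y Z W :
  assocV (X ⊗ Y) Z W ∘ assocV X Y (Z ⊗ W) =
  (assocV X Y Z ▷ W) ∘ assocV X (Y ⊗ Z) W ∘ (X ◁ assocV Y Z W).
Proof. exact: (@pentagon k (revCat C) W Z Y X). Qed.

Lemma lunit_tens X Y : lunit (X ⊗ Y) = (lunit X ▷ Y) ∘ assocV I X Y.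
Proof. exact: (@runit_tens k (revCat C) Y X). Qed.

Lemma runitV_tens X Y : runitV (X ⊗ Y) = assocV X Y I ∘ (X ◁ runitV Y).
Proof.
apply: (inverse_mono (runitP _)); rewrite runitVK runit_tens -!compA.
by rewrite (compA (assoc _ _ _)) assocVK comp1m -tensmr runitVK tensm1.
Qed.

End MonoidalCalculus.

Section UnitCoherence.
Variables (k : fieldType) (C : monCat k).
Implicit Types X Y : C.
Local Notation I := (tunit C).

Lemma lunitV_tens X Y : lunitV (X ⊗ Y) = assoc I X Y ∘ (lunitV X ▷ Y).
Proof. exact: (@runitV_tens k (revCat C) Y X). Qed.

Lemma triangle_assocV X Y : (runit X ▷ Y) ∘ assocV X I Y = X ◁ lunit Y.
Proof. by rewrite -triangle -compA assocVK compm1. Qed.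

(** Kelly's argument: naturality of [lunit] at itself gives [lunit (I ⊗ I) = I ◁ lunit I], and the
    triangle axiom then compares the two unitors. *)
Lemma lunit_runit : lunit I = runit I.
Proof.
have E : lunit (I ⊗ I) = I ◁ lunit I.
  by apply: (inverse_mono (lunitP _)); rewrite lunit_nat.
have : lunit I ▷ I = runit I ▷ I.
  by rewrite -triangle -E lunit_tens -compA assocK compm1.
by move=> e; apply: (inverse_epi (runitP _)); rewrite -!runit_nat e.
Qed.

Lemma lunitV_runitV : lunitV I = runitV I.
Proof.
by apply: (inverse_mono (lunitP _)); rewrite lunitVK lunit_runit runitVK.
Qed.

End UnitCoherence.

(** * Dual pairs as adjunctions *)

Section DualPairs.
Variables (k : fieldType) (C : monCat k) (A B : C).
Local Notation I := (tunit C).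
Implicit Types P Q V W X Y Z : C.

(* Unit and counit of the adjunction between [- ⊗ A] and [- ⊗ B], and their
   left-handed versions.  They are locked because [compA] would otherwise
   rewrite inside them. *)
Definition coevr (c : hom I (A ⊗ B)) V : hom V (V ⊗ A ⊗ B) :=
  locked (assocV V A B ∘ (V ◁ c) ∘ runitV V).
Definition evr (e : hom (B ⊗ A) I) Y : hom (Y ⊗ B ⊗ A) Y :=
  locked (runit Y ∘ (Y ◁ e) ∘ assoc Y B A).
Definition coevl (c : hom I (A ⊗ B)) V : hom V (A ⊗ (B ⊗ V)) :=
  locked (assoc A B V ∘ (c ▷ V) ∘ lunitV V).
Definition evl (e : hom (B ⊗ A) I) Y : hom (B ⊗ (A ⊗ Y)) Y :=
  locked (lunit Y ∘ (e ▷ Y) ∘ assocV B A Y).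

Variables (e : hom (B ⊗ A) I) (c : hom I (A ⊗ B)).

Lemma coevrE V : coevr c V = assocV V A B ∘ (V ◁ c) ∘ runitV V.
Proof. by rewrite /coevr -lock. Qed.
Lemma evrE Y : evr e Y = runit Y ∘ (Y ◁ e) ∘ assoc Y B A.
Proof. by rewrite /evr -lock. Qed.
Lemma coevlE V : coevl c V = assoc A B V ∘ (c ▷ V) ∘ lunitV V.
Proof. by rewrite /coevl -lock. Qed.
Lemma evlE Y : evl e Y = lunit Y ∘ (e ▷ Y) ∘ assocV B A Y.
Proof. by rewrite /evl -lock. Qed.

Lemma coevr_nat X Y (f : hom X Y) :
  coevr c Y ∘ f = (f ▷ A ▷ B) ∘ coevr c X.
Proof. by rewrite !coevrE; apply: eta_nat. Qed.
Lemma evr_nat X Y (f : hom X Y) :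
  evr e Y ∘ (f ▷ B ▷ A) = f ∘ evr e X.
Proof. by rewrite !evrE; apply: eps_nat. Qed.

Lemma coevr_tens P V :
  coevr c (P ⊗ V) = (assocV P V A ▷ B) ∘ assocV P (V ⊗ A) B ∘ (P ◁ coevr c V).
Proof.
rewrite !coevrE runitV_tens !tensmr !compA -pentagonV.
by rewrite -!compA [in RHS](compA (assocV P V (A ⊗ B))) assocV_natr !compA.
Qed.

Lemma evr_tens P Y :
  evr e (P ⊗ Y) = (P ◁ evr e Y) ∘ assoc P (Y ⊗ B) A ∘ (assoc P Y B ▷ A).
Proof.
rewrite !evrE runit_tens !tensmr -!compA.
by congr (_ ∘ _); rewrite compA assoc_natr -compA pentagon !compA.
Qed.

Lemma coevr_unit : coevr c I = (lunitV A ▷ B) ∘ c.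
Proof.
rewrite coevrE -lunitV_runitV -compA -lunitV_nat compA lunitV_tens compA.
by rewrite assocK comp1m.
Qed.

Lemma evr_unit : evr e I = e ∘ (lunit B ▷ A).
Proof.
rewrite evrE -lunit_runit lunit_nat -compA; congr (_ ∘ _).
by rewrite lunit_tens -compA assocK compm1.
Qed.

Hypothesis d : is_left_dual e c.

Lemma triangler1 V : evr e (V ⊗ A) ∘ (coevr c V ▷ A) = idm (V ⊗ A).
Proof. by rewrite !(coevrE, evrE); apply: triangle1. Qed.
Lemma triangler2 Y : (evr e Y ▷ B) ∘ coevr c (Y ⊗ B) = idm (Y ⊗ B).
Proof. by rewrite !(coevrE, evrE); apply: triangle2. Qed.

End DualPairs.

Section LeftHanded.
Variables (k : fieldType) (C : monCat k) (A B : C).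
Local Notation I := (tunit C).
Variables (e : hom (B ⊗ A) I) (c : hom I (A ⊗ B)).
Implicit Types P Q V W X Y Z : C.

Lemma coevl_nat X Y (f : hom X Y) :
  coevl c Y ∘ f = (A ◁ B ◁ f) ∘ coevl c X.
Proof. exact: (@coevr_nat k (revCat C)). Qed.
Lemma evl_nat X Y (f : hom X Y) :
  evl e Y ∘ (B ◁ A ◁ f) = f ∘ evl e X.
Proof. exact: (@evr_nat k (revCat C)). Qed.

Lemma evl_tens Y P :
  evl e (Y ⊗ P) = (evl e Y ▷ P) ∘ assocV B (A ⊗ Y) P ∘ (B ◁ assocV A Y P).
Proof. exact: (@evr_tens k (revCat C)). Qed.

Lemma coevl_unit : coevl c I = (A ◁ runitV B) ∘ c.
Proof. exact: (@coevr_unit k (revCat C)). Qed.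
Lemma evl_unit : evl e I = e ∘ (B ◁ runit A).
Proof. exact: (@evr_unit k (revCat C)). Qed.

Hypothesis d : is_left_dual e c.

Lemma trianglel1 V : evl e (B ⊗ V) ∘ (B ◁ coevl c V) = idm (B ⊗ V).
Proof. exact: (@triangler1 k (revCat C) _ _ _ _ (rev_left_dual d)). Qed.
Lemma trianglel2 Y : (A ◁ evl e Y) ∘ coevl c (A ⊗ Y) = idm (A ⊗ Y).
Proof. exact: (@triangler2 k (revCat C) _ _ _ _ (rev_left_dual d)). Qed.

End LeftHanded.

(** * Mates and transposes *)

Section Mates.
Variables (k : fieldType) (C : monCat k) (A B : C).
Local Notation I := (tunit C).
Variables (e : hom (B ⊗ A) I) (c : hom I (A ⊗ B)).
Hypothesis d : is_left_dual e c.
Implicit Types V Y : C.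

Lemma snaker : evr e A ∘ (c ▷ A) ∘ lunitV A = idm A.
Proof. by rewrite evrE; case: d. Qed.

Lemma mateK V Y (u : hom V (Y ⊗ B)) :
  ((evr e Y ∘ (u ▷ A)) ▷ B) ∘ coevr c V = u.
Proof. by rewrite tensml -compA -coevr_nat compA triangler2 // comp1m. Qed.

Lemma mateVK V Y (g : hom (V ⊗ A) Y) :
  evr e Y ∘ (((g ▷ B) ∘ coevr c V) ▷ A) = g.
Proof. by rewrite tensml compA evr_nat -compA triangler1 // compm1. Qed.

Lemma mate_inj V Y (u v : hom V (Y ⊗ B)) :
  evr e Y ∘ (u ▷ A) = evr e Y ∘ (v ▷ A) -> u = v.
Proof. by move=> uv; rewrite -[u]mateK uv mateK. Qed.

Lemma ev_mate V (g : hom (V ⊗ A) I) :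
  e ∘ ((lunit B ∘ (g ▷ B) ∘ coevr c V) ▷ A) = g.
Proof.
by rewrite -compA tensml compA -evr_unit mateVK.
Qed.

Lemma ev_inj V (u v : hom V B) : e ∘ (u ▷ A) = e ∘ (v ▷ A) -> u = v.
Proof.
move=> uv; apply: (inverse_mono (conj (lunitVK B) (lunitK B))).
apply: mate_inj; rewrite evr_unit !tensml !compA.
by rewrite -!(compA e) -!tensml !lunitVK !comp1m.
Qed.

(** Applied to the pivotal isomorphism from X to its double dual, this makes X itself a left dual of
    [dual X]. *)
Lemma left_dual_iso B' (f : hom B' B) (g : hom B B') : inverse f g ->
  is_left_dual (e ∘ (f ▷ A)) ((A ◁ g) ∘ c).
Proof.
move=> [gf fg]; case: d => d1 d2; split.
  rewrite tensmr tensml !compA.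
  rewrite -(compA _ (assoc _ _ _)) assoc_natm !compA -(compA _ _ (A ◁ (g ▷ A))).
  by rewrite -tensmr -tensml fg tensm1 tensm1 compm1.
rewrite tensmr tensml !compA.
rewrite -(compA _ (assocV _ _ _)) assocV_natr.
rewrite -[_ ∘ (f ▷ A ▷ B')]compA !compA.
rewrite -[_ ∘ _ ∘ ((B' ⊗ A) ◁ g)]compA -[f ▷ A ▷ B' ∘ _]tensmM comp1m compm1.
have -> : (f ▷ A) ⊠ g = ((B ⊗ A) ◁ g) ∘ (f ▷ A ▷ B) by rewrite -tensmM comp1m compm1.
rewrite !compA -[_ ∘ (e ▷ B') ∘ _]compA tensm_swap !compA lunit_nat.
rewrite -[_ ∘ (f ▷ A ▷ B) ∘ _]compA -assocV_natl !compA.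
rewrite -[_ ∘ (f ▷ _) ∘ _]compA tensm_swap !compA -[_ ∘ (f ▷ _) ∘ _]compA -runitV_nat.
transitivity (g ∘ (lunit B ∘ (e ▷ B) ∘ assocV B A B ∘ (B ◁ c) ∘ runitV B) ∘ f).
  by rewrite !compA.
by rewrite d2 compm1.
Qed.

End Mates.

Section DualMorphisms.
Variables (k : fieldType) (C : rigidCat k).
Local Notation I := (tunit C).
Implicit Types P Q V W X Y Z : C.

Lemma transposeE X Y X' Y' (c : hom I (X ⊗ X')) (e : hom (Y' ⊗ Y) I) (f : hom X Y) :
  transpose c e f = lunit X' ∘ ((e ∘ (Y' ◁ f)) ▷ X') ∘ coevr c Y'.
Proof. by rewrite /transpose coevrE tensml !compA. Qed.

Lemma transpose_ev X Y X' Y' (eX : hom (X' ⊗ X) I) (c : hom I (X ⊗ X'))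
    (e : hom (Y' ⊗ Y) I) (f : hom X Y) : is_left_dual eX c ->
  eX ∘ (transpose c e f ▷ X) = e ∘ (Y' ◁ f).
Proof. by move=> d; rewrite transposeE (ev_mate d). Qed.

(** Of the second pair a single zigzag is asked, so that the lemma applies to nested pairs, for
    which [nested_snake] supplies exactly that. *)
Lemma transpose_coev X Y X' Y' (eX : hom (X' ⊗ X) I) (c : hom I (X ⊗ X'))
    (eY : hom (Y' ⊗ Y) I) (cY : hom I (Y ⊗ Y')) (f : hom X Y) :
  is_left_dual eX c -> evr eY Y ∘ (cY ▷ Y) ∘ lunitV Y = idm Y ->
  (Y ◁ transpose c eY f) ∘ cY = (f ▷ X') ∘ c.
Proof.
move=> dX dY; apply: (mate_inj dX).
apply: (inverse_epi (conj (lunitVK X) (lunitK X))).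
rewrite !tensml !compA evr_nat -!compA. rewrite [evr eX X ∘ _]compA.
have -> : evr eX X ∘ (c ▷ X) ∘ lunitV X = idm X.
  by rewrite evrE; case: dX.
rewrite compm1 evrE -!compA (compA (assoc _ _ _)) assoc_natm.
rewrite -!compA (compA (Y ◁ eX)) -tensmr (transpose_ev _ _ dX) tensmr.
rewrite -!compA (compA (Y ◁ (Y' ◁ f))) -assoc_natr -!compA (compA _ (cY ▷ X)).
rewrite -tensm_swap -compA -lunitV_nat !compA.
by move: dY; rewrite evrE => ->; rewrite comp1m.
Qed.

Lemma dualm_ev X Y (f : hom X Y) : ev X ∘ (dualm f ▷ X) = ev Y ∘ (dual Y ◁ f).
Proof. by apply: transpose_ev; apply: dualP. Qed.

Lemma dualm_coev X Y (f : hom X Y) : (Y ◁ dualm f) ∘ coev Y = (f ▷ dual X) ∘ coev X.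
Proof.
by apply: transpose_coev; [exact: dualP | exact: (snaker (dualP Y))].
Qed.

Lemma dualm1 X : dualm (idm X) = idm (dual X).
Proof. by apply: (ev_inj (dualP X)); rewrite dualm_ev. Qed.

Lemma dualmM X Y Z (g : hom Y Z) (f : hom X Y) : dualm (g ∘ f) = dualm f ∘ dualm g.
Proof.
apply: (ev_inj (dualP X)); rewrite dualm_ev tensml compA dualm_ev.
by rewrite -compA -tensm_swap compA dualm_ev -compA -tensmr.
Qed.

Lemma dualm_sum X Y n (F : 'I_n -> hom X Y) : dualm (\sum_a F a) = \sum_a dualm (F a).
Proof.
apply: (ev_inj (dualP X)); rewrite dualm_ev tens_suml tens_sumr !comp_sumr.
by apply: eq_bigr => a _; rewrite dualm_ev.
Qed.

Lemma dual_tens_ev X Y : ev (X ⊗ Y) ∘ (dual_tens X Y ▷ (X ⊗ Y)) = ev_tens X Y.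
Proof. by rewrite /dual_tens (transpose_ev _ _ (dualP _)) tensm1 compm1. Qed.

Lemma ev_tensE X Y : ev_tens X Y =
  ev Y ∘ (dual Y ◁ evl (ev X) Y) ∘ assoc (dual Y) (dual X) (X ⊗ Y).
Proof. by rewrite evlE. Qed.

End DualMorphisms.

(** * Pivotal traces *)

Section NestedDuals.
Variables (k : fieldType) (C : monCat k).
Local Notation I := (tunit C).
Implicit Types P Q V W X Y Z : C.

(** The middle factors X' ⊗ X of Q ⊗ X' ⊗ X ⊗ Y may be contracted into Y or into Q: a pentagon
    followed by the triangle axiom. *)
Lemma evl_evr X X' (e : hom (X' ⊗ X) I) Q Y :
  (Q ◁ evl e Y) ∘ assoc Q X' (X ⊗ Y) ∘ assoc (Q ⊗ X') X Y = evr e Q ▷ Y.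
Proof.
rewrite evlE evrE -compA pentagon !compA -tensmr -(compA _ (assocV _ _ _)).
rewrite assocK compm1 tensmr -(compA _ (Q ◁ (e ▷ Y))) -assoc_natm !compA.
by rewrite triangle !tensml.
Qed.

(** The evaluation on a tensor product, with the inner pair contracted first. It is generic in the
    two pairs because it serves both [ev] and [pev]. *)
Definition nested_ev X X' Y Y' (eX : hom (X' ⊗ X) I) (eY : hom (Y' ⊗ Y) I) :
    hom ((Y' ⊗ X') ⊗ (X ⊗ Y)) I :=
  eY ∘ (Y' ◁ evl eX Y) ∘ assoc Y' X' (X ⊗ Y).

Definition nested_coev X X' Y Y' (cX : hom I (X ⊗ X')) (cY : hom I (Y ⊗ Y')) :
    hom I ((X ⊗ Y) ⊗ (Y' ⊗ X')) :=
  assoc (X ⊗ Y) Y' X' ∘ (coevr cY X ▷ X') ∘ cX.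

Lemma nested_evr X X' Y Y' (eX : hom (X' ⊗ X) I) (eY : hom (Y' ⊗ Y) I) P :
  evr (nested_ev eX eY) P ∘ (assoc P Y' X' ▷ (X ⊗ Y)) ∘ assoc (P ⊗ Y' ⊗ X') X Y =
  evr eY P ∘ (evr eX (P ⊗ Y') ▷ Y).
Proof.
rewrite evrE /nested_ev !tensmr !compA.
rewrite -(compA _ (P ◁ assoc _ _ _)) -(compA _ _ (assoc P Y' X' ▷ _)) -pentagon.
rewrite compA -(compA _ (P ◁ (Y' ◁ _))) -assoc_natr compA -evrE.
by rewrite -!compA [_ ∘ (_ ∘ assoc _ _ _)]compA evl_evr.
Qed.

Lemma nested_coevr X X' Y Y' (cX : hom I (X ⊗ X')) (cY : hom I (Y ⊗ Y')) P :
  coevr (nested_coev cX cY) P = assoc (P ⊗ (X ⊗ Y)) Y' X' ∘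
   (assoc P X Y ▷ Y' ▷ X') ∘ (coevr cY (P ⊗ X) ▷ X') ∘ coevr cX P.
Proof.
rewrite coevr_tens -(compA (assoc _ _ _)) -tensml !compA -tensml assocVK tensm1 comp1m.
rewrite (coevrE (nested_coev _ _)) (coevrE cX) /nested_coev !tensmr !tensml !compA.
rewrite -(compA _ _ (assocV P X X')) -assocV_natm !compA. congr (_ ∘ _ ∘ _ ∘ _).
apply: (inverse_mono (conj (assocVK _ _ _) (assocK _ _ _))).
rewrite !compA assocK comp1m pentagonV.
by rewrite -compA -tensmr assocK tensm1 compm1.
Qed.

Lemma evr_compr A A' B (e : hom (B ⊗ A') I) (f : hom A A') P :
  evr (e ∘ (B ◁ f)) P = evr e P ∘ ((P ⊗ B) ◁ f).
Proof. by rewrite !evrE tensmr -!compA assoc_natr. Qed.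

Lemma coevr_compl A B B' (c : hom I (A ⊗ B)) (f : hom B B') P :
  coevr ((A ◁ f) ∘ c) P = ((P ⊗ A) ◁ f) ∘ coevr c P.
Proof. by rewrite !coevrE tensmr !compA assocV_natr. Qed.

Lemma nested_snake X X' Y Y' (eX : hom (X' ⊗ X) I) (cX : hom I (X ⊗ X'))
    (eY : hom (Y' ⊗ Y) I) (cY : hom I (Y ⊗ Y')) :
  is_left_dual eX cX -> is_left_dual eY cY ->
  evr (nested_ev eX eY) (X ⊗ Y) ∘ (nested_coev cX cY ▷ (X ⊗ Y)) ∘ lunitV (X ⊗ Y) =
  idm (X ⊗ Y).
Proof.
move=> dX dY; rewrite lunitV_tens /nested_coev !tensml !compA.
rewrite -(compA _ (_ ▷ (X ⊗ Y)) (assoc _ _ _)) -assoc_natl.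
rewrite -(compA _ _ (assoc _ X Y ∘ _)) (compA _ (assoc _ _ _)) -assoc_natl.
rewrite !compA nested_evr -!(compA (evr eY _)) -!tensml evr_nat -!compA.
by rewrite (compA (evr eX X)) snaker // compm1 triangler1.
Qed.

End NestedDuals.

Section Pivotal.
Variables (k : fieldType) (C : rigidCat k) (j : pivotal C).
Local Notation I := (tunit C).
Implicit Types P Q V W X Y Z : C.

(** The evaluation of the pair in which X is a left dual of [dual X]; composed with [coev X] it is
    the pivotal dimension. *)
Definition pev X : hom (X ⊗ dual X) I := ev (dual X) ∘ (piv j X ▷ dual X).

Lemma pev_dual X : exists c, is_left_dual (pev X) c.
Proof.
have [g [gj jg]] := piv_iso j X.
by exists ((dual X ◁ g) ∘ coev (dual X)); apply: left_dual_iso (dualP _) _ _ _ _.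
Qed.

Definition pcoev X : hom I (dual X ⊗ X) := sval (cid (pev_dual X)).

Lemma pdualP X : is_left_dual (pev X) (pcoev X).
Proof. exact: svalP (cid (pev_dual X)). Qed.

Lemma pev_dualm X Y (f : hom X Y) :
  pev Y ∘ (f ▷ dual Y) = pev X ∘ (X ◁ dualm f).
Proof.
rewrite /pev -!compA -tensml piv_nat tensml compA dualm_ev -!compA.
by rewrite tensm_swap.
Qed.

(** Partial trace: the strand X is closed on the right and P, Q stay free, so that traces can be
    nested. *)
Definition ptr X P Q (h : hom (P ⊗ X) (Q ⊗ X)) : hom P Q :=
  locked (evr (pev X) Q ∘ (h ▷ dual X) ∘ coevr (coev X) P).

Lemma ptrE X P Q (h : hom (P ⊗ X) (Q ⊗ X)) :
  ptr h = evr (pev X) Q ∘ (h ▷ dual X) ∘ coevr (coev X) P.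
Proof. by rewrite /ptr -lock. Qed.

Lemma ptr_compl X P Q Q' (g : hom Q Q') (h : hom (P ⊗ X) (Q ⊗ X)) :
  ptr ((g ▷ X) ∘ h) = g ∘ ptr h.
Proof. by rewrite !ptrE tensml !compA evr_nat. Qed.

Lemma ptr_compr X P P' Q (f : hom P' P) (h : hom (P ⊗ X) (Q ⊗ X)) :
  ptr (h ∘ (f ▷ X)) = ptr h ∘ f.
Proof. by rewrite !ptrE tensml -!compA coevr_nat. Qed.

Lemma ptr_tens X W P Q (h : hom (P ⊗ X) (Q ⊗ X)) :
  ptr (assocV W Q X ∘ (W ◁ h) ∘ assoc W P X) = W ◁ ptr h.
Proof.
rewrite !ptrE evr_tens coevr_tens !tensml !compA.
rewrite -(compA _ (assoc W Q X ▷ _)) -tensml assocVK tensm1 compm1.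
rewrite -(compA _ _ (assocV W P X ▷ _)) -tensml assocVK tensm1 compm1.
rewrite -(compA _ (assoc _ _ _)) assoc_natm compA -(compA _ _ (assocV _ _ _)).
by rewrite assocVK compm1 -!tensmr.
Qed.

(** The map f travels around the closed strand: across [pev] it becomes [dualm f], which slides past
    h and turns back into f at the coevaluation. *)
Lemma ptr_cyclic X Y P Q (f : hom X Y) (h : hom (P ⊗ Y) (Q ⊗ X)) :
  ptr ((Q ◁ f) ∘ h) = ptr (h ∘ (P ◁ f)).
Proof.
rewrite !ptrE !tensml !compA.
have -> : evr (pev Y) Q ∘ ((Q ◁ f) ▷ dual Y) = evr (pev X) Q ∘ ((Q ⊗ X) ◁ dualm f).
  rewrite !evrE -!compA assoc_natm assoc_natr !compA -!(compA (runit Q)).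
  by rewrite -!tensmr pev_dualm.
rewrite -(compA _ _ (h ▷ _)) -tensm_swap compA -!(compA (evr _ _ ∘ _)); congr (_ ∘ _).
rewrite !coevrE !compA -assocV_natr -assocV_natm -!(compA _ (P ◁ _) (P ◁ coev _)).
by rewrite -!tensmr dualm_coev.
Qed.

(** This is where monoidality of the pivotal structure enters the traces. *)
Lemma pev_tens X Y :
  pev (X ⊗ Y) ∘ ((X ⊗ Y) ◁ dual_tens X Y) = nested_ev (pev Y) (pev X).
Proof.
rewrite /pev -compA tensm_swap compA -dualm_ev -compA -tensml pivotal_tens tensml.
rewrite compA dual_tens_ev ev_tensE /nested_ev -compA assoc_nat compA -(compA (ev _)).
rewrite -tensmM comp1m.
have -> : evl (ev (dual Y)) (dual X) ∘ (piv j Y ▷ (dual Y ⊗ dual X)) =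
    evl (pev Y) (dual X).
  by rewrite !evlE -!compA assocV_natl /pev tensml !compA.
by rewrite /pev -!compA [(_ ▷ _) ∘ _]compA -tensmM comp1m compm1.
Qed.

Lemma coev_tens X Y :
  coev (X ⊗ Y) = ((X ⊗ Y) ◁ dual_tens X Y) ∘ nested_coev (coev X) (coev Y).
Proof.
rewrite /dual_tens (transpose_coev _ (dualP _)) ?tensm1 ?comp1m //.
by rewrite ev_tensE; apply: nested_snake; apply: dualP.
Qed.

Lemma ptr_tensor X Y P Q (h : hom (P ⊗ (X ⊗ Y)) (Q ⊗ (X ⊗ Y))) :
  ptr h = ptr (ptr (assocV Q X Y ∘ h ∘ assoc P X Y)).
Proof.
rewrite !ptrE !tensml !compA.
have -> : evr (pev X) Q ∘ (evr (pev Y) (Q ⊗ X) ▷ dual X) ∘ (assocV Q X Y ▷ dual Y ▷ dual X) =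
    evr (nested_ev (pev Y) (pev X)) Q ∘ assoc (Q ⊗ (X ⊗ Y)) (dual Y) (dual X).
  rewrite -nested_evr -!compA; congr (_ ∘ _).
  by rewrite assoc_natl compA -tensml assocVK tensm1 comp1m.
rewrite -(compA _ (assoc _ _ _)) assoc_natl -!compA.
have -> : assoc (P ⊗ (X ⊗ Y)) (dual Y) (dual X) ∘ ((assoc P X Y ▷ dual Y ▷ dual X) ∘
    ((coevr (coev Y) (P ⊗ X) ▷ dual X) ∘ coevr (coev X) P)) =
    coevr (nested_coev (coev X) (coev Y)) P by rewrite nested_coevr !compA.
(* [dual_tens] slides along the closed strand from the coevaluation, past h, to the pivotal
   evaluation. *)
rewrite -pev_tens coev_tens evr_compr coevr_compl !compA.
by rewrite -(compA _ _ (h ▷ _)) -tensm_swap !compA.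
Qed.

(* By naturality of the pivotal structure at [ev X], the evaluation of [X] is a
   nesting of pivotal evaluations; this identifies the left dimension of [X]
   with the (right) pivotal dimension of its dual. *)
Lemma pdim_dual X : ev X ∘ pcoev X = pev (dual X) ∘ coev (dual X).
Proof.
have du : ev I ∘ (dual_unit C ▷ I) = lunit I.
  by rewrite /dual_unit (transpose_ev _ _ (dualP _)) tensm1 compm1.
have pdu : pev I ∘ (I ◁ dual_unit C) = lunit I.
  rewrite /pev -compA tensm_swap compA -dualm_ev -compA -tensml pivotal_unit.
  exact: du.
(* Up to the canonical isomorphisms, the dual of [ev X] is the coevaluation of [dual X]; both sides
   are compared after evaluation. *)
have evX : dualm (ev X) ∘ dual_unit C = dual_tens (dual X) X ∘ coev (dual X).
  apply: (ev_inj (dualP _)); rewrite tensml [in RHS]tensml !compA dualm_ev dual_tens_ev.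
  rewrite -compA -tensm_swap compA du lunit_nat ev_tensE -!compA.
  congr (_ ∘ _); apply: (inverse_epi (conj (lunitVK _) (lunitK _))).
  by rewrite lunitVK -!compA (compA (assoc _ _ _)) -coevlE trianglel2 //; apply: dualP.
have nest : nested_ev (pev X) (pev (dual X)) ∘ ((dual X ⊗ X) ◁ coev (dual X)) =
    ev X ∘ runit (dual X ⊗ X).
  rewrite -pev_tens -compA -tensmr -evX tensmr compA -pev_dualm -compA tensm_swap compA.
  by rewrite pdu lunit_runit runit_nat.
apply: (inverse_epi (runitP I)).
rewrite -compA -runit_nat compA -nest -compA -tensm_swap compA -lunit_runit.
rewrite -(compA _ _ (lunit I)) -lunit_nat compA; congr (_ ∘ _).
rewrite /nested_ev -!(compA (pev (dual X))); congr (_ ∘ _).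
apply: (inverse_epi (conj (lunitVK _) (lunitK _))).
by rewrite lunitVK -!compA (compA (assoc _ _ _)) -coevlE trianglel2 //; apply: pdualP.
Qed.

End Pivotal.

(** * The canonical object of the center *)

Section FusionBasics.
Variables (k : closedFieldType) (C : fusionCat k).
Implicit Types P Q W X Y Z : C.

Lemma fusion_schur : schur C.
Proof. exact/kernels_schur/fin_kernels. Qed.

Lemma fusion_regular X Y (f : hom X Y) : regular f.
Proof. exact: (semisimple_regular fusion_schur) (fsemisimple _) (fsemisimple _). Qed.

Lemma fusion_split : idempotents_split C.
Proof. exact/kernels_split/fin_kernels. Qed.

Lemma simple_scalar X (f : hom X X) : simple X -> exists c, f = c *: idm X.
Proof. by apply: schur_scalar; [exact: fin_eigenvalues | exact: fusion_schur]. Qed.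

Variables (m : nat) (V : 'I_m.+1 -> C).
Hypothesis hV : simple_representatives V.

Lemma rep_simple i : simple (V i).
Proof. by case: hV. Qed.

Lemma rep_hom0 i l (f : hom (V i) (V l)) : i <> l -> f = 0.
Proof.
move=> il; apply: (schur_hom0 fusion_schur) (rep_simple i) (rep_simple l) _.
by case: hV => _ _ + _; apply.
Qed.

Lemma rep_scalar i (f : hom (V i) (V i)) : exists c, f = c *: idm (V i).
Proof. exact: simple_scalar (rep_simple i). Qed.

Lemma simple_decomposition X : exists n (s : 'I_n -> 'I_m.+1)
    (i : forall a, hom (V (s a)) X) (p : forall a, hom X (V (s a))),
  \sum_a (i a ∘ p a) = idm X.
Proof.
have [n [S [sS [i [p [_ _ ip]]]]]] := fsemisimple X.
have /choice [s sE] a : exists i, isomorphic (S a) (V i).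
  by case: hV => _ _ _; apply.
have g a : {g : hom (S a) (V (s a)) * hom (V (s a)) (S a) | inverse g.1 g.2}.
  by apply/cid; have [g [g' gg']] := sE a; exists (g, g').
exists n, s, (fun a => i a ∘ (sval (g a)).2), (fun a => (sval (g a)).1 ∘ p a).
rewrite -ip; apply: eq_bigr => a _; have [gg _] := svalP (g a).
by rewrite compA -(compA (i a)) gg compm1.
Qed.

Lemma joint_mono Q X (a b : hom Q X) :
  (forall l (g : hom X (V l)), g ∘ a = g ∘ b) -> a = b.
Proof.
move=> ab; have [n [s [i [p ip]]]] := simple_decomposition X.
rewrite -[a]comp1m -[b]comp1m -ip !comp_suml; apply: eq_bigr => c _.
by rewrite -!compA ab.
Qed.

Lemma tens_joint_epi P Q X (a b : hom (P ⊗ X) Q) :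
  (forall l (g : hom (V l) X), a ∘ (P ◁ g) = b ∘ (P ◁ g)) -> a = b.
Proof.
move=> ab; have [n [s [i [p ip]]]] := simple_decomposition X.
rewrite -[a]compm1 -[b]compm1 -tensm1 -ip tens_sumr !comp_sumr.
by apply: eq_bigr => c _; rewrite tensmr !compA ab.
Qed.

End FusionBasics.

(** [is_direct_sum] only asserts existence; as data, one J with fixed inclusions and projections is
    available to later definitions. *)
Record direct_sum_data (k : fieldType) (C : linCat k) n (S : 'I_n -> C) := DirectSumData {
  dsum : C;
  inj : forall l, hom (S l) dsum;
  proj : forall l, hom dsum (S l);
  projK : forall l, proj l ∘ inj l = idm _;
  proj0 : forall i l, i <> l -> proj l ∘ inj i = 0;
  injK : \sum_l (inj l ∘ proj l) = idm dsum
}.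

Section Canonical.
Variables (k : closedFieldType) (C : fusionCat k).
Variables (m : nat) (V : 'I_m.+1 -> C).
Hypothesis hV : simple_representatives V.
Variable D : direct_sum_data (fun l => V l ⊗ dual (V l)).
Local Notation J := (dsum D).
Local Notation inj := (inj D).
Local Notation proj := (proj D).
Local Notation I := (tunit C).
Implicit Types P Q W X Y Z : C.

Let h l : hom (J ⊗ V l) (V l) := locked (evr (ev (V l)) (V l) ∘ (proj l ▷ V l)).

(** Between simple representatives naturality is automatic: morphisms are zero or scalars. *)
Let h_nat i l (g : hom (V i) (V l)) : g ∘ h i = h l ∘ (J ◁ g).
Proof.
have [il|il] := pselect (i = l); last first.
  by rewrite (rep_hom0 hV g il) tens0r comp0l comp0r.
case: l / il g => g; have [c ->] := rep_scalar hV g.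
by rewrite compZl tensZr compZr tensm1 comp1m compm1.
Qed.

Let pi_ex X : exists t : hom (J ⊗ X) X,
  forall l (g : hom X (V l)), g ∘ t = h l ∘ (J ◁ g).
Proof.
have [n [s [i [p ip]]]] := simple_decomposition hV X.
exists (\sum_a (i a ∘ h (s a) ∘ (J ◁ p a))) => l g.
rewrite -[g in RHS]compm1 -ip !comp_sumr tens_sumr comp_sumr.
by apply: eq_bigr => a _; rewrite !compA h_nat -compA -tensmr.
Qed.

(** The universal family, exhibiting J as the end of X ⊗ X^*; it is fixed on the simple objects and
    extended by decomposing X. *)
Definition pi X : hom (J ⊗ X) X := sval (cid (pi_ex X)).

Lemma pi_test X l (g : hom X (V l)) :
  g ∘ pi X = evr (ev (V l)) (V l) ∘ (proj l ▷ V l) ∘ (J ◁ g).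
Proof. by have := svalP (cid (pi_ex X)) l g; rewrite /h -lock. Qed.

Lemma pi_rep l : pi (V l) = evr (ev (V l)) (V l) ∘ (proj l ▷ V l).
Proof. by rewrite -[LHS]comp1m pi_test tensm1 compm1. Qed.

Lemma pi_nat X Y (f : hom X Y) : f ∘ pi X = pi Y ∘ (J ◁ f).
Proof.
by apply: (joint_mono hV) => l g; rewrite !compA !pi_test -!compA -tensmr.
Qed.

(* [t |-> family t] is the bijection from Hom(Q, P ⊗ J) to the natural families
   Q ⊗ X -> P ⊗ X, by [family_inj] and [family_ex]. *)
Definition family P Q (t : hom Q (P ⊗ J)) X : hom (Q ⊗ X) (P ⊗ X) :=
  locked ((P ◁ pi X) ∘ assoc P J X ∘ (t ▷ X)).

Lemma familyE P Q (t : hom Q (P ⊗ J)) X :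
  family t X = (P ◁ pi X) ∘ assoc P J X ∘ (t ▷ X).
Proof. by rewrite /family -lock. Qed.

Lemma family_nat P Q (t : hom Q (P ⊗ J)) X Y (f : hom X Y) :
  (P ◁ f) ∘ family t X = family t Y ∘ (Q ◁ f).
Proof.
rewrite !familyE !compA -tensmr pi_nat tensmr -(compA _ (P ◁ _)) -assoc_natr.
by rewrite -!compA tensm_swap.
Qed.

Lemma family_rep P Q (t : hom Q (P ⊗ J)) l : family t (V l) =
  evr (ev (V l)) (P ⊗ V l) ∘
    ((assocV P (V l) (dual (V l)) ∘ (P ◁ proj l) ∘ t) ▷ V l).
Proof.
rewrite familyE pi_rep evr_tens tensmr -!compA tensml; congr (_ ∘ _).
rewrite !compA -(compA _ (assoc P _ _ ▷ _)) -tensml assocVK tensm1 compm1.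
by rewrite tensml !compA assoc_natm.
Qed.

Lemma family_inj_rep P Q (t t' : hom Q (P ⊗ J)) :
  (forall l, family t (V l) = family t' (V l)) -> t = t'.
Proof.
move=> tt; rewrite -[t]comp1m -[t']comp1m -tensm1 -injK tens_sumr !comp_suml.
apply: eq_bigr => l _; rewrite tensmr -!compA; congr (_ ∘ _).
have := tt l; rewrite !family_rep => /(mate_inj (dualP (V l))).
rewrite -!compA => /(congr1 (fun x => assoc _ _ _ ∘ x)).
by rewrite !compA assocVK comp1m.
Qed.

Lemma family_inj P Q (t t' : hom Q (P ⊗ J)) :
  (forall X, family t X = family t' X) -> t = t'.
Proof. by move=> tt; apply: family_inj_rep => l. Qed.

Lemma family_ex P Q (tau : forall X, hom (Q ⊗ X) (P ⊗ X)) :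
  (forall X Y (f : hom X Y), (P ◁ f) ∘ tau X = tau Y ∘ (Q ◁ f)) ->
  exists t, forall X, family t X = tau X.
Proof.
(* The component of t at l is the mate of [tau (V l)]. *)
move=> tau_nat; pose u l : hom Q (P ⊗ V l ⊗ dual (V l)) :=
  (tau (V l) ▷ dual (V l)) ∘ coevr (coev (V l)) Q.
exists (\sum_l ((P ◁ inj l) ∘ assoc _ _ _ ∘ u l)) => X.
set t := \sum_l _.
have ptu l : (P ◁ proj l) ∘ t = assoc _ _ _ ∘ u l.
  rewrite /t comp_sumr (bigD1 l) //= big1 ?addr0.
    by rewrite !compA -tensmr projK tensm1 comp1m.
  by move=> i /eqP il; rewrite !compA -tensmr proj0 // tens0r !comp0l.
have t_rep l : family t (V l) = tau (V l).
  rewrite family_rep -(compA (assocV _ _ _)) ptu compA assocK comp1m.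
  exact: (mateVK (dualP (V l))).
apply: (tens_joint_epi hV) => l g.
by rewrite -family_nat -tau_nat t_rep.
Qed.

Lemma family_unit Q (t : hom Q J) X :
  family (lunitV J ∘ t) X = lunitV X ∘ (pi X ∘ (t ▷ X)).
Proof.
rewrite familyE tensml !compA -(compA (I ◁ _)) -lunitV_tens -lunitV_nat.
by rewrite -compA.
Qed.

Lemma family0_inj Q (t t' : hom Q J) :
  (forall X, pi X ∘ (t ▷ X) = pi X ∘ (t' ▷ X)) -> t = t'.
Proof.
move=> tt; apply: (inverse_mono (conj (lunitVK J) (lunitK J))).
by apply: family_inj => X; rewrite !family_unit tt.
Qed.

Lemma family0_ex Q (tau : forall X, hom (Q ⊗ X) X) :
  (forall X Y (f : hom X Y), f ∘ tau X = tau Y ∘ (Q ◁ f)) ->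
  exists t, forall X, pi X ∘ (t ▷ X) = tau X.
Proof.
move=> tau_nat; have [|t tE] := @family_ex I Q (fun X => lunitV X ∘ tau X).
  by move=> X Y f; rewrite compA -lunitV_nat -!compA tau_nat.
exists (lunit J ∘ t) => X; apply: (inverse_mono (conj (lunitVK X) (lunitK X))).
by rewrite -family_unit compA lunitK comp1m tE.
Qed.

(** The half-braiding at Y is the morphism whose family in X is the universal family at Y ⊗ X. *)
Let sigma_ex Y : exists s : hom (J ⊗ Y) (Y ⊗ J),
  forall X, family s X = pi (Y ⊗ X) ∘ assoc J Y X.
Proof.
apply: family_ex => X Z f.
by rewrite compA pi_nat -!compA assoc_natr.
Qed.

Definition sigma Y : hom (J ⊗ Y) (Y ⊗ J) := sval (cid (sigma_ex Y)).

Lemma sigmaE Y X : (Y ◁ pi X) ∘ assoc Y J X ∘ (sigma Y ▷ X) = pi (Y ⊗ X) ∘ assoc J Y X.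
Proof. by rewrite -familyE; apply: (svalP (cid (sigma_ex Y))). Qed.

Lemma sigma_nat X Y (f : hom X Y) : sigma Y ∘ (J ◁ f) = (f ▷ J) ∘ sigma X.
Proof.
apply: family_inj => Z; rewrite !familyE !tensml !compA sigmaE -!compA.
rewrite assoc_natm !compA -pi_nat -compA -sigmaE !compA.
by rewrite tensm_swap -(compA _ (f ▷ _)) -assoc_natl !compA.
Qed.

(** Derived from the universal property: the general argument of [hbraid_unit] cancels a
    half-braiding, whereas invertibility of [sigma] rests on this lemma. *)
Lemma sigma_unit : sigma I ∘ runitV J = lunitV J.
Proof.
apply: family_inj => Z; rewrite !familyE tensml !compA sigmaE.
rewrite -(compA (I ◁ _)) -lunitV_tens -lunitV_nat pi_nat -compA; congr (_ ∘ _).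
have fl : inverse (J ◁ lunit Z) (J ◁ lunitV Z).
  by split; rewrite -tensmr ?lunitK ?lunitVK tensm1.
apply: (inverse_mono fl).
by rewrite !compA triangle -tensml runitVK -tensmr lunitVK !tensm1.
Qed.

Lemma sigma_tens X Y : sigma (X ⊗ Y) =
  assocV X Y J ∘ (X ◁ sigma Y) ∘ assoc X J Y ∘ (sigma X ▷ Y) ∘ assocV J X Y.
Proof.
apply: family_inj => Z; rewrite !familyE sigmaE.
apply: (inverse_epi (inverse_tensl Z (assocP J X Y))).
rewrite -!(compA _ (_ ▷ Z)) -tensml -(compA _ (assocV J X Y)) assocK compm1.
rewrite !tensml !compA.
apply: (inverse_mono (assocP X Y Z)); rewrite !compA pi_nat.
rewrite -!(compA (pi _)) -pentagon !compA assoc_natr.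
rewrite -(compA _ _ (assoc (X ⊗ Y) J Z)) pentagon !compA.
rewrite -(compA _ (assoc X Y J ▷ Z)) -tensml assocVK tensm1 compm1.
rewrite -(compA _ (assoc X (Y ⊗ J) Z)) assoc_natm !compA -!tensmr sigmaE.
rewrite tensmr -!(compA (X ◁ pi _)) -pentagon.
by rewrite -!compA assoc_natl !compA sigmaE.
Qed.

(** The inverse is [sigma Y'] rotated with a right dual Y' of Y. The hexagon together with
    naturality at c and at e ([E1], [E2]) reduces both composites to zigzags. *)
Lemma sigma_iso Y : is_iso (sigma Y).
Proof.
have [Y' [e [c d]]] := right_dual Y.
exists (evl e (J ⊗ Y) ∘ (Y ◁ (assoc _ _ _ ∘ (sigma Y' ▷ Y) ∘ coevr c J))).
have E1 : (Y' ◁ sigma Y) ∘ (assoc Y' J Y ∘ (sigma Y' ▷ Y) ∘ coevr c J) = coevl c J.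
  transitivity (assoc Y' Y J ∘ sigma (Y' ⊗ Y) ∘ (J ◁ c) ∘ runitV J).
    by rewrite sigma_tens coevrE !compA assocVK comp1m.
  by rewrite -(compA (assoc _ _ _)) sigma_nat compA -compA sigma_unit coevlE.
have E2 : evl e J ∘ ((Y ◁ sigma Y') ∘ assoc Y J Y' ∘ (sigma Y ▷ Y')) = evr e J.
  transitivity (lunit J ∘ (e ▷ J) ∘ sigma (Y ⊗ Y') ∘ assoc J Y Y').
    by rewrite sigma_tens evlE -!compA assocK compm1 !compA.
  rewrite -(compA (lunit J)) -sigma_nat compA evrE; congr (_ ∘ _ ∘ _).
  apply: (inverse_epi (conj (runitVK J) (runitK J))).
  by rewrite runitVK -compA sigma_unit lunitVK.
split; last first.
  by rewrite compA -evl_nat -compA -tensmr E1 trianglel1.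
rewrite evl_tens !tensmr !compA.
rewrite -(compA _ _ (Y ◁ assoc _ _ _)) -tensmr assocK tensm1 compm1.
have -> : Y ◁ coevr c J = assoc Y (J ⊗ Y') Y ∘ (assoc Y J Y' ▷ Y) ∘ coevr c (Y ⊗ J).
  rewrite coevr_tens !compA -(compA _ (assoc Y J Y' ▷ Y)) -tensml assocVK tensm1.
  by rewrite compm1 assocVK comp1m.
rewrite !compA -(compA _ _ (sigma Y)) coevr_nat !compA.
rewrite -(compA _ (assocV Y _ Y)) assocV_natm !compA.
rewrite -(compA _ (assocV _ _ _)) assocK compm1 -!tensml.
by rewrite -!(compA (evl e J)) E2 triangler2.
Qed.

Definition canonical : centerObj C :=
  CenterObj sigma_iso sigma_nat sigma_tens.

End Canonical.

(** * Morphisms to the canonical object *)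

(** The hexagon at two unit objects expresses s through two copies of s; invertibility cancels one
    of them. *)
Lemma hbraid_unit (k : fieldType) (C : monCat k) (Z : centerObj C) :
  hbraid Z (tunit C) = lunitV Z ∘ runit Z.
Proof.
set I := tunit C; set s := hbraid Z I.
have [s' ss'] := hbraid_iso Z I.
have E : s ∘ (Z ◁ lunit I) = s ∘ (((lunit Z ∘ s) ▷ I) ∘ assocV Z I I).
  rewrite hbraid_nat hbraid_tens !compA -lunit_tens lunit_nat.
  rewrite -!(compA s); congr (_ ∘ _); rewrite lunit_tens.
  by rewrite -(compA _ (assocV _ _ _)) assocK compm1 tensml.
have {}E : Z ◁ lunit I = ((lunit Z ∘ s) ▷ I) ∘ assocV Z I I := inverse_mono ss' E.
have {}E : runit Z ▷ I = (lunit Z ∘ s) ▷ I.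
  by rewrite -triangle -/I E -compA assocK compm1.
have {}E : runit Z = lunit Z ∘ s.
  by apply: (inverse_epi (runitP _)); rewrite -!runit_nat E.
by rewrite -/s E compA lunitK comp1m.
Qed.

Section CenterHoms.
Variables (k : closedFieldType) (C : fusionCat k).
Variables (m : nat) (V : 'I_m.+1 -> C).
Hypothesis hV : simple_representatives V.
Variable D : direct_sum_data (fun l => V l ⊗ dual (V l)).
Local Notation I := (tunit C).
Local Notation J := (dsum D).
Local Notation pi := (pi hV D).
Local Notation sigma := (sigma hV D).
Local Notation JZ := (canonical hV D).
Implicit Types P Q W X Y : C.
Implicit Types Z : centerObj C.

Definition counit : hom J I := locked (pi I ∘ runitV J).

(** The whole universal family is recovered from its value at the unit, so a center morphism into J
    is determined by its composite with [counit]. *)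
Lemma pi_counit X : runit X ∘ (X ◁ counit) ∘ sigma X = pi X.
Proof.
apply: (inverse_mono (conj (runitVK X) (runitK X))).
rewrite !compA runitK comp1m /counit -lock tensmr.
have -> : X ◁ runitV J = assoc X J I ∘ runitV (X ⊗ J).
  by rewrite runitV_tens compA assocVK comp1m.
rewrite -!compA runitV_nat !compA.
rewrite sigmaE -compA runitV_tens (compA (assoc _ _ _)) assocVK comp1m.
by rewrite -pi_nat.
Qed.

Lemma center_pi Z (t : hom Z J) : center_morphism (V := Z) (W := JZ) t ->
  forall X, pi X ∘ (t ▷ X) = runit X ∘ (X ◁ (counit ∘ t)) ∘ hbraid Z X.
Proof.
move=> ct X; rewrite -pi_counit -compA; have /= -> := ct X.
by rewrite tensmr !compA.
Qed.

Lemma center_ext Z (t t' : hom Z J) :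
  center_morphism (V := Z) (W := JZ) t -> center_morphism (V := Z) (W := JZ) t' ->
  counit ∘ t = counit ∘ t' -> t = t'.
Proof.
move=> ct ct' tt; apply: (family0_inj (hV := hV)) => X.
by rewrite (center_pi ct) (center_pi ct') tt.
Qed.

Let sharp_ex Z (phi : hom Z I) : exists t : hom Z J,
  forall X, pi X ∘ (t ▷ X) = runit X ∘ (X ◁ phi) ∘ hbraid Z X.
Proof.
apply: family0_ex => X Y f; rewrite !compA -runit_nat -(compA (runit Y)).
by rewrite tensm_swap !compA -!compA hbraid_nat.
Qed.

(** Inverse to composition with [counit]: the family of [sharp phi] passes Z across X and then
    applies phi. *)
Definition sharp Z (phi : hom Z I) : hom Z J := sval (cid (sharp_ex phi)).

Lemma sharpE Z (phi : hom Z I) X :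
  pi X ∘ (sharp phi ▷ X) = runit X ∘ (X ◁ phi) ∘ hbraid Z X.
Proof. exact: (svalP (cid (sharp_ex phi))). Qed.

Lemma sharp_center Z (phi : hom Z I) :
  center_morphism (V := Z) (W := JZ) (sharp phi).
Proof.
move=> Y /=; apply: (family_inj (hV := hV)) => X; rewrite !familyE !tensml !compA sigmaE.
rewrite -compA assoc_natl compA sharpE hbraid_tens !compA.
rewrite -(compA _ (assocV _ _ _)) assocK compm1.
rewrite -(compA _ (assoc Y J X)) assoc_natm !compA -tensmr sharpE !tensmr.
by rewrite runit_tens -(compA _ _ (assocV _ _ _)) -assocV_natr !compA -(compA _ (assoc Y X I)) assocVK compm1.
Qed.

Lemma counit_sharp Z (phi : hom Z I) : counit ∘ sharp phi = phi.
Proof.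
rewrite /counit -lock -compA runitV_nat compA sharpE hbraid_unit !compA.
rewrite -(compA _ (I ◁ phi)) -lunitV_nat -lunit_runit compA lunitVK comp1m.
by rewrite -compA runitVK compm1.
Qed.

End CenterHoms.

(** * The weighted functional on the canonical object *)

Section Average.
Variables (k : closedFieldType) (C : fusionCat k) (j : pivotal C).
Variables (m : nat) (V : 'I_m.+1 -> C).
Hypothesis hV : simple_representatives V.
Variable D : direct_sum_data (fun l => V l ⊗ dual (V l)).
Local Notation I := (tunit C).
Local Notation J := (dsum D).
Local Notation pi := (pi hV D).
Local Notation sigma := (sigma hV D).
Local Notation JZ := (canonical hV D).
Implicit Types P Q W X Y : C.
Implicit Types Z : centerObj C.

(* The left dimension; [weight_pdim] turns it into a pivotal dimension. *)
Definition weight X : k := scalar (ev X ∘ pcoev j X).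

Lemma weightE X : ev X ∘ pcoev j X = weight X *: idm I.
Proof. by rewrite /weight scalarK. Qed.

Lemma weight_pdim X : weight X = pdim j (dual X).
Proof. by rewrite /weight pdim_dual. Qed.

Lemma evr_scale A B (e : hom (B ⊗ A) I) c X : evr (c *: e) X = c *: evr e X.
Proof. by rewrite !evrE tensZr compZr compZl. Qed.

Lemma evl_mate A B (e : hom (B ⊗ A) I) c X (f : hom (B ⊗ X) I) : is_left_dual e c ->
  e ∘ (B ◁ (runit A ∘ (A ◁ f) ∘ coevl c X)) = f.
Proof.
by move=> d; rewrite !tensmr !compA -evl_unit evl_nat -compA trianglel1 // compm1.
Qed.

Lemma coevl_mate A B e (c : hom I (A ⊗ B)) X (h : hom I (A ⊗ X)) : is_left_dual e c ->
  (A ◁ (evl e X ∘ (B ◁ h) ∘ runitV B)) ∘ c = h.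
Proof.
move=> d; rewrite !tensmr -!compA -coevl_unit -coevl_nat.
by rewrite compA trianglel2 // comp1m.
Qed.

Lemma simple_evl A B (e f : hom (B ⊗ A) I) c : is_left_dual e c -> simple A ->
  exists a, f = a *: e.
Proof.
move=> d sA; rewrite -(evl_mate f d).
have [a ->] := simple_scalar (runit A ∘ (A ◁ f) ∘ coevl c A) sA.
by exists a; rewrite tensZr tensm1 compZr compm1.
Qed.

Lemma simple_evr A B (e f : hom (B ⊗ A) I) c : is_left_dual e c -> simple B ->
  exists a, f = a *: e.
Proof.
move=> d sB; rewrite -(ev_mate d f).
have [a ->] := simple_scalar (lunit B ∘ (f ▷ B) ∘ coevr c B) sB.
by exists a; rewrite tensZl tensm1 compZr compm1.
Qed.

Lemma simple_coev A B e (c h : hom I (A ⊗ B)) : is_left_dual e c -> simple B ->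
  exists a, h = a *: c.
Proof.
move=> d sB; rewrite -(coevl_mate h d).
have [a ->] := simple_scalar (evl e B ∘ (B ◁ h) ∘ runitV B) sB.
by exists a; rewrite tensZr tensm1 compZl comp1m.
Qed.

Lemma left_dual_ev0 A B (e : hom (B ⊗ A) I) c : is_left_dual e c -> simple A -> e <> 0.
Proof.
move=> d [A0 _] e0; apply: A0; rewrite /is_zero -(snaker d) evrE e0.
by rewrite tens0r comp0r !comp0l.
Qed.

(** Regularity gives h with ev h ev = ev, and h is a multiple of [pcoev j X]; a vanishing weight
    would make [ev X] zero. *)
Lemma weight_neq0 X : simple X -> weight X != 0.
Proof.
move=> sX; apply/eqP => w0; apply: (left_dual_ev0 (dualP X) sX).
have [h ehe] := fusion_regular (ev X); have [a ha] := simple_coev h (pdualP j X) sX.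
by rewrite -ehe ha compZr weightE w0 scale0r scaler0 comp0l.
Qed.

(** Decompose [dual W], dualize, and return to W by the pivotal isomorphism. *)
Lemma dual_decomposition W : exists n (s : 'I_n -> 'I_m.+1)
    (i : forall a, hom (dual (V (s a))) W) (p : forall a, hom W (dual (V (s a)))),
  \sum_a (i a ∘ p a) = idm W.
Proof.
have [n [s [i [p ip]]]] := simple_decomposition hV (dual W).
have [g [gj jg]] := piv_iso j W.
exists n, s, (fun a => g ∘ dualm (p a)), (fun a => dualm (i a) ∘ piv j W).
rewrite -gj -[g in RHS]compm1 -dualm1 -ip dualm_sum comp_sumr comp_suml.
by apply: eq_bigr => a _; rewrite dualmM !compA.
Qed.

(* As [beta] ranges over the maps from the duals of the simple objects, the
   [B ◁ beta] are jointly epic on [(B ⊗ dual B) ⊗ Y], so the half-braiding of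
   [J] is determined by the composites in [sigma_inj].  There [b] is the
   rotation of [beta], and the ratio of the weights arises from closing the
   same planar diagram ([ga] composed with [beta]) around [A] and around [B]. *)
Section KeyIdentity.
Variables (i q : 'I_m.+1) (Y : C) (beta : hom (dual (V i)) (dual (V q) ⊗ Y)).
Local Notation A := (V i).
Local Notation B := (V q).

Let g : hom (B ⊗ dual A) Y := locked (evl (pev j B) Y ∘ (B ◁ beta)).
Let b : hom B (Y ⊗ A) := locked ((g ▷ A) ∘ coevr (pcoev j A) B).

Let gE : g = evl (pev j B) Y ∘ (B ◁ beta).
Proof. by rewrite /g -lock. Qed.

Let bE : b = (g ▷ A) ∘ coevr (pcoev j A) B.
Proof. by rewrite /b -lock. Qed.

Let gb : evr (pev j A) Y ∘ (b ▷ dual A) = g.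
Proof. by rewrite bE (mateVK (pdualP j A)). Qed.

Let kap X (ga : hom (Y ⊗ X) B) : hom (dual A ⊗ X) I :=
  ev B ∘ ((dual B ◁ ga) ∘ assoc (dual B) Y X ∘ (beta ▷ X)).

Let b_beta : (dual B ◁ b) ∘ pcoev j B = assoc (dual B) Y A ∘ (beta ▷ A) ∘ pcoev j A.
Proof.
rewrite bE tensmr.
have -> : dual B ◁ coevr (pcoev j A) B = assoc (dual B) (B ⊗ dual A) A ∘
    (assoc (dual B) B (dual A) ▷ A) ∘ coevr (pcoev j A) (dual B ⊗ B).
  rewrite coevr_tens !compA -(compA _ (assoc (dual B) B _ ▷ A)) -tensml assocVK tensm1.
  by rewrite compm1 assocVK comp1m.
rewrite -!compA coevr_nat coevr_unit.
rewrite !compA -assoc_natm -!compA; congr (_ ∘ _).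
rewrite !compA -!tensml; congr (_ ∘ _); congr (_ ▷ _).
rewrite gE tensmr -!compA (compA (assoc _ _ _)) -coevlE -coevl_nat compA.
by rewrite trianglel2 ?comp1m //; apply: pdualP.
Qed.

Let kap_weight (ga : hom (Y ⊗ A) B) c x :
  kap ga = c *: ev A -> ga ∘ b = x *: idm B -> c * weight A = weight B * x.
Proof.
move=> kc gx; have : kap ga ∘ pcoev j A = ev B ∘ (dual B ◁ (ga ∘ b)) ∘ pcoev j B.
  rewrite /kap tensmr -!compA; congr (_ ∘ _).
  by rewrite b_beta !compA.
rewrite kc gx compZl weightE tensZr tensm1 compZr compm1 compZl weightE !scalerA.
move=> /(congr1 scalar). rewrite !Defs.scalarZ => ->.
by rewrite mulrC.
Qed.

Lemma sigma_inj : weight A *: (sigma Y ∘ (inj D q ▷ Y) ∘ assocV B (dual B) Y ∘ (B ◁ beta)) =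
  weight B *: ((Y ◁ inj D i) ∘ assoc Y A (dual A) ∘ (b ▷ dual A)).
Proof.
have famZ P Q a (t : hom Q (P ⊗ J)) X : family hV (a *: t) X = a *: family hV t X.
  by rewrite !familyE tensZl compZr.
apply: (family_inj_rep (hV := hV)) => l; rewrite !famZ.
apply: (joint_mono hV) => p ga; rewrite !compZr.
have -> : ga ∘ family hV (sigma Y ∘ (inj D q ▷ Y) ∘ assocV B (dual B) Y ∘ (B ◁ beta)) (V l) =
    evr (ev (V p)) (V p) ∘ ((proj D p ∘ inj D q) ▷ V p) ∘ ((B ⊗ dual B) ◁ ga) ∘
    assoc (B ⊗ dual B) Y (V l) ∘ ((assocV B (dual B) Y ∘ (B ◁ beta)) ▷ V l).
  rewrite familyE !tensml !compA -!(compA ga) sigmaE !compA pi_test.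
  rewrite -(compA _ (assoc J _ _)) assoc_natl !compA.
  by rewrite -(compA _ (J ◁ ga)) -tensm_swap !compA.
have -> : ga ∘ family hV ((Y ◁ inj D i) ∘ assoc Y A (dual A) ∘ (b ▷ dual A)) (V l) =
    ga ∘ (Y ◁ (evr (ev (V l)) (V l) ∘ ((proj D l ∘ inj D i) ▷ V l))) ∘
    assoc Y (A ⊗ dual A) (V l) ∘ (assoc Y A (dual A) ▷ V l) ∘ (b ▷ dual A ▷ V l).
  rewrite familyE pi_rep !tensml !tensmr -!compA; congr (_ ∘ (_ ∘ _)).
  by rewrite !compA -(compA _ (assoc Y J _)) assoc_natm !compA.
have rhs (ga' : hom (Y ⊗ A) (V p)) :
    ga' ∘ (Y ◁ (evr (ev A) A ∘ ((proj D i ∘ inj D i) ▷ A))) ∘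
    assoc Y (A ⊗ dual A) A ∘ (assoc Y A (dual A) ▷ A) ∘ (b ▷ dual A ▷ A) =
    ga' ∘ b ∘ evr (ev A) B.
  by rewrite projK tensm1 compm1 -!(compA ga') -evr_tens evr_nat.
(* Unless p = q and l = i both sides vanish, by orthogonality of the summands or by Schur's lemma.
   In the remaining case both are multiples of [evr (ev A) B], compared by [kap_weight]. *)
have [pq|pq] := pselect (q = p); last first.
  rewrite proj0 // tens0l comp0r !comp0l scaler0.
  have [il|il] := pselect (i = l); last first.
    by rewrite proj0 // tens0l comp0r tens0r comp0r !comp0l scaler0.
  by case: l / il ga => ga; rewrite rhs (rep_hom0 hV (ga ∘ b) pq) comp0l scaler0.
case: p / pq ga rhs => ga rhs.
have -> : evr (ev B) B ∘ ((proj D q ∘ inj D q) ▷ B) ∘ ((B ⊗ dual B) ◁ ga) ∘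
    assoc (B ⊗ dual B) Y (V l) ∘ ((assocV B (dual B) Y ∘ (B ◁ beta)) ▷ V l) =
    evr (kap ga) B.
  rewrite projK tensm1 compm1 !evrE /kap !tensmr tensml -!compA; congr (_ ∘ (_ ∘ _)).
  rewrite !compA assoc_natr -!compA; congr (_ ∘ _).
  rewrite -assoc_natm !compA pentagon -!compA.
  by rewrite [(assoc _ _ _ ▷ _) ∘ _]compA -tensml assocVK tensm1 comp1m.
have [il|il] := pselect (i = l); last first.
  rewrite [X in _ = _ *: X](_ : _ = 0) ?scaler0; last first.
    by rewrite proj0 // tens0l comp0r tens0r comp0r !comp0l.
  rewrite -(evl_mate (kap ga) (dualP A)) (rep_hom0 hV (runit A ∘ _ ∘ _)) => [|e]; last by apply: il.
  by rewrite tens0r comp0r evrE tens0r comp0r comp0l scaler0.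
case: l / il ga => ga; rewrite rhs.
have [c kc] := simple_evl (kap ga) (dualP A) (rep_simple hV i).
have [x gx] := rep_scalar hV (ga ∘ b).
rewrite kc gx evr_scale compZl comp1m !scalerA mulrC.
by rewrite (kap_weight kc gx).
Qed.

Lemma key_identity (lam : hom J I) :
  (forall l, lam ∘ inj D l = weight (V l) *: pev j (V l)) ->
  runit Y ∘ (Y ◁ lam) ∘ sigma Y ∘ (inj D q ▷ Y) ∘ assocV B (dual B) Y ∘ (B ◁ beta) =
  lunit Y ∘ (lam ▷ Y) ∘ (inj D q ▷ Y) ∘ assocV B (dual B) Y ∘ (B ◁ beta).
Proof.
move=> lamE; have wA := weight_neq0 (rep_simple hV i).
(* After multiplication by [weight A] both sides equal [weight A] times [weight B] times g, the left
   one through [sigma_inj]. *)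
apply: (can_inj (scalerK wA)).
have /= := congr1 (fun t => runit Y ∘ (Y ◁ lam) ∘ t) sigma_inj.
rewrite !compZr !compA => ->.
rewrite -(compA (runit Y)) -tensmr lamE tensZr compZr !compZl -evrE gb gE.
rewrite -(compA (lunit Y)) -tensml lamE tensZl compZr !compZl evlE.
by rewrite !scalerA mulrC -!compA.
Qed.

End KeyIdentity.

Variable lam : hom J I.
Hypothesis lamE : forall l, lam ∘ inj D l = weight (V l) *: pev j (V l).

Lemma lam_central Y : runit Y ∘ (Y ◁ lam) ∘ sigma Y = lunit Y ∘ (lam ▷ Y).
Proof.
rewrite -[LHS]compm1 -[RHS]compm1 -tensm1 -(injK D) tens_suml !comp_sumr.
apply: eq_bigr => q _; rewrite tensml !compA; congr (_ ∘ _).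
apply: (inverse_epi (conj (assocVK _ _ _) (assocK _ _ _))).
have [n [s [i [p ip]]]] := dual_decomposition (dual (V q) ⊗ Y).
rewrite -[LHS]compm1 -[RHS]compm1 -tensm1 -ip tens_sumr !comp_sumr.
apply: eq_bigr => a _; rewrite tensmr !compA; congr (_ ∘ _).
exact: key_identity.
Qed.

End Average.

(** * Averaging over the simple objects *)

Section InverseBraiding.
Variables (k : fieldType) (C : monCat k) (Z : centerObj C).
Implicit Types X Y : C.

Definition hbraidV X : hom (X ⊗ Z) (Z ⊗ X) := sval (cid (hbraid_iso Z X)).

Lemma hbraidP X : inverse (hbraid Z X) (hbraidV X).
Proof. exact: (svalP (cid (hbraid_iso Z X))). Qed.

Lemma hbraidK X : hbraidV X ∘ hbraid Z X = idm _.
Proof. by case: (hbraidP X). Qed.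
Lemma hbraidVK X : hbraid Z X ∘ hbraidV X = idm _.
Proof. by case: (hbraidP X). Qed.

Lemma hbraidV_nat X Y (f : hom X Y) :
  hbraidV Y ∘ (f ▷ Z) = (Z ◁ f) ∘ hbraidV X.
Proof.
apply: (inverse_epi (hbraidP X)).
by rewrite -!compA hbraidK compm1 -hbraid_nat compA hbraidK comp1m.
Qed.

Lemma hbraidV_tens X Y :
  (hbraid Z X ▷ Y) ∘ assocV Z X Y ∘ hbraidV (X ⊗ Y) ∘ assocV X Y Z =
  assocV X Z Y ∘ (X ◁ hbraidV Y).
Proof.
apply: (inverse_mono (assocP _ _ _)); apply: (inverse_mono (inverse_tensr X (hbraidP Y))).
apply: (inverse_mono (conj (assocVK _ _ _) (assocK _ _ _))).
rewrite !compA -hbraid_tens hbraidVK comp1m -(compA _ (assoc _ _ _)) assocVK compm1.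
by rewrite -(compA _ (X ◁ _)) -tensmr hbraidVK tensm1 compm1.
Qed.

End InverseBraiding.

Lemma center_morphismV (k : fieldType) (C : monCat k) (Z1 Z2 : centerObj C)
    (g : hom Z1 Z2) (X : C) : center_morphism g ->
  hbraidV Z2 X ∘ (X ◁ g) = (g ▷ X) ∘ hbraidV Z1 X.
Proof.
move=> cg; apply: (inverse_epi (hbraidP Z1 X)); apply: (inverse_mono (hbraidP Z2 X)).
rewrite !compA hbraidVK comp1m -(compA _ (hbraidV _ _)) hbraidK compm1.
exact: (esym (cg X)).
Qed.

Section Averaging.
Variables (k : closedFieldType) (C : fusionCat k) (j : pivotal C).
Variables (m : nat) (V : 'I_m.+1 -> C).
Hypothesis hV : simple_representatives V.
Variable D : direct_sum_data (fun l => V l ⊗ dual (V l)).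
Local Notation I := (tunit C).
Local Notation J := (dsum D).
Local Notation pi := (pi hV D).
Local Notation sigma := (sigma hV D).
Local Notation JZ := (canonical hV D).
Implicit Types P Q W X Y : C.
Implicit Types Z : centerObj C.

Lemma family_assocV P W Q (t : hom Q (P ⊗ (W ⊗ J))) X :
  family hV (assocV P W J ∘ t) X =
  assocV P W X ∘ (P ◁ ((W ◁ pi X) ∘ assoc W J X)) ∘ assoc P (W ⊗ J) X ∘ (t ▷ X).
Proof.
rewrite familyE tensml !compA; congr (_ ∘ _).
apply: (inverse_mono (assocP P W X)).
rewrite !compA assocVK comp1m assoc_natr tensmr -!compA; congr (_ ∘ _).
by rewrite compA pentagon -!compA -tensml assocVK tensm1 compm1.
Qed.

Let spread_ex Z1 Z2 (f : hom Z1 Z2) : exists t : hom Z1 (Z2 ⊗ J),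
  forall X, family hV t X = hbraidV Z2 X ∘ (X ◁ f) ∘ hbraid Z1 X.
Proof.
apply: family_ex => X Y g; rewrite !compA -hbraidV_nat -!compA hbraid_nat.
by rewrite !compA -!(compA (hbraidV _ _)) tensm_swap.
Qed.

(** All conjugates of f by the half-braidings at X, gathered into one morphism; [average] contracts
    them with [lam], as one sums conjugates over a finite group. *)
Definition spread Z1 Z2 (f : hom Z1 Z2) : hom Z1 (Z2 ⊗ J) := sval (cid (spread_ex f)).

Lemma spreadE Z1 Z2 (f : hom Z1 Z2) X :
  family hV (spread f) X = hbraidV Z2 X ∘ (X ◁ f) ∘ hbraid Z1 X.
Proof. exact: (svalP (cid (spread_ex f))). Qed.

Lemma spread_central Z1 Z2 (f : hom Z1 Z2) Y :
  (Y ◁ spread f) ∘ hbraid Z1 Y =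
  assoc Y Z2 J ∘ (hbraid Z2 Y ▷ J) ∘ assocV Z2 Y J ∘ (Z2 ◁ sigma Y) ∘
    assoc Z2 J Y ∘ (spread f ▷ Y).
Proof.
apply: (inverse_mono (conj (assocVK Y Z2 J) (assocK Y Z2 J))).
apply: (family_inj (hV := hV)) => X.
rewrite [LHS]family_assocV tensml !compA.
rewrite -(compA _ (assoc Y (Z2 ⊗ J) X)) assoc_natm !compA -(compA (assocV _ _ _)) -tensmr.
rewrite -familyE spreadE !tensmr assocK comp1m !compA -hbraidV_tens.
rewrite familyE !tensml !compA.
rewrite -(compA ((Y ⊗ Z2) ◁ _)) assoc_natl !compA -tensm_swap.
(* [sigmaE] merges [sigma Y] with the family at X into the family at Y ⊗ X, where [spreadE] and the
   hexagons apply. *)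
have E : ((Z2 ⊗ Y) ◁ pi X) ∘ assoc (Z2 ⊗ Y) J X ∘ (assocV Z2 Y J ▷ X) ∘
    ((Z2 ◁ sigma Y) ▷ X) ∘ (assoc Z2 J Y ▷ X) =
    assocV Z2 Y X ∘ (Z2 ◁ pi (Y ⊗ X)) ∘ assoc Z2 J (Y ⊗ X) ∘ assoc (Z2 ⊗ J) Y X.
  have := family_assocV ((Z2 ◁ sigma Y) ∘ assoc Z2 J Y) X.
  rewrite familyE !tensml !compA => ->.
  rewrite -(compA _ (assoc Z2 (Y ⊗ J) X)) assoc_natm !compA.
  rewrite -(compA (assocV _ _ _)) -tensmr sigmaE tensmr.
  by rewrite -!(compA (assocV _ _ _)) -!(compA (Z2 ◁ pi _)) pentagon !compA.
rewrite -!(compA (hbraid Z2 Y ▷ X)) E -!(compA (assocV Z2 Y X)).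
rewrite -(compA (_ ∘ assoc Z2 J (Y ⊗ X))) assoc_natl (compA (_ ∘ assoc Z2 J (Y ⊗ X))).
have -> : (Z2 ◁ pi (Y ⊗ X)) ∘ assoc Z2 J (Y ⊗ X) ∘ (spread f ▷ (Y ⊗ X)) =
  hbraidV Z2 (Y ⊗ X) ∘ ((Y ⊗ X) ◁ f) ∘ hbraid Z1 (Y ⊗ X) by rewrite -familyE spreadE.
rewrite hbraid_tens !compA -(compA _ (assocV Z1 Y X)) assocK compm1.
by rewrite -(compA _ ((Y ⊗ X) ◁ f)) -assocV_natr !compA.
Qed.

Variable lam : hom J I.
Hypothesis lam_central : forall Y, runit Y ∘ (Y ◁ lam) ∘ sigma Y = lunit Y ∘ (lam ▷ Y).

Definition average Z1 Z2 (f : hom Z1 Z2) : hom Z1 Z2 :=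
  locked (runit Z2 ∘ (Z2 ◁ lam) ∘ spread f).

Lemma averageE Z1 Z2 (f : hom Z1 Z2) :
  average f = runit Z2 ∘ (Z2 ◁ lam) ∘ spread f.
Proof. by rewrite /average -lock. Qed.

(* [spread f] is a morphism of the center from [Z1] to [Z2 ⊗ J], and so is
   [lam] from [J] to the unit. *)
Lemma average_center Z1 Z2 (f : hom Z1 Z2) : center_morphism (average f).
Proof.
move=> Y; rewrite averageE !tensmr -!compA spread_central !compA.
rewrite -(compA _ (Y ◁ (Z2 ◁ lam))) -assoc_natr !compA -runit_tens.
rewrite -(compA (runit (Y ⊗ Z2))) -tensm_swap !compA runit_nat.
rewrite -(compA _ ((Z2 ⊗ Y) ◁ lam)) -assocV_natr !compA runit_tens !compA.
rewrite -(compA _ (assoc Z2 Y I)) assocVK compm1.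
rewrite -(compA (hbraid Z2 Y)) -tensmr -(compA (hbraid Z2 Y)) -tensmr lam_central tensmr !compA.
rewrite -(compA _ (Z2 ◁ (lam ▷ Y))) -assoc_natm !compA.
by rewrite -(compA _ (Z2 ◁ lunit Y)) triangle !tensml !compA.
Qed.

Lemma spread_compl Z1 Z2 Z3 (g : hom Z2 Z3) (f : hom Z1 Z2) : center_morphism g ->
  spread (g ∘ f) = (g ▷ J) ∘ spread f.
Proof.
move=> cg; apply: (family_inj (hV := hV)) => X.
rewrite spreadE familyE tensml !compA -(compA (Z3 ◁ _)) assoc_natl !compA -tensm_swap.
rewrite -!(compA (g ▷ X)) -familyE spreadE tensmr !compA.
by rewrite center_morphismV.
Qed.

Lemma spread_compr Z1 Z2 Z3 (g : hom Z2 Z3) (f : hom Z1 Z2) : center_morphism f ->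
  spread (g ∘ f) = spread g ∘ f.
Proof.
move=> cf; apply: (family_inj (hV := hV)) => X.
rewrite spreadE familyE tensml !compA -familyE spreadE tensmr.
by rewrite -!compA cf.
Qed.

Lemma average_compl Z1 Z2 Z3 (g : hom Z2 Z3) (f : hom Z1 Z2) : center_morphism g ->
  average (g ∘ f) = g ∘ average f.
Proof.
move=> cg; rewrite !averageE spread_compl // !compA; congr (_ ∘ _).
by rewrite -!compA -tensm_swap !compA runit_nat.
Qed.

Lemma average_compr Z1 Z2 Z3 (g : hom Z2 Z3) (f : hom Z1 Z2) : center_morphism f ->
  average (g ∘ f) = average g ∘ f.
Proof. by move=> cf; rewrite !averageE spread_compr // !compA. Qed.

(** All conjugates of an identity are identities, so [spread] inserts only the unit u and averaging
    multiplies by [lam ∘ u]. *)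
Lemma average_id (u : hom I J) Z : (forall X, pi X ∘ (u ▷ X) = lunit X) ->
  average (idm Z) = scalar (lam ∘ u) *: idm Z.
Proof.
move=> uE; have -> : average (idm Z) = runit Z ∘ (Z ◁ (lam ∘ u)) ∘ runitV Z.
  rewrite averageE tensmr -!compA; congr (_ ∘ (_ ∘ _)).
  apply: (family_inj (hV := hV)) => X; rewrite spreadE tensm1 compm1 hbraidK.
  rewrite familyE tensml !compA -(compA (Z ◁ _)) assoc_natm !compA -tensmr uE.
  by rewrite triangle -tensml runitVK tensm1.
by rewrite -{1}[lam ∘ u]scalarK tensZr tensm1 compZr compm1 compZl runitVK.
Qed.

End Averaging.

(** * Splitting in the center *)

Section CenterSplitting.
Variables (k : fieldType) (C : monCat k) (Z : centerObj C) (Y : C).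
Variables (i : hom Y Z) (p : hom Z Y).
Hypotheses (pi1 : p ∘ i = idm Y) (cip : center_morphism (V := Z) (W := Z) (i ∘ p)).

(** The half-braiding of Z compressed to the image Y; it commutes with i and p because [i ∘ p] is a
    morphism of the center. *)
Let hb X : hom (Y ⊗ X) (X ⊗ Y) := locked ((X ◁ p) ∘ hbraid Z X ∘ (i ▷ X)).

Let hbE X : hb X = (X ◁ p) ∘ hbraid Z X ∘ (i ▷ X).
Proof. by rewrite /hb -lock. Qed.

Let hb_i X : (X ◁ i) ∘ hb X = hbraid Z X ∘ (i ▷ X).
Proof.
by rewrite hbE !compA -tensmr -cip -compA -tensml -(compA i) pi1 compm1.
Qed.

Let hb_p X : hb X ∘ (p ▷ X) = (X ◁ p) ∘ hbraid Z X.
Proof.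
by rewrite hbE -!compA -tensml cip !compA -tensmr compA pi1 comp1m.
Qed.

Let hb_iso X : is_iso (hb X).
Proof.
exists ((p ▷ X) ∘ hbraidV Z X ∘ (X ◁ i)); split.
  rewrite -!compA hb_i (compA (hbraidV _ _)) hbraidK comp1m -tensml pi1.
  exact: tensm1.
by rewrite !compA hb_p -(compA (X ◁ p)) hbraidVK compm1 -tensmr pi1 tensm1.
Qed.

Let hb_nat X X' (f : hom X X') : hb X' ∘ (Y ◁ f) = (f ▷ Y) ∘ hb X.
Proof.
rewrite !hbE -compA tensm_swap !compA -(compA _ (hbraid _ _)) hbraid_nat.
by rewrite !compA -tensm_swap.
Qed.

Let hb_tens X X' : hb (X ⊗ X') =
  assocV X X' Y ∘ (X ◁ hb X') ∘ assoc X Y X' ∘ (hb X ▷ X') ∘ assocV Y X X'.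
Proof.
rewrite hbE hbraid_tens !compA -(compA _ (assocV Z X X')) assocV_natl !compA.
rewrite -(compA _ (hbraid Z X ▷ X')) -tensml -hb_i tensml !compA.
rewrite -(compA _ (assoc X Z X')) assoc_natm !compA -(compA _ (X ◁ hbraid Z X')) -tensmr.
rewrite -hb_i tensmr -assocV_natr !compA; congr (_ ∘ _ ∘ _ ∘ _).
by rewrite -(compA _ (X ◁ (X' ◁ p))) -!tensmr pi1 !tensm1 compm1.
Qed.

Definition split_center : centerObj C := CenterObj hb_iso hb_nat hb_tens.

Lemma split_center_i : center_morphism (V := split_center) (W := Z) i.
Proof. by move=> X /=; rewrite hb_i. Qed.

Lemma split_center_p : center_morphism (V := Z) (W := split_center) p.
Proof. by move=> X /=; rewrite hb_p. Qed.

End CenterSplitting.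

Section CenterCategory.
Variables (k : closedFieldType) (C : fusionCat k).
Local Notation ZC := (drinfeldCenter C).

Lemma center_mk (Z1 Z2 : ZC) (f : hom (cobj Z1) (cobj Z2)) : center_morphism f ->
  {g : hom Z1 Z2 | sublmod_val g = f}.
Proof. by move=> cf; exists (mk_sublmod (center_morphism_submod Z1 Z2) cf). Qed.

Lemma center_val_inj (Z1 Z2 : ZC) (f g : hom Z1 Z2) :
  sublmod_val f = sublmod_val g -> f = g.
Proof. exact: val_inj. Qed.

Lemma center_split : idempotents_split ZC.
Proof.
move=> Z e ee; have := congr1 (@sublmod_val _ _ _ _) ee => /= {}ee.
have [Y [i [p [pi ip]]]] := fusion_split ee.
have cip : center_morphism (V := Z) (W := Z) (i ∘ p).
  by rewrite ip; apply: (sublmodP e).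
have [i' i'E] := center_mk (Z1 := split_center pi cip : ZC) (split_center_i pi cip).
have [p' p'E] := center_mk (Z2 := split_center pi cip : ZC) (split_center_p pi cip).
exists (split_center pi cip : ZC), i', p'; split; apply: center_val_inj => /=.
  by rewrite i'E p'E.
by rewrite i'E p'E.
Qed.

Lemma forget_linear : linear_functor (forget C).
Proof. by move=> X Y a u v. Qed.

Lemma forget_faithful (X Y : ZC) (f g : hom X Y) :
  fmap (forget C) f = fmap (forget C) g -> f = g.
Proof. exact: center_val_inj. Qed.

Lemma center_eigenvalues : has_eigenvalues ZC.
Proof. exact: (faithful_eigenvalues forget_linear forget_faithful (@fin_eigenvalues _ C)). Qed.

Lemma center_rank : exists mu, @has_rank k ZC mu.
Proof.
have [mu rk] := fin_rank C; exists (mu \o forget C).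
exact: (faithful_rank forget_faithful rk).
Qed.

End CenterCategory.

(** * Regularity of the center *)

Section CenterRegular.
Variables (k : closedFieldType) (C : fusionCat k) (j : pivotal C).
Variables (m : nat) (V : 'I_m.+1 -> C).
Hypothesis hV : simple_representatives V.
Hypothesis dimC : \sum_i pdim j (dual (V i)) * pdim j (V i) <> 0.
Variable D : direct_sum_data (fun l => V l ⊗ dual (V l)).
Local Notation I := (tunit C).
Local Notation J := (dsum D).
Local Notation pi := (pi hV D).
Local Notation ZC := (drinfeldCenter C).

Let lam : hom J I := locked (\sum_l weight j (V l) *: (pev j (V l) ∘ proj D l)).

Let lamE l : lam ∘ inj D l = weight j (V l) *: pev j (V l).
Proof.
rewrite /lam -lock comp_suml (bigD1 l) //= big1 ?addr0.
  by rewrite compZl -compA projK compm1.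
by move=> i /eqP il; rewrite compZl -compA proj0 ?comp0r ?scaler0 // => /esym.
Qed.

Let unit_ex : exists u : hom I J, forall X, pi X ∘ (u ▷ X) = lunit X.
Proof. by apply: family0_ex => X Y f; rewrite lunit_nat. Qed.

(** The components of the unit are the coevaluations, so the term at l is the left times the right
    dimension of V_l, and the sum is dim(C). *)
Let lam_unit (u : hom I J) : (forall X, pi X ∘ (u ▷ X) = lunit X) -> scalar (lam ∘ u) <> 0.
Proof.
move=> uE; have proj_u l : proj D l ∘ u = coev (V l).
  apply: (mate_inj (dualP (V l))); rewrite tensml compA -pi_rep uE.
  apply: (inverse_epi (conj (lunitVK _) (lunitK _))).
  by rewrite lunitVK (snaker (dualP (V l))).
have -> : lam ∘ u = (\sum_l pdim j (dual (V l)) * pdim j (V l)) *: idm I.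
  rewrite /lam -lock comp_suml scaler_suml; apply: eq_bigr => l _.
  rewrite compZl -compA proj_u weight_pdim -scalerA; congr (_ *: _).
  by rewrite /pdim scalarK.
by rewrite Defs.scalarZ.
Qed.

Lemma center_regular (Z1 Z2 : ZC) (f : hom Z1 Z2) : regular f.
Proof.
have [u uE] := unit_ex; have := lam_unit uE; set c := scalar _ => /eqP c0.
have lamC := lam_central hV lamE.
have [h fhf] := fusion_regular (sublmod_val f).
have [g gE] := center_mk (average_center lamC h : center_morphism (V := Z2) (W := Z1) _).
have cf := sublmodP f.
exists (c^-1 *: g); apply: center_val_inj.
transitivity (sublmod_val f ∘ (c^-1 *: sublmod_val g) ∘ sublmod_val f); first by [].
(* f average(h) f = average(f h f) = average(f) = f average(1) = c f, because averaging is linear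
   over center morphisms on both sides. *)
rewrite gE compZr compZl -(average_compl hV lam h cf) -(average_compr hV lam _ cf) fhf.
rewrite -[X in average _ _ X]compm1 average_compl // (average_id lam _ uE) -/c.
by rewrite compZr scalerA mulVf // scale1r compm1.
Qed.

End CenterRegular.

(** * Identification of R(1) *)

Section Representing.
Variables (k : closedFieldType) (C : fusionCat k).
Variables (m : nat) (V : 'I_m.+1 -> C).
Hypothesis hV : simple_representatives V.
Variable D : direct_sum_data (fun l => V l ⊗ dual (V l)).
Local Notation I := (tunit C).
Local Notation ZC := (drinfeldCenter C).
Local Notation JZ := (canonical hV D : ZC).

(** Both objects represent the maps to the unit of C: a and b intertwine the two counits, and a
    counit determines each endomorphism. *)
Lemma adjoint_canonical (R : functor C ZC) :
  right_adjoint (forget C) R -> isomorphic (R I) JZ.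
Proof.
move=> [eta [eps [eta_nat eps_nat t1 t2]]].
have [a aE] := center_mk (sharp_center hV D (eps I)).
pose b : hom JZ (R I) := fmap R (counit hV D) ∘ eta JZ.
have eb : eps I ∘ sublmod_val b = counit hV D.
  have := eps_nat _ _ (counit hV D : hom (forget C JZ) I).
  move=> /(congr1 (fun x => x ∘ fmap (forget C) (eta JZ))); rewrite -!compA t1 compm1.
  by move=> ->.
have ea : counit hV D ∘ sublmod_val a = eps I by rewrite aE counit_sharp.
exists a, b; split.
  have fix_eq (f : hom (R I) (R I)) : f = fmap R (eps I ∘ sublmod_val f) ∘ eta (R I).
    by rewrite fmapM -compA -(eta_nat _ _ f) compA t2 comp1m.
  rewrite [LHS]fix_eq [RHS]fix_eq; congr (fmap R _ ∘ _) => /=.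
  by rewrite compA eb ea compm1.
apply: center_val_inj; apply: (center_ext (hV := hV)).
- exact: (sublmodP (a ∘ b)).
- exact: (sublmodP (idm JZ)).
by rewrite /= compA ea eb compm1.
Qed.

End Representing.

(** * Characters *)

Section PresentedInduction.
Variables (S : Type) (T : forall M : zmodType, (S -> M) -> Prop).
Variable P : presented T -> Prop.
Hypotheses (P0 : P 0) (Pgen : forall x, P (gen T x)).
Hypotheses (PD : forall u v, P u -> P v -> P (u + v)) (PN : forall u, P u -> P (- u)).

(** Elements are classes of integer formal sums: sums of generators give natural multiples, negation
    the integral ones. *)
Lemma presented_ind u : P u.
Proof.
have Pnat (x : {classic S}) n : P (pclass T [:: (n%:Z, x)]).
  elim: n => [|n IHn].
    suff -> : pclass T [:: (0%:Z, x)] = 0 by [].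
    by apply: presented_ext => M f Tf; rewrite peval_pi // peval0 // /fsum_eval big_seq1.
  suff -> : pclass T [:: (n.+1%:Z, x)] = gen T x + pclass T [:: (n%:Z, x)] by apply: PD.
  apply: presented_ext => M f Tf; rewrite [RHS]pevalD // fsum_eval_gen // !peval_pi //.
  by rewrite /fsum_eval !big_seq1 /= -!pmulrn mulrS.
have Pint (x : {classic S}) z : P (pclass T [:: (z, x)]).
  case: z => n; first exact: Pnat.
  suff -> : pclass T [:: (Negz n, x)] = - pclass T [:: (n.+1%:Z, x)] by apply: PN.
  apply: presented_ext => M f Tf; rewrite [RHS]pevalN // !peval_pi //.
  by rewrite /fsum_eval !big_seq1 /= NegzE mulrNz.
rewrite -[u]reprK; elim: (repr u) => [|[z x] s IHs]; first exact: P0.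
change (P (pclass T ((z, x) :: s))).
suff -> : pclass T ((z, x) :: s) = pclass T [:: (z, x)] + pclass T s by apply: PD.
apply: presented_ext => M f Tf; rewrite [RHS]pevalD // !peval_pi //.
by rewrite /fsum_eval big_cons big_seq1.
Qed.

End PresentedInduction.

Section AdditiveFunctions.
Variables (k : closedFieldType) (C : fusionCat k).

(** A weak inverse of p is a section because p is epic; the complement of [s ∘ p] factors through
    the kernel. *)
Lemma fusion_exact_split (X Y Z : C) (i : hom X Y) (p : hom Y Z) : short_exact i p ->
  exists (r : hom Y X) (s : hom Z Y),
    [/\ r ∘ i = idm X, p ∘ s = idm Z & i ∘ r + s ∘ p = idm Y].
Proof.
move=> [[pi0 ker] [_ coker]].
have [s psp] := fusion_regular p.
have ps : p ∘ s = idm Z.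
  have [w [_ wU]] := coker _ p pi0.
  by rewrite -(wU (p ∘ s) psp) (wU (idm Z) (comp1m p)).
have [|r [ir rU]] := ker _ (idm Y - s ∘ p).
  by rewrite compBr compm1 compA psp subrr.
exists r, s; split=> //; last by rewrite ir subrK.
have [w [_ wU]] := ker _ i pi0.
rewrite -(wU (r ∘ i)) -?(wU (idm X) (compm1 i)) // compA ir compBl comp1m -compA pi0.
by rewrite comp0r subr0.
Qed.

Lemma biproduct_exact (X Y Z : C) (i : hom X Y) (p : hom Y Z) (r : hom Y X) (s : hom Z Y) :
  r ∘ i = idm X -> p ∘ s = idm Z -> p ∘ i = 0 -> i ∘ r + s ∘ p = idm Y -> short_exact i p.
Proof.
move=> ri ps pi0 irsp; split; split=> // W h h0.
  exists (r ∘ h); split=> [|u iu]; last by rewrite -iu compA ri comp1m.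
  by rewrite -[RHS]comp1m -irsp compDl -(compA s) h0 comp0r addr0 compA.
exists (h ∘ s); split=> [|u up]; last by rewrite -up -compA ps compm1.
by rewrite -[RHS]compm1 -irsp compDr (compA h i) h0 comp0l add0r compA.
Qed.

Lemma additive_direct_sum (M : zmodType) (f : C -> M) n (S : 'I_n -> C) X :
  additive_function f -> is_direct_sum S X -> f X = \sum_a f (S a).
Proof.
move=> [fiso fex]; elim: n S X => [|n IHn] S X [i [p [pi1 pi0 ip]]].
  rewrite big_ord0 in ip; rewrite big_ord0.
  (* Here X is zero, so its identity taken twice is short exact and f X = f X + f X. *)
  have X0 : short_exact (idm X) (idm X).
    apply: (@biproduct_exact _ _ _ _ _ (idm X) (idm X)); rewrite ?comp1m -?ip ?addr0 //.
  by have /eqP := fex _ _ _ _ _ X0; rewrite -subr_eq subrr => /eqP.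
have ee : (idm X - i ord0 ∘ p ord0) ∘ (idm X - i ord0 ∘ p ord0) = idm X - i ord0 ∘ p ord0.
  by rewrite compBl comp1m compBr compm1 -compA (compA (p _)) pi1 comp1m subrr subr0.
(* Y is the complement of the first summand, hence a direct sum of the others. *)
have [Y [u [v [vu uv]]]] := fusion_split ee.
have vi : v ∘ i ord0 = 0.
  rewrite -[v]comp1m -vu -(compA v) uv -compA compBl comp1m -compA pi1 compm1 subrr.
  by rewrite comp0r.
have pu : p ord0 ∘ u = 0.
  rewrite -[u]compm1 -vu (compA u) uv compA compBr compm1 compA pi1 comp1m subrr.
  by rewrite comp0l.
rewrite big_ord_recl -(IHn (fun a => S (lift ord0 a)) Y).
  apply: (fex _ _ _ (i ord0) v).
  by apply: (biproduct_exact (pi1 ord0) vu vi); rewrite uv addrC subrK.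
have lift0 a : lift ord0 a <> ord0 :> 'I_n.+1 by apply/eqP; rewrite eq_sym neq_lift.
exists (fun a => v ∘ i (lift ord0 a)), (fun a => p (lift ord0 a) ∘ u); split.
- move=> a; rewrite compA -(compA (p _)) uv compBr compm1 compBl pi1 !compA.
  by rewrite pi0 ?comp0l ?subr0 // => /esym/lift0.
- move=> a b ab; rewrite compA -(compA (p _)) uv compBr compm1 compBl !compA.
  rewrite (pi0 ord0) ?comp0l ?subr0; last by move=> /esym/lift0.
  by rewrite pi0 // => /lift_inj.
- have -> : idm Y = v ∘ (\sum_a (i a ∘ p a)) ∘ u by rewrite ip compm1 vu.
  rewrite big_ord_recl compDr compDl !compA vi !comp0l add0r comp_sumr comp_suml.
  by apply: eq_bigr => a _; rewrite !compA.
Qed.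

(** The multiplicities are chosen before f, so the same ones serve for [ch] and for [Grk_class]. *)
Lemma additive_rep_sum m (V : 'I_m.+1 -> C) X :
  simple_representatives V -> exists c : 'I_m.+1 -> nat,
  forall (M : zmodType) (f : C -> M), additive_function f -> f X = \sum_l f (V l) *+ c l.
Proof.
move=> [_ _ _ hV]; have [n [S [sS dS]]] := fsemisimple X.
have /choice [s sE] a : exists i, isomorphic (S a) (V i) by exact: hV.
exists (fun l => #|[pred a | s a == l]|) => N g ga.
rewrite (additive_direct_sum ga dS) (partition_big s xpredT) //=.
apply: eq_bigr => l _; rewrite -sumr_const; apply: eq_bigr => a /eqP <-.
by case: ga => + _; apply.
Qed.

End AdditiveFunctions.

Section CharacterAlgebra.
Variables (k : closedFieldType) (C : fusionCat k) (j : pivotal C).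
Variables (m : nat) (V : 'I_m.+1 -> C).
Hypothesis hV : simple_representatives V.
Variable D : direct_sum_data (fun l => V l ⊗ dual (V l)).
Local Notation I := (tunit C).
Local Notation J := (dsum D).
Local Notation pi := (pi hV D).
Local Notation sigma := (sigma hV D).
Local Notation ZC := (drinfeldCenter C).
Local Notation JZ := (canonical hV D : ZC).
Implicit Types X Y Z : C.

(* The paper's internal character of [X]. *)
Definition ch X : hom J I := ptr j (lunitV X ∘ pi X).

Lemma ch_additive : additive_function ch.
Proof.
(* [t] is a cyclic trace with t(1) = [ch]; splitting the sequence, t(1_Y) = t(i r) + t(s p) = t(r i)
   + t(p s). *)
pose t X (f : hom X X) := ptr j ((I ◁ f) ∘ (lunitV X ∘ pi X)).
have t_cyc X Y (f : hom X Y) (g : hom Y X) : t _ (g ∘ f) = t _ (f ∘ g).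
  rewrite /t tensmr -compA ptr_cyclic; congr (ptr j _).
  by rewrite tensmr -!compA -pi_nat (compA (lunitV X)) lunitV_nat -!compA.
have t_id X : t X (idm X) = ch X by rewrite /t tensm1 comp1m.
split=> [X Y [f [g [gf fg]]]|X Y Z i p ip]; first by rewrite -!t_id -gf -fg t_cyc.
have [r [s [ri ps irsp]]] := fusion_exact_split ip.
rewrite -!t_id -irsp -ri -ps (t_cyc _ _ i) -(t_cyc _ _ p) /t.
by rewrite tensDr compDl ptrE tensDl compDr compDl -!ptrE.
Qed.

Lemma ch_rep l : ch (V l) = pev j (V l) ∘ proj D l.
Proof.
rewrite /ch pi_rep compA ptr_compr; congr (_ ∘ _).
rewrite ptrE tensml -!compA triangler2 ?compm1; last exact: dualP.
by rewrite evr_unit -compA -tensml lunitVK tensm1 compm1.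
Qed.

Lemma ch_free (c : 'I_m.+1 -> k) : \sum_l c l *: ch (V l) = 0 -> forall l, c l = 0.
Proof.
move=> c0 l; have := congr1 (fun x => x ∘ inj D l) c0.
rewrite comp0l comp_suml (bigD1 l) //= big1 ?addr0; last first.
  by move=> i /eqP il; rewrite ch_rep compZl -compA proj0 ?comp0r ?scaler0 // => /esym.
rewrite ch_rep compZl -compA projK compm1 => /eqP; rewrite scaler_eq0 => /orP [/eqP //|/eqP e0].
case: (rep_simple hV l) => n0 _; case: n0.
by case: (pdualP j (V l)) => _; rewrite e0 tens0l comp0r !comp0l => /esym.
Qed.

Lemma ch_span (phi : hom J I) : exists c, phi = \sum_l c l *: ch (V l).
Proof.
have /choice [c cE] l : exists a, phi ∘ inj D l = a *: pev j (V l).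
  exact: simple_evr (pdualP j (V l)) (rep_simple hV l).
exists c; rewrite -[LHS]compm1 -(injK D) comp_sumr; apply: eq_bigr => l _.
by rewrite ch_rep compA cE compZl.
Qed.

(* Under Hom_C(J, 1) = End_Z(J) the left-hand side is composition. *)
Lemma ch_tensor X Y : ch X ∘ sharp hV D (Z := JZ) (ch Y) = ch (X ⊗ Y).
Proof.
rewrite /ch -ptr_compr -(compA (lunitV X)) sharpE /=.
transitivity (ptr j (lunitV X ∘ ptr j (pi (X ⊗ Y) ∘ assoc J X Y))).
  (* The trace over Y is pulled out of [X ◁ _], after which [sigmaE] fuses the two universal
     families into the one at X ⊗ Y. *)
  congr (ptr j (lunitV X ∘ _)).
  rewrite -ptr_tens -ptr_compl -ptr_compr; congr (ptr j _).
  rewrite !compA triangle_assocV -tensmr !compA lunitVK comp1m.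
  exact: sigmaE.
rewrite ptr_tensor -ptr_compl; congr (ptr j (ptr j _)).
by rewrite lunitV_tens !compA assocK comp1m.
Qed.

Lemma ch_endo X : exists e : hom JZ JZ, sublmod_val e = sharp hV D (Z := JZ) (ch X).
Proof. by have [e eE] := center_mk (sharp_center hV D (Z := JZ) (ch X)); exists e. Qed.

Lemma counit_inj (e f : hom JZ JZ) :
  counit hV D ∘ sublmod_val e = counit hV D ∘ sublmod_val f -> e = f.
Proof.
move=> ef; apply: center_val_inj; apply: (center_ext (hV := hV)) ef.
  exact: (sublmodP e).
exact: (sublmodP f).
Qed.

Lemma canonical_commutative :
  commutative_end JZ <-> forall X Y, ch (X ⊗ Y) = ch (Y ⊗ X).
Proof.
pose E X := sval (cid (ch_endo X)).
have EE X : sublmod_val (E X) = sharp hV D (Z := JZ) (ch X) := svalP (cid (ch_endo X)).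
have cE X : counit hV D ∘ sublmod_val (E X) = ch X by rewrite EE counit_sharp.
have EM X Y : counit hV D ∘ sublmod_val (E X ∘ E Y) = ch (X ⊗ Y).
  by rewrite /= compA cE EE ch_tensor.
split=> [cJ X Y|chC e f]; first by rewrite -!EM cJ.
(* An endomorphism is determined by its composite with [counit], so the spanning characters lift to
   spanning endomorphisms. *)
have spanE (g : hom JZ JZ) : exists c, g = \sum_l c l *: E (V l).
  have [c cg] := ch_span (counit hV D ∘ sublmod_val g); exists c.
  apply: counit_inj; rewrite cg (linear_map_sum (f := @sublmod_val _ _ _ _)) // comp_sumr.
  by apply: eq_bigr => l _; rewrite -cE -compZr.
have EC X Y : E X ∘ E Y = E Y ∘ E X by apply: counit_inj; rewrite !EM.
have [c ->] := spanE e; have [d ->] := spanE f.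
rewrite !comp_suml; under eq_bigr do rewrite comp_sumr.
under [RHS]eq_bigr do rewrite comp_sumr.
rewrite exchange_big; apply: eq_bigr => l _; apply: eq_bigr => i _.
by rewrite !(compZl, compZr) EC !scalerA mulrC.
Qed.

End CharacterAlgebra.

(** * The Grothendieck algebra *)

Section ScalarExtension.
Variables (K : comPzRingType) (G : pzRingType).

Lemma pureDr (a : K) (x y : G) : pure a (x + y) = pure a x + pure a y.
Proof.
apply: presented_ext => M f Tf; rewrite [RHS]pevalD // !fsum_eval_gen //.
by case: Tf => _ ->.
Qed.

Lemma pure0 (a : K) : pure a (0 : G) = 0.
Proof. by apply: (addrI (pure a 0)); rewrite -pureDr !addr0. Qed.

Lemma pureN (a : K) (x : G) : pure a (- x) = - pure a x.
Proof. by apply: (addrI (pure a x)); rewrite -pureDr !subrr pure0. Qed.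

Lemma pure_scale (a : K) (x : G) : pure a x = a *: pure 1 x.
Proof. by rewrite pureZ mulr1. Qed.

End ScalarExtension.

Section GrothendieckAlgebra.
Variables (k : closedFieldType) (C : fusionCat k).

Definition Grk_class (X : C) : Grk C := pure 1 (Grclass X).

Lemma Grk_classM (X Y : C) : Grk_class X * Grk_class Y = Grk_class (X ⊗ Y).
Proof. by rewrite /Grk_class [LHS]pureM mulr1 GrclassM. Qed.

Lemma Grk_class_additive : additive_function Grk_class.
Proof.
split=> [X Y XY|X Y Z i p ip]; rewrite /Grk_class; first by rewrite (Grclass_iso XY).
by rewrite (Grclass_exact ip) pureDr.
Qed.

Lemma Grk_commutative : (forall X Y : C, Grk_class (X ⊗ Y) = Grk_class (Y ⊗ X)) ->
  forall x y : Grk C, x * y = y * x.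
Proof.
move=> cXY.
pose commutes (u v : Grk C) := u * v = v * u.
(* Used once in each variable; inside, scalars are pulled out and the induction runs first over Gr,
   then over elementary tensors. *)
have ind (v : Grk C) : (forall X, commutes (Grk_class X) v) -> forall u, commutes u v.
  move=> cv; have cpure x a : commutes (pure a x) v.
    rewrite /commutes [pure a x]pure_scale -[LHS]ext_scaleAl -[RHS]ext_scaleAr.
    congr (_ *: _); move: x; apply: presented_ind.
    - by rewrite pure0 mul0r mulr0.
    - exact: cv.
    - by move=> x y xv yv; rewrite pureDr mulrDl mulrDr xv yv.
    - by move=> x xv; rewrite pureN mulNr mulrN xv.
  apply: presented_ind.
  - by rewrite /commutes mul0r mulr0.
  - by case=> a x; apply: cpure.
  - by move=> x y xv yv; rewrite /commutes mulrDl mulrDr xv yv.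
  - by move=> x xv; rewrite /commutes mulNr mulrN xv.
move=> x y; apply: (ind y) => X; apply/esym; apply: (ind (Grk_class X)) => Y.
by rewrite /commutes !Grk_classM.
Qed.

Variables (j : pivotal C) (m : nat) (V : 'I_m.+1 -> C).
Hypothesis hV : simple_representatives V.
Variable D : direct_sum_data (fun l => V l ⊗ dual (V l)).
Local Notation ch := (ch j hV D).

(** One way, [ch] extends to Gr_k by the biadditive [F]. Conversely, independence of the [ch (V l)]
    equates the multiplicities in X ⊗ Y and Y ⊗ X as elements of k, which suffices in Gr_k. *)
Lemma Grk_commutative_ch : (forall x y : Grk C, x * y = y * x) <->
  forall X Y, ch (X ⊗ Y) = ch (Y ⊗ X).
Proof.
have chA := ch_additive j hV D.
split=> [cG X Y|cT].
  pose F (u : k * Gr C) := u.1 *: peval ch u.2.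
  have FA : biadditive F.
    by split=> [a b x|a x y]; rewrite /F /= ?scalerDl // pevalD // scalerDr.
  have FE Z : peval F (Grk_class Z) = ch Z.
    by rewrite /Grk_class fsum_eval_gen // /F /= fsum_eval_gen // scale1r.
  by rewrite -!FE -!Grk_classM cG.
apply: Grk_commutative => X Y.
have [c cE] := additive_rep_sum (X ⊗ Y) hV; have [d dE] := additive_rep_sum (Y ⊗ X) hV.
have cd l : (c l)%:R = (d l)%:R :> k.
  apply: subr0_eq; move: l; apply: (ch_free (j := j) (hV := hV) (D := D)).
  under eq_bigr do rewrite scalerBl !scaler_nat.
  by rewrite sumrB -cE // -dE // cT subrr.
rewrite (cE _ _ Grk_class_additive) (dE _ _ Grk_class_additive).
by apply: eq_bigr => l _; rewrite -!scaler_nat cd.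
Qed.

End GrothendieckAlgebra.

Theorem theorem6p6 (k : closedFieldType) (C : fusionCat k) (j : pivotal C)
    (hC : nondegenerate_pivotal j)
    (R : functor C (drinfeldCenter C)) (hR : right_adjoint (forget C) R) :
  multiplicity_free (R (tunit C)) <->
  (forall x y : Grk C, x * y = y * x).
Proof.
have [m [V [hV dimC]]] := hC.
have [J [inj [proj [projK proj0 injK]]]] := fin_direct_sum (fun l => V l ⊗ dual (V l)).
pose D := DirectSumData projK proj0 injK.
have RJ := adjoint_canonical hV D hR.
have reg := center_regular hV dimC D.
have spl := @center_split k C; have eig := @center_eigenvalues k C.
rewrite (Grk_commutative_ch j hV D) -(canonical_commutative j hV D).
split=> [mf|cJ].
  apply: (multiplicity_free_commutative (regular_schur reg spl) eig).
  exact: multiplicity_free_iso RJ mf.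
have [mu rk] := center_rank C.
apply: (multiplicity_free_iso (isomorphic_sym RJ)).
exact: (commutative_multiplicity_free rk reg spl eig).
Qed.
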